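(* Assume the intruder model is effective and absorbing. Given two limits $L_1,L_2$, it is decidable whether $[\![L_1]\!]\subseteq[\![L_2]\!]$.
   Context: Intruder model $(\Sigma,\vdash)$: finite signature of constructors; messages are terms over a countably infinite set of names; $\mathrm{names}(M)$ the names of $M$; $\vdash$ relates finite sets of messages to messages and satisfies identity, monotonicity, cut, constructibility $\{M_1,\dots,M_n\}\vdash f(M_1,\dots,M_n)$, invariance under injective renamings of names, and relevancy ($\Gamma\cup\{a\}\vdash M$ with $a$ a name not in $\Gamma,M$ implies $\Gamma\vdash M$). Effective: $\vdash$ is decidable. Absorbing: for lists $\vec x,\vec y$ of pairwise distinct names, finite $\Gamma$ with $\mathrm{names}(\Gamma)\cap\vec y=\emptyset$, $\Gamma'=\Gamma\{\vec x\mapsto\vec y\}$, and every $M$ with $\mathrm{names}(M)\subseteq\mathrm{names}(\Gamma)$: $\Gamma\cup\Gamma'\vdash M$ iff $\Gamma\vdash M$. $\Gamma_1\preceq\Gamma_2$ iff every message derivable from $\Gamma_1$ is derivable from $\Gamma_2$. Processes: $P::=0\mid\nu x.P\mid P\parallel P\mid\langle M\rangle\mid\mathsf Q[\vec M]$ over a finite set of process identifiers; $\langle\Gamma\rangle$ is the parallel composition of $\langle M\rangle$, $M\in\Gamma$. $\equiv$: smallest congruence with $\alpha$-equivalence, AC of $\parallel$ with neutral $0$, $\nu a.0\equiv0$, $\nu a.\nu b.P\equiv\nu b.\nu a.P$, $P\parallel\nu a.Q\equiv\nu a.(P\parallel Q)$ if $a$ not free in $P$. Knowledge embedding $P_1\sqsubseteq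 P_2$ iff $P_1\equiv\nu\vec x.(\langle\Gamma_1\rangle\parallel Q)$, $P_2\equiv\nu\vec x.\nu\vec y.(\langle\Gamma_2\rangle\parallel Q\parallel Q')$ with $Q,Q'$ parallel compositions of calls and $\Gamma_1\preceq\Gamma_2$. Limits: $L::=0\mid R_1\parallel\dots\parallel R_n$, $R::=B\mid B^\omega$, $B::=\langle M\rangle\mid\mathsf Q[\vec M]\mid\nu x.L$. Instances: $\mathrm{inst}(0)=\{0\}$, $\mathrm{inst}(\langle M\rangle)=\{\langle M\rangle\}$, $\mathrm{inst}(\mathsf Q[\vec M])=\{\mathsf Q[\vec M]\}$, $\mathrm{inst}(L_1\parallel L_2)=\{P_1\parallel P_2\mid P_i\in\mathrm{inst}(L_i)\}$, $\mathrm{inst}(\nu x.L)=\{\nu x.P\mid P\in\mathrm{inst}(L)\}$, $\mathrm{inst}(B^\omega)=\bigcup_n\{P_1\parallel\dots\parallel P_n\mid P_i\in\mathrm{inst}(B)\}$; the denotation $[\![L]\!]$ is the $\sqsubseteq$-downward closure of $\mathrm{inst}(L)$. *)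

(* Defs.v *)
From Stdlib Require List.
From HB Require Import structures.
From mathcomp Require Import all_boot.


Set Implicit Arguments.
Unset Strict Implicit.
Unset Printing Implicit Defensive.

(* A model of computation: Kleene's partial mu-recursive functions on nat.  *)
(* Used to express "decidable" (classical logic would trivialise a mere     *)
(* existence of a boolean decision function).                               *)

Inductive prog : Type :=
| PrZero
| PrSucc
| PrProj (i : nat)
| PrComp (f : prog) (gs : seq prog)
| PrRec (f g : prog)
| PrMu (f : prog).

Inductive eval : prog -> seq nat -> nat -> Prop :=
| ev_zero xs : eval PrZero xs 0
| ev_succ xs : eval PrSucc xs (head 0 xs).+1
| ev_proj i xs : eval (PrProj i) xs (nth 0 xs i)
| ev_comp f gs xs ys y : evals gs xs ys -> eval f ys y -> eval (PrComp f gs) xs y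
| ev_rec0 f g xs y : eval f xs y -> eval (PrRec f g) (0 :: xs) y
| ev_recS f g n xs z y :
    eval (PrRec f g) (n :: xs) z -> eval g (n :: z :: xs) y ->
    eval (PrRec f g) (n.+1 :: xs) y
| ev_mu f xs n :
    eval f (n :: xs) 0 -> (forall m, m < n -> exists k, eval f (m :: xs) k.+1) ->
    eval (PrMu f) xs n
with evals : seq prog -> seq nat -> seq nat -> Prop :=
| evs_nil xs : evals [::] xs [::]
| evs_cons g gs xs y ys : eval g xs y -> evals gs xs ys -> evals (g :: gs) xs (y :: ys).

Definition decidable2 (A B : Type) (cA : A -> nat) (cB : B -> nat)
  (R : A -> B -> Prop) : Prop :=
  exists p : prog, forall a b,
    (R a b -> eval p [:: cA a; cB b] 1) /\ (~ R a b -> eval p [:: cA a; cB b] 0).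

Section Intruder.

(* Finite signature: constructors 0, ..., nc-1, constructor f has arity ar f. *)
Variables (nc : nat) (ar : nat -> nat).
(* Finite set of process identifiers: 'I_nq. *)
Variable nq : nat.

(* Messages: terms over names (nat) and the signature, represented as      *)
(* GenTree.tree nat: Leaf a is the name a, Node f [:: M1; ..; Mn] is        *)
(* f(M1, ..., Mn); well-formedness enforces the signature.                  *)

Fixpoint wf_term (t : GenTree.tree nat) : bool :=
  match t with
  | GenTree.Leaf _ => true
  | GenTree.Node f ts => [&& f < nc, size ts == ar f & all wf_term ts]
  end.

Definition msg := {t : GenTree.tree nat | wf_term t}.

Fixpoint tnames (t : GenTree.tree nat) : seq nat :=
  match t with
  | GenTree.Leaf a => [:: a]
  | GenTree.Node _ ts => flatten (map tnames ts)
  end.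

Fixpoint tren (rho : nat -> nat) (t : GenTree.tree nat) : GenTree.tree nat :=
  match t with
  | GenTree.Leaf a => GenTree.Leaf (rho a)
  | GenTree.Node f ts => GenTree.Node f (map (tren rho) ts)
  end.

Lemma wf_leaf a : wf_term (GenTree.Leaf a). Proof. by []. Qed.

Definition mname (a : nat) : msg := exist _ (GenTree.Leaf a) (wf_leaf a).

Definition mnames (M : msg) : seq nat := tnames (val M).
Definition names (G : seq msg) : seq nat := flatten (map mnames G).

(* renaming of names in a message (renaming preserves well-formedness, so  *)
(* the default of insubd is never used) *)
Definition mren (rho : nat -> nat) (M : msg) : msg :=
  insubd (mname 0) (tren rho (val M)).

(* f(M1, ..., Mn) (meaningful when f < nc and n = ar f) *)
Definition mapp (f : nat) (Ms : seq msg) : msg :=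
  insubd (mname 0) (GenTree.Node f (map val Ms)).

Definition nsubst (xs ys : seq nat) (a : nat) : nat :=
  if a \in xs then nth a ys (index a xs) else a.

(* Intruder model: |- relates finite sets of messages (given as finite      *)
(* sequences; by monotonicity |- only depends on the underlying set) to     *)
(* messages.                                                                *)

Definition intruder_model (der : seq msg -> msg -> Prop) : Prop :=
  (forall G M, M \in G -> der G M) /\
  [/\
      (forall G G' M, {subset G <= G'} -> der G M -> der G' M),
      (forall G M N, der G M -> der (M :: G) N -> der G N),
      (forall f Ms, f < nc -> size Ms = ar f -> der Ms (mapp f Ms)),
      (forall rho G M, injective rho -> der G M -> der (map (mren rho) G) (mren rho M))
    &
      (forall G a M, a \notin names G -> a \notin mnames M ->
         der (mname a :: G) M -> der G M)].

Definition effective (der : seq msg -> msg -> Prop) : Prop :=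
  decidable2 (@pickle _ : seq msg -> nat) (@pickle _ : msg -> nat) der.

Definition absorbing (der : seq msg -> msg -> Prop) : Prop :=
  forall (xs ys : seq nat) (G : seq msg) (M : msg),
    uniq xs -> uniq ys -> size xs = size ys ->
    all (fun y => y \notin names G) ys ->
    {subset mnames M <= names G} ->
    (der (G ++ map (mren (nsubst xs ys)) G) M <-> der G M).

Definition preceq (der : seq msg -> msg -> Prop) (G1 G2 : seq msg) : Prop :=
  forall M, der G1 M -> der G2 M.

Inductive proc : Type :=
| P0
| PNu (x : nat) (P : proc)
| PPar (P Q : proc)
| POut (M : msg)
| PCall (q : 'I_nq) (args : seq msg).

Fixpoint fn (P : proc) : seq nat :=
  match P with
  | P0 => [::]
  | PNu x P => [seq a <- fn P | a != x]
  | PPar P Q => fn P ++ fn Q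
  | POut M => mnames M
  | PCall _ args => names args
  end.

Definition nswap (x y a : nat) : nat := if a == x then y else if a == y then x else a.

(* swapping of two names everywhere (binders included): nominal alpha-renaming *)
Fixpoint pswap (x y : nat) (P : proc) : proc :=
  match P with
  | P0 => P0
  | PNu z P => PNu (nswap x y z) (pswap x y P)
  | PPar P Q => PPar (pswap x y P) (pswap x y Q)
  | POut M => POut (mren (nswap x y) M)
  | PCall q args => PCall q (map (mren (nswap x y)) args)
  end.

Inductive sc : proc -> proc -> Prop :=
| sc_refl P : sc P P
| sc_sym P Q : sc P Q -> sc Q P
| sc_trans P Q R : sc P Q -> sc Q R -> sc P R
| sc_nu x P Q : sc P Q -> sc (PNu x P) (PNu x Q)
| sc_parl P P' Q : sc P P' -> sc (PPar P Q) (PPar P' Q)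
| sc_parr P Q Q' : sc Q Q' -> sc (PPar P Q) (PPar P Q')
| sc_alpha x y P : y \notin fn (PNu x P) -> sc (PNu x P) (PNu y (pswap x y P))
| sc_assoc P Q R : sc (PPar P (PPar Q R)) (PPar (PPar P Q) R)
| sc_comm P Q : sc (PPar P Q) (PPar Q P)
| sc_zero P : sc (PPar P P0) P
| sc_nu0 a : sc (PNu a P0) P0
| sc_nunu a b P : sc (PNu a (PNu b P)) (PNu b (PNu a P))
| sc_ext a P Q : a \notin fn P -> sc (PPar P (PNu a Q)) (PNu a (PPar P Q)).

Definition nus (xs : seq nat) (P : proc) : proc := foldr PNu P xs.
Definition outs (G : seq msg) : proc := foldr (fun M P => PPar (POut M) P) P0 G.
Definition calls (Q : seq ('I_nq * seq msg)) : proc :=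
  foldr (fun c P => PPar (PCall c.1 c.2) P) P0 Q.

Definition kemb (der : seq msg -> msg -> Prop) (P1 P2 : proc) : Prop :=
  exists (xs ys : seq nat) (G1 G2 : seq msg) (Q Q' : seq ('I_nq * seq msg)),
    [/\ sc P1 (nus xs (PPar (outs G1) (calls Q))),
        sc P2 (nus xs (nus ys (PPar (PPar (outs G2) (calls Q)) (calls Q'))))
      & preceq der G1 G2].

(* L ::= 0 | R1 || ... || Rn  (LNil = 0, LCons R L = R || L)
   R ::= B | B^omega
   B ::= <M> | Q[Ms] | nu x. L *)
Inductive lim : Type :=
| LNil
| LCons (r : rep) (l : lim)
with rep : Type :=
| RB (b : blk)
| ROm (b : blk)
with blk : Type :=
| BOut (M : msg)
| BCall (q : 'I_nq) (args : seq msg)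
| BNu (x : nat) (l : lim).

Fixpoint parl (ps : seq proc) : proc :=
  match ps with
  | [::] => P0
  | p :: ps' => match ps' with [::] => p | _ => PPar p (parl ps') end
  end.

Fixpoint inst_lim (l : lim) (P : proc) {struct l} : Prop :=
  match l with
  | LNil => P = P0
  | LCons r l' =>
      match l' with
      | LNil => inst_rep r P
      | _ => exists P1 P2, [/\ P = PPar P1 P2, inst_rep r P1 & inst_lim l' P2]
      end
  end
with inst_rep (r : rep) (P : proc) {struct r} : Prop :=
  match r with
  | RB b => inst_blk b P
  | ROm b => exists ps : seq proc,
      (forall p, List.In p ps -> inst_blk b p) /\ P = parl ps
  end
with inst_blk (b : blk) (P : proc) {struct b} : Prop :=
  match b with
  | BOut M => P = POut M
  | BCall q args => P = PCall q args
  | BNu x l => exists P', P = PNu x P' /\ inst_lim l P'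
  end.

Definition den (der : seq msg -> msg -> Prop) (l : lim) (P : proc) : Prop :=
  exists P', inst_lim l P' /\ kemb der P P'.

Fixpoint enc_lim (l : lim) : GenTree.tree nat :=
  match l with
  | LNil => GenTree.Node 0 [::]
  | LCons r l => GenTree.Node 1 [:: enc_rep r; enc_lim l]
  end
with enc_rep (r : rep) : GenTree.tree nat :=
  match r with
  | RB b => GenTree.Node 2 [:: enc_blk b]
  | ROm b => GenTree.Node 3 [:: enc_blk b]
  end
with enc_blk (b : blk) : GenTree.tree nat :=
  match b with
  | BOut M => GenTree.Node 4 [:: val M]
  | BCall q args => GenTree.Node 5 (GenTree.Leaf (val q) :: map val args)
  | BNu x l => GenTree.Node 6 [:: GenTree.Leaf x; enc_lim l]
  end.

Definition code_lim (l : lim) : nat := pickle (enc_lim l).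

End Intruder.

(* Main.v *)
Require Import Defs.
From Stdlib Require Import ClassicalEpsilon.
From HB Require Import structures.
From mathcomp Require Import all_boot zify.

(** Flattening an instance of a limit gives a set of bound names and a multiset
    of outputs and calls.  With the free names of the larger process treated as
    constants, knowledge embedding is an injective renaming that fixes these
    constants, makes every output derivable and injects calls into calls; all
    other names, even free names of the smaller process, may be mapped to bound
    names.  Hence an inclusion has to be checked for the instances of L1 whose
    binders receive arbitrary names, including free names of L2.

    Two bounds make this a finite check.  (1) Replace the outermost replications
    of L1 by N copies.  An embedding into an instance of L2 of what lies outside
    these copies fixes only a bounded part of that instance; if N exceeds the
    size of this part, some copy is mapped outside it, and duplicating the rest
    of the instance makes room for one more copy.  So N copies are covered only
    if any number is, and repeating this eliminates all replications of L1.
    (2) By absorption, copies of a block of L2 that an embedding does not touch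
    add no knowledge to a single copy, so for a given process it suffices to
    unfold each replication of L2 more often than the process has names and
    calls.

    The resulting procedure is shown to be mu-recursive by closure properties of
    the functions computable on codes. *)

Set Implicit Arguments.
Unset Strict Implicit.
Unset Printing Implicit Defensive.

(** * Computable functions on codes *)

(** Free names of the smaller process may be mapped to bound names because the inner binders [ys] of
    [kemb] can capture them; rigid are only the names that occur free in the chosen instance of the
    larger limit. That set varies with the instance, since a replication may contribute no copy.
    Hence a set of free names is guessed, and [prune] deletes every replication whose block cannot
    do without some other free name.

    Pumping exchanges copies of a block, so the copies must be renamings of one another, which fails
    when nested replications are unfolded differently in them. For this reason nested replications
    are unfolded uniformly by [full n], for an arbitrary [n], while only the number of outermost
    copies is lowered; [flat_grow] shows that every instance is part of such a uniform one. Once the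
    outermost replications are gone, those nested in them have become outermost in an enlarged
    template, and the bound is computed afresh from it. *)

Lemma eval_comp1 f g xs y z :
  eval g xs y -> eval f [:: y] z -> eval (PrComp f [:: g]) xs z.
Proof. by move=> h; apply: ev_comp; do !constructor. Qed.

Lemma eval_comp2 f g1 g2 xs y1 y2 z :
  eval g1 xs y1 -> eval g2 xs y2 -> eval f [:: y1; y2] z ->
  eval (PrComp f [:: g1; g2]) xs z.
Proof. by move=> h1 h2; apply: ev_comp; do !constructor. Qed.

Lemma eval_rec (r : nat -> nat) f g n xs :
  eval f xs (r 0) -> (forall k, k < n -> eval g (k :: r k :: xs) (r k.+1)) ->
  eval (PrRec f g) (n :: xs) (r n).
Proof.
move=> h0; elim: n => [|n IHn] hS; first exact: ev_rec0.
by apply: ev_recS (IHn _) (hS n _) => // k ltkn; apply: hS; apply: leqW.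
Qed.

Lemma eval_proj i xs y : nth 0 xs i = y -> eval (PrProj i) xs y.
Proof. by move<-; constructor. Qed.

Definition pr_one := PrComp PrSucc [:: PrZero].
Lemma eval_one xs : eval pr_one xs 1.
Proof. by apply: (eval_comp1 (y := 0)); constructor. Qed.

Definition pr_isz := PrRec pr_one PrZero.
Lemma eval_isz n xs : eval pr_isz (n :: xs) (n == 0).
Proof.
by apply: (@eval_rec (fun n => n == 0)) => [|k _]; [exact: eval_one | constructor].
Qed.

Definition pr_add := PrRec (PrProj 0) (PrComp PrSucc [:: PrProj 1]).
Lemma eval_add n m : eval pr_add [:: n; m] (n + m).
Proof.
apply: (@eval_rec (fun n => n + m)) => [|k _]; first by constructor.
by apply: (eval_comp1 (y := k + m)); [apply: eval_proj | constructor].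
Qed.

Definition pr_mul := PrRec PrZero (PrComp pr_add [:: PrProj 2; PrProj 1]).
Lemma eval_mul n m : eval pr_mul [:: n; m] (n * m).
Proof.
apply: (@eval_rec (fun n => n * m)) => [|k _]; first by constructor.
by rewrite mulSn; apply: (eval_comp2 _ _ (eval_add _ _)); apply: eval_proj.
Qed.

Definition pr_pow2 := PrRec pr_one (PrComp pr_add [:: PrProj 1; PrProj 1]).
Lemma eval_pow2 n xs : eval pr_pow2 (n :: xs) (2 ^ n).
Proof.
apply: (@eval_rec (fun n => 2 ^ n)) => [|k _]; first exact: eval_one.
rewrite expnS mul2n -addnn.
by apply: (eval_comp2 _ _ (eval_add _ _)); apply: eval_proj.
Qed.

(** One step of [CodeSeq.code]: the code of a list is an iterated [ccons] ending in 0, the code of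
    the empty list. *)
Definition ccons n m := 2 ^ n * m.*2.+1.

Definition pr_cons := PrComp pr_mul [:: pr_pow2;
  PrComp PrSucc [:: PrComp pr_add [:: PrProj 1; PrProj 1]]].
Lemma eval_cons n m : eval pr_cons [:: n; m] (ccons n m).
Proof.
apply: (eval_comp2 (eval_pow2 _ _) _ (eval_mul _ _)).
apply: (eval_comp1 (y := m.*2)); last by constructor.
by rewrite -addnn; apply: (eval_comp2 _ _ (eval_add _ _)); apply: eval_proj.
Qed.

Definition pr_odd := PrRec PrZero (PrComp pr_isz [:: PrProj 1]).
Lemma eval_odd n xs : eval pr_odd (n :: xs) (odd n).
Proof.
apply: (@eval_rec (fun n => odd n)) => [|k _]; first by constructor.
apply: eval_comp1; first exact: eval_proj.
by rewrite /= -eqb0; apply: eval_isz.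
Qed.

Definition pr_half :=
  PrRec PrZero (PrComp pr_add [:: PrComp pr_odd [:: PrProj 0]; PrProj 1]).
Lemma eval_half n xs : eval pr_half (n :: xs) n./2.
Proof.
apply: (@eval_rec half) => [|k _]; first by constructor.
rewrite -uphalfE uphalf_half.
apply: (eval_comp2 _ _ (eval_add _ _)); last exact: eval_proj.
by apply: eval_comp1; [apply: eval_proj | apply: eval_odd].
Qed.

Definition pr_halfs := PrRec (PrProj 0) (PrComp pr_half [:: PrProj 1]).
Lemma eval_halfs n c : eval pr_halfs [:: n; c] (iter n half c).
Proof.
apply: (@eval_rec (fun n => iter n half c)) => [|k _]; first by constructor.
by apply: eval_comp1; [apply: eval_proj | apply: eval_half].
Qed.

Lemma half_ccons n m : (ccons n.+1 m)./2 = ccons n m.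
Proof. by rewrite /ccons expnS -mulnA mul2n doubleK. Qed.

Lemma halfs_ccons k n m : k <= n -> iter k half (ccons n m) = ccons (n - k) m.
Proof.
elim: k => [|k IHk] ltkn /=; first by rewrite subn0.
by rewrite IHk ?(ltnW ltkn) // -(subnSK ltkn) half_ccons.
Qed.

(** The head is the exponent of 2 in the code: the least number of halvings that leaves an odd
    number. On 0 the search diverges. *)
Definition pr_hd := PrMu (PrComp pr_isz [:: PrComp pr_odd [:: pr_halfs]]).
Lemma eval_hd n m : eval pr_hd [:: ccons n m] n.
Proof.
have ev k : k <= n ->
  eval (PrComp pr_isz [:: PrComp pr_odd [:: pr_halfs]]) [:: k; ccons n m]
       (k != n).
  move=> lekn; have ->: (k != n) = (odd (iter k half (ccons n m)) == 0 :> nat) :> bool.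
    rewrite halfs_ccons // /ccons oddM oddX /= odd_double /=; lia.
  apply: eval_comp1 (eval_isz _ _); apply: eval_comp1 (eval_odd _ _).
  exact: eval_halfs.
constructor=> [|k ltkn]; first by have := ev n (leqnn n); rewrite eqxx.
by exists 0; have := ev k (ltnW ltkn); rewrite neq_ltn ltkn.
Qed.

Definition pr_tl := PrComp pr_half [:: PrComp pr_halfs [:: pr_hd; PrProj 0]].
Lemma eval_tl n m : eval pr_tl [:: ccons n m] m.
Proof.
apply: eval_comp1.
  apply: eval_comp2; [exact: eval_hd|exact: eval_proj|exact: eval_halfs].
rewrite halfs_ccons // subnn /ccons mul1n.
by rewrite -[X in eval _ _ X](half_bit_double m true) add1n; apply: eval_half.
Qed.

(* A function between coded types is computable when some program maps the
   code of every argument to the code of its value; nothing is required of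
   numbers that are not codes, so programs may diverge on them. *)

Class coded (A : Type) := code : A -> nat.

#[export] Instance coded_nat : coded nat := id.
#[export] Instance coded_bool : coded bool := nat_of_bool.
#[export] Instance coded_prod A B (cA : coded A) (cB : coded B) : coded (A * B) :=
  fun u => ccons (code u.1) (ccons (code u.2) 0).
#[export] Instance coded_seq A (cA : coded A) : coded (seq A) :=
  fun s => CodeSeq.code (map code s).
#[export] Instance coded_tree : coded (GenTree.tree nat) := pickle.

Definition computable A B (cA : coded A) (cB : coded B) (f : A -> B) :=
  exists p, forall a, eval p [:: code a] (code (f a)).
Arguments computable {A B cA cB} f.


Lemma comp_ext G (cG : coded G) A (cA : coded A) (f g : G -> A) : f =1 g -> computable f -> computable g.
Proof. by move=> e [p hp]; exists p => a; rewrite -e. Qed.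

Lemma comp_id G (cG : coded G) : computable (fun g : G => g).
Proof. by exists (PrProj 0) => a; apply: eval_proj. Qed.

Lemma comp_nat G (cG : coded G) (n : nat) : computable (fun _ : G => n).
Proof.
elim: n => [|n IHn]; first by exists PrZero => a; constructor.
have [p hp] := IHn; by exists (PrComp PrSucc [:: p]) => a; apply: eval_comp1 (hp a) _; constructor.
Qed.

Lemma comp_cst G (cG : coded G) A (cA : coded A) (a : A) : computable (fun _ : G => a).
Proof. by have [p hp] := comp_nat cG (code a); exists p. Qed.

Lemma comp_comp G (cG : coded G) A B (cA : coded A) (cB : coded B) (f : G -> A) (h : A -> B) :
  computable h -> computable f -> computable (fun g => h (f g)).
Proof.
move=> [p hp] [q hq]; exists (PrComp p [:: q]) => a.
exact: eval_comp1 (hq a) (hp _).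
Qed.

Lemma comp_pair G (cG : coded G) A B (cA : coded A) (cB : coded B) (f : G -> A) (h : G -> B) :
  computable f -> computable h -> computable (fun g => (f g, h g)).
Proof.
move=> [p hp] [q hq].
exists (PrComp pr_cons [:: p; PrComp pr_cons [:: q; PrZero]]) => a.
apply: (eval_comp2 (hp a) _ (eval_cons _ _)).
by apply: (eval_comp2 (hq a) _ (eval_cons _ _)); constructor.
Qed.

Lemma comp_fst G (cG : coded G) A B (cA : coded A) (cB : coded B) (f : G -> A * B) :
  computable f -> computable (fun g => (f g).1).
Proof.
move=> [p hp]; exists (PrComp pr_hd [:: p]) => a.
exact: eval_comp1 (hp a) (eval_hd _ _).
Qed.

Lemma comp_snd G (cG : coded G) A B (cA : coded A) (cB : coded B) (f : G -> A * B) :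
  computable f -> computable (fun g => (f g).2).
Proof.
move=> [p hp]; exists (PrComp pr_hd [:: PrComp pr_tl [:: p]]) => a.
by apply: eval_comp1 (eval_hd _ _); apply: eval_comp1 (hp a) (eval_tl _ _).
Qed.

Lemma comp_succ G (cG : coded G) (f : G -> nat) : computable f -> computable (fun g => (f g).+1).
Proof.
move=> [p hp]; exists (PrComp PrSucc [:: p]) => a.
by apply: eval_comp1 (hp a) _; constructor.
Qed.

Lemma comp_cons G (cG : coded G) A (cA : coded A) (f : G -> A) (h : G -> seq A) :
  computable f -> computable h -> computable (fun g => f g :: h g).
Proof.
move=> [p hp] [q hq]; exists (PrComp pr_cons [:: p; q]) => a.
exact: (eval_comp2 (hp a) (hq a) (eval_cons _ _)).
Qed.

Lemma comp_nrec G (cG : coded G) A (cA : coded A) (n : G -> nat) (z : G -> A) (s : G -> nat -> A -> A) :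
  computable n -> computable z -> computable (fun u : G * nat * A => s u.1.1 u.1.2 u.2) ->
  computable (fun g => nat_rect (fun _ => A) (z g) (s g) (n g)).
Proof.
move=> [pn hn] [pz hz] [ps hs].
(* [PrRec] passes the counter, the value and the parameter in this order; they are repacked as the
   code of [(g, k, a)]. *)
pose pg := PrComp pr_cons [:: PrProj 2; PrComp pr_cons [:: PrProj 0; PrZero]].
pose ps' := PrComp ps [:: PrComp pr_cons [:: pg; PrComp pr_cons [:: PrProj 1; PrZero]]].
exists (PrComp (PrRec pz ps') [:: pn; PrProj 0]) => g.
apply: eval_comp2; [exact: hn|exact: eval_proj|].
apply: (@eval_rec (fun n => code (nat_rect (fun _ => A) (z g) (s g) n))).
  exact: hz.
move=> k _ /=; apply: eval_comp1 (hs (g, k, _)).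
apply: (eval_comp2 _ _ (eval_cons _ _)).
  apply: (eval_comp2 _ _ (eval_cons _ _)); first exact: eval_proj.
  by apply: (eval_comp2 _ _ (eval_cons _ _)); [apply: eval_proj|constructor].
by apply: (eval_comp2 _ _ (eval_cons _ _)); [apply: eval_proj|constructor].
Qed.

(* Only the empty-list branch is evaluated unconditionally: the other one is
   guarded by a primitive recursion, as its arguments need not be codes. *)
Lemma comp_case_seq G (cG : coded G) A B (cA : coded A) (cB : coded B) (l : G -> seq A)
    (z : G -> B) (s : G -> A -> seq A -> B) :
  computable l -> computable z -> computable (fun u : G * A * seq A => s u.1.1 u.1.2 u.2) ->
  computable (fun g => if l g is a :: l' then s g a l' else z g).
Proof.
move=> [pl hl] [pz hz] [ps hs].
(* The counter is 0 or 1, so the step of the recursion, and with it the search for head and tail,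
   runs only on a nonempty list. *)
pose nz := PrComp pr_isz [:: PrComp pr_isz [:: pl]].
pose hd := PrComp pr_hd [:: PrComp pl [:: PrProj 2]].
pose tl := PrComp pr_tl [:: PrComp pl [:: PrProj 2]].
pose pg := PrComp pr_cons [:: PrProj 2; PrComp pr_cons [:: hd; PrZero]].
pose ps' := PrComp ps [:: PrComp pr_cons [:: pg; PrComp pr_cons [:: tl; PrZero]]].
exists (PrComp (PrRec pz ps') [:: nz; PrProj 0]) => g.
apply: (@eval_comp2 _ _ _ _ ((code (l g) == 0) == 0 :> nat) (code g)).
- apply: eval_comp1 (eval_isz _ _); apply: eval_comp1 (eval_isz _ _); exact: hl.
- exact: eval_proj.
have := hl g; case: (l g) => [|a l'] hlg; first exact: ev_rec0.
have ->: (code (a :: l') == 0) = false.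
  by apply/negbTE; rewrite -lt0n /code /coded_seq /= muln_gt0 expn_gt0.
apply: ev_recS; first by apply: ev_rec0; exact: hz.
apply: eval_comp1 (hs (g, a, l')).
have hlg2 : eval (PrComp pl [:: PrProj 2]) [:: 0; code (z g); code g]
                 (ccons (code a) (code l')).
  by apply: eval_comp1; [apply: eval_proj | exact: hlg].
apply: (eval_comp2 _ _ (eval_cons _ _)).
  apply: (eval_comp2 _ _ (eval_cons _ _)); first exact: eval_proj.
  apply: (eval_comp2 _ _ (eval_cons _ _)); last by constructor.
  exact: eval_comp1 hlg2 (eval_hd _ _).
apply: (eval_comp2 _ _ (eval_cons _ _)); last by constructor.
exact: eval_comp1 hlg2 (eval_tl _ _).
Qed.



Lemma comp_case_nat G (cG : coded G) A (cA : coded A) (n : G -> nat) (z : G -> A) (s : G -> nat -> A) :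
  computable n -> computable z -> computable (fun u : G * nat => s u.1 u.2) ->
  computable (fun g => if n g is k.+1 then s g k else z g).
Proof.
move=> hn hz hs.
have h : computable (fun g => nat_rect (fun _ => A) (z g) (fun k _ => s g k) (n g)).
  by apply: comp_nrec => //; apply: comp_comp hs _; apply/comp_fst/comp_id.
by apply: comp_ext h => g; case: (n g).
Qed.

Lemma comp_if G (cG : coded G) A (cA : coded A) (b : G -> bool) (f h : G -> A) :
  computable b -> computable f -> computable h -> computable (fun g => if b g then f g else h g).
Proof.
move=> [pb hb] hf hh.
have hb' : computable (fun g => b g : nat) by exists pb.
have h' := comp_case_nat (s := fun g _ => f g) hb' hh (comp_comp hf (comp_fst (@comp_id _ _))).
by apply: comp_ext h' => g; case: (b g).
Qed.

Lemma comp_iter G (cG : coded G) A (cA : coded A) (n : G -> nat) (z : G -> A) (s : G -> A -> A) :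
  computable n -> computable z -> computable (fun u : G * A => s u.1 u.2) ->
  computable (fun g => iter (n g) (s g) (z g)).
Proof.
move=> hn hz hs.
have h : computable (fun g => nat_rect (fun _ => A) (z g) (fun _ a => s g a) (n g)).
  apply: comp_nrec => //.
  apply: (comp_comp (f := fun u : G * nat * A => (u.1.1, u.2)) hs).
  apply: comp_pair; first by do 2!apply: comp_fst; apply: comp_id.
  by apply/comp_snd/comp_id.
by apply: comp_ext h => g; elim: (n g) => //= k ->.
Qed.

Lemma comp_code G (cG : coded G) A (cA : coded A) (f : G -> A) : computable f -> computable (fun g => code (f g)).
Proof. by case=> p hp; exists p. Qed.


(** A bound on the length that is available as a number at once: the code itself serves as the fuel
    of folds. *)
Lemma size_code A (cA : coded A) (s : seq A) : size s <= code s.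
Proof.
rewrite /code /coded_seq; elim: s => //= a s IHs.
rewrite -[(size s).+1]mul1n; apply: leq_mul; first by rewrite expn_gt0.
by rewrite ltnS (leq_trans IHs) // -addnn leq_addr.
Qed.


(** The state pairs the remaining list with the accumulator and is iterated as often as the code of
    the list says; surplus rounds meet the empty list and change nothing. *)
Lemma comp_foldl G (cG : coded G) A B (cA : coded A) (cB : coded B) (l : G -> seq A) (z : G -> B)
    (s : G -> B -> A -> B) :
  computable l -> computable z -> computable (fun u : G * B * A => s u.1.1 u.1.2 u.2) ->
  computable (fun g => foldl (s g) (z g) (l g)).
Proof.
move=> hl hz hs.
pose st g (u : seq A * B) := if u.1 is a :: l' then (l', s g u.2 a) else u.
have iterE g n l0 z0 : size l0 <= n -> (iter n (st g) (l0, z0)).2 = foldl (s g) z0 l0.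
  elim: n l0 z0 => [|n IHn] [|a l0] z0 // le; rewrite iterSr; last exact: IHn.
  by rewrite -[st g _]/([::], z0) IHn.
have h : computable (fun g => (iter (code (l g)) (st g) (l g, z g)).2).
  apply: comp_snd; apply: comp_iter; first exact: comp_code.
    exact: comp_pair.
  apply: comp_case_seq; first by apply: comp_fst; apply/comp_snd/comp_id.
    by apply/comp_snd/comp_id.
  apply: comp_pair; first by apply/comp_snd/comp_id.
  apply: (comp_comp (f := fun u : G * (seq A * B) * A * seq A =>
    (u.1.1.1, u.1.1.2.2, u.1.2)) hs).
  apply: comp_pair; last by apply/comp_snd/comp_fst/comp_id.
  apply: comp_pair; first by do 3!apply: comp_fst; apply: comp_id.
  by do 2!apply: comp_snd; do 2!apply: comp_fst; apply: comp_id.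
by apply: comp_ext h => g; apply: iterE; apply: size_code.
Qed.


Lemma comp_app1 G A B (cG : coded G) (cA : coded A) (cB : coded B)
    (f : A -> B) (e : G -> A) :
  computable f -> computable e -> computable (fun v => f (e v)).
Proof. exact: comp_comp. Qed.

Lemma comp_app2 G A B C (cG : coded G) (cA : coded A) (cB : coded B) (cC : coded C)
    (f : A -> B -> C) (e1 : G -> A) (e2 : G -> B) :
  computable (fun u : A * B => f u.1 u.2) -> computable e1 -> computable e2 ->
  computable (fun v => f (e1 v) (e2 v)).
Proof.
move=> hf h1 h2.
exact: (comp_comp (f := fun v => (e1 v, e2 v)) hf (comp_pair h1 h2)).
Qed.

Lemma comp_app3 G A B C D (cG : coded G) (cA : coded A) (cB : coded B)
    (cC : coded C) (cD : coded D) (f : A -> B -> C -> D)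
    (e1 : G -> A) (e2 : G -> B) (e3 : G -> C) :
  computable (fun u : A * B * C => f u.1.1 u.1.2 u.2) ->
  computable e1 -> computable e2 -> computable e3 ->
  computable (fun v => f (e1 v) (e2 v) (e3 v)).
Proof.
move=> hf h1 h2 h3.
exact: (comp_comp (f := fun v => (e1 v, e2 v, e3 v)) hf
  (comp_pair (comp_pair h1 h2) h3)).
Qed.

Ltac comp_hyp := match goal with
  | H : computable (fun u => ?f u.1.1 u.1.2 u.2) |- computable (fun v => ?f _ _ _) =>
      apply: (@comp_app3 _ _ _ _ _ _ _ _ _ _ f _ _ _ H)
  | H : computable (fun u => ?f u.1 u.2) |- computable (fun v => ?f _ _) =>
      apply: (@comp_app2 _ _ _ _ _ _ _ _ f _ _ H)
  | H : computable ?f |- computable (fun v => ?f _) =>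
      apply: (@comp_app1 _ _ _ _ _ _ f _ H)
  end.
(** A hook, rebound below whenever further closure properties become available. *)
Ltac comp_user := fail.
Ltac comp_step := cbv beta; match goal with
  | |- computable (fun u => u) => apply: comp_id
  | |- computable (fun _ => ?a) => apply: comp_cst
  | |- computable fst => apply: (comp_fst (@comp_id _ _))
  | |- computable snd => apply: (comp_snd (@comp_id _ _))
  | |- computable S => apply: (comp_succ (@comp_id _ _))
  | |- computable (fun u => (_, _)) => apply: comp_pair
  | |- computable (fun u => fst _) => apply: comp_fst
  | |- computable (fun u => snd _) => apply: comp_snd
  | |- computable (fun u => S _) => apply: comp_succ
  | |- computable (fun u => cons _ _) => apply: comp_cons
  | |- computable (fun u => foldl _ _ _) => apply: comp_foldl
  | |- computable (fun u => iter _ _ _) => apply: comp_iter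
  | |- computable (fun u => match _ with O => _ | S k => _ end) => apply: comp_case_nat
  | |- computable (fun u => match _ with nil => _ | cons a l => _ end) => apply: comp_case_seq
  | |- computable (fun u => if _ then _ else _) => apply: comp_if
  | |- _ => first [assumption | comp_user | comp_hyp]
  end.
Ltac comp_tac := repeat comp_step.


(** * Closure under list operations and arithmetic *)

Lemma comp_rev G (cG : coded G) A (cA : coded A) (l : G -> seq A) :
  computable l -> computable (fun g => rev (l g)).
Proof.
move=> hl; apply: (comp_ext (f := fun g => foldl (fun s x => x :: s) [::] (l g))).
  by move=> g; rewrite /rev; elim: (l g) [::] => //= x s IHs t; rewrite IHs.
by comp_tac.
Qed.

Lemma comp_foldr G (cG : coded G) A B (cA : coded A) (cB : coded B) (l : G -> seq A) (z : G -> B)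
    (s : G -> A -> B -> B) :
  computable l -> computable z ->
  computable (fun u : G * A * B => s u.1.1 u.1.2 u.2) ->
  computable (fun g => foldr (s g) (z g) (l g)).
Proof.
move=> hl hz hs.
apply: (comp_ext (f := fun g => foldl (fun b a => s g a b) (z g) (rev (l g)))).
  by move=> g; rewrite foldl_rev.
by apply: comp_foldl; [exact: comp_rev | by [] | comp_tac].
Qed.

Lemma comp_map G (cG : coded G) A B (cA : coded A) (cB : coded B) (l : G -> seq A) (f : G -> A -> B) :
  computable l -> computable (fun u : G * A => f u.1 u.2) ->
  computable (fun g => map (f g) (l g)).
Proof.
move=> hl hf.
apply: (comp_ext (f := fun g => foldr (fun a s => f g a :: s) [::] (l g))).
  by move=> g; elim: (l g) => //= a s ->.
by apply: comp_foldr; comp_tac.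
Qed.

Lemma comp_cat G (cG : coded G) A (cA : coded A) (l1 l2 : G -> seq A) :
  computable l1 -> computable l2 -> computable (fun g => l1 g ++ l2 g).
Proof.
move=> h1 h2; apply: (comp_ext (f := fun g => foldr cons (l2 g) (l1 g))).
  by move=> g; elim: (l1 g) => //= a s ->.
by apply: comp_foldr; comp_tac.
Qed.

Lemma comp_andb G (cG : coded G) (b c : G -> bool) :
  computable b -> computable c -> computable (fun g => b g && c g).
Proof. by move=> hb hc; apply: comp_if; comp_tac. Qed.

Lemma comp_orb G (cG : coded G) (b c : G -> bool) :
  computable b -> computable c -> computable (fun g => b g || c g).
Proof. by move=> hb hc; apply: comp_if; comp_tac. Qed.

Lemma comp_negb G (cG : coded G) (b : G -> bool) : computable b -> computable (fun g => ~~ b g).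
Proof. by move=> hb; apply: comp_if; comp_tac. Qed.

Lemma comp_addn G (cG : coded G) (m n : G -> nat) :
  computable m -> computable n -> computable (fun g => m g + n g).
Proof.
move=> hm hn; apply: (comp_ext (f := fun g => iter (m g) S (n g))).
  by move=> g; elim: (m g) => //= k ->.
by comp_tac.
Qed.

Lemma comp_muln G (cG : coded G) (m n : G -> nat) :
  computable m -> computable n -> computable (fun g => m g * n g).
Proof.
move=> hm hn; apply: (comp_ext (f := fun g => iter (m g) (addn (n g)) 0)).
  by move=> g; elim: (m g) => //= k ->; rewrite mulSn.
by comp_tac; apply: comp_addn; comp_tac.
Qed.

Ltac comp_user ::= match goal with
  | |- computable (fun u => foldr _ _ _) => apply: comp_foldr
  | |- computable (fun u => map _ _) => apply: comp_map
  | |- computable (fun u => rev _) => apply: comp_rev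
  | |- computable (fun u => cat _ _) => apply: comp_cat
  | |- computable (fun u => addn _ _) => apply: comp_addn
  | |- computable (fun u => muln _ _) => apply: comp_muln
  | |- computable (fun u => andb _ _) => apply: comp_andb
  | |- computable (fun u => orb _ _) => apply: comp_orb
  | |- computable (fun u => negb _) => apply: comp_negb
  end.


Lemma comp_all G (cG : coded G) A (cA : coded A) (l : G -> seq A) (f : G -> A -> bool) :
  computable l -> computable (fun u : G * A => f u.1 u.2) ->
  computable (fun g => all (f g) (l g)).
Proof.
move=> hl hf.
apply: (comp_ext (f := fun g => foldr (fun a b => f g a && b) true (l g))).
  by move=> g; elim: (l g) => //= a s ->.
by comp_tac.
Qed.

Lemma comp_has G (cG : coded G) A (cA : coded A) (l : G -> seq A) (f : G -> A -> bool) :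
  computable l -> computable (fun u : G * A => f u.1 u.2) ->
  computable (fun g => has (f g) (l g)).
Proof.
move=> hl hf.
apply: (comp_ext (f := fun g => foldr (fun a b => f g a || b) false (l g))).
  by move=> g; elim: (l g) => //= a s ->.
by comp_tac.
Qed.

Lemma comp_filter G (cG : coded G) A (cA : coded A) (l : G -> seq A) (f : G -> A -> bool) :
  computable l -> computable (fun u : G * A => f u.1 u.2) ->
  computable (fun g => filter (f g) (l g)).
Proof.
move=> hl hf.
apply: (comp_ext
  (f := fun g => foldr (fun a b => if f g a then a :: b else b) [::] (l g))).
  by move=> g; elim: (l g) => //= a s ->.
by comp_tac.
Qed.

Lemma comp_flatten G (cG : coded G) A (cA : coded A) (l : G -> seq (seq A)) :
  computable l -> computable (fun g => flatten (l g)).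
Proof. by move=> hl; rewrite /flatten; comp_tac. Qed.

Lemma comp_size G (cG : coded G) A (cA : coded A) (l : G -> seq A) :
  computable l -> computable (fun g => size (l g)).
Proof.
move=> hl; apply: (comp_ext (f := fun g => foldr (fun _ n => n.+1) 0 (l g))).
  by move=> g; elim: (l g) => //= a s ->.
by comp_tac.
Qed.

Lemma comp_predn G (cG : coded G) (n : G -> nat) :
  computable n -> computable (fun g => (n g).-1).
Proof.
move=> hn; apply: (comp_ext (f := fun g => if n g is k.+1 then k else 0)).
  by move=> g; case: (n g).
by comp_tac.
Qed.

Lemma comp_subn G (cG : coded G) (m n : G -> nat) :
  computable m -> computable n -> computable (fun g => m g - n g).
Proof.
move=> hm hn; apply: (comp_ext (f := fun g => iter (n g) predn (m g))).
  by move=> g; elim: (n g) => [|k IHk] /=; rewrite ?subn0 // IHk subnS.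
by comp_tac; apply: comp_predn; comp_tac.
Qed.

Lemma comp_eqn G (cG : coded G) (m n : G -> nat) :
  computable m -> computable n -> computable (fun g => m g == n g).
Proof.
move=> hm hn; apply: (comp_ext (f := fun g =>
    if (m g - n g) + (n g - m g) is _.+1 then false else true)).
  move=> g; case: eqP => [->|]; first by rewrite subnn.
  by case E: (m g - n g + (n g - m g)) => // ne; case: ne; lia.
by comp_tac; apply: comp_subn.
Qed.

Lemma comp_mem G (cG : coded G) (x : G -> nat) (l : G -> seq nat) :
  computable x -> computable l -> computable (fun g => x g \in l g).
Proof.
move=> hx hl.
apply: (comp_ext (f := fun g => has (fun y => x g == y) (l g))).
  by move=> g; elim: (l g) => //= y s ->.
apply: comp_has => //; apply: comp_eqn; comp_tac.
Qed.

Lemma comp_nth G (cG : coded G) A (cA : coded A) (d : G -> A) (l : G -> seq A) (n : G -> nat) :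
  computable d -> computable l -> computable n ->
  computable (fun g => nth (d g) (l g) (n g)).
Proof.
move=> hd hl hn; apply: (comp_ext (f := fun g =>
    if iter (n g) (fun l => if l is _ :: l' then l' else [::]) (l g) is a :: _
    then a else d g)).
  move=> g; elim: (n g) (l g) => [|k IHk] [|a s] //; rewrite iterSr // IHk.
  by rewrite nth_nil.
comp_tac.
Qed.

Lemma comp_index G (cG : coded G) (x : G -> nat) (l : G -> seq nat) :
  computable x -> computable l -> computable (fun g => index (x g) (l g)).
Proof.
move=> hx hl; apply: (comp_ext (f := fun g =>
    foldr (fun y n => if y == x g then 0 else n.+1) 0 (l g))).
  by move=> g; rewrite /index; elim: (l g) => //= y s ->.
comp_tac; apply: comp_eqn; comp_tac.
Qed.

Lemma comp_uniq G (cG : coded G) (l : G -> seq nat) :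
  computable l -> computable (fun g => uniq (l g)).
Proof.
move=> hl; apply: (comp_ext (f := fun g =>
  (foldr (fun x u => (x :: u.1, (x \notin u.1) && u.2)) ([::], true) (l g)).2)).
  move=> g; suff ->: foldr (fun x u => (x :: u.1, (x \notin u.1) && u.2))
    ([::], true) (l g) = (l g, uniq (l g)) by [].
  by elim: (l g) => //= x s ->.
comp_tac; apply: comp_mem; comp_tac.
Qed.

Lemma comp_count G (cG : coded G) A (cA : coded A) (l : G -> seq A) (f : G -> A -> bool) :
  computable l -> computable (fun u : G * A => f u.1 u.2) ->
  computable (fun g => count (f g) (l g)).
Proof.
move=> hl hf; apply: (comp_ext (f := fun g => size (filter (f g) (l g)))).
  by move=> g; rewrite size_filter.
by apply: comp_size; apply: comp_filter.
Qed.

(** * Enumerations and tree recursion *)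

Ltac comp_lists := match goal with
  | |- computable (fun u => foldr _ _ _) => apply: comp_foldr
  | |- computable (fun u => map _ _) => apply: comp_map
  | |- computable (fun u => rev _) => apply: comp_rev
  | |- computable (fun u => cat _ _) => apply: comp_cat
  | |- computable (fun u => addn _ _) => apply: comp_addn
  | |- computable (fun u => muln _ _) => apply: comp_muln
  | |- computable (fun u => andb _ _) => apply: comp_andb
  | |- computable (fun u => orb _ _) => apply: comp_orb
  | |- computable (fun u => negb _) => apply: comp_negb
  | |- computable (fun u => all _ _) => apply: comp_all
  | |- computable (fun u => has _ _) => apply: comp_has
  | |- computable (fun u => filter _ _) => apply: comp_filter
  | |- computable (fun u => flatten _) => apply: comp_flatten
  | |- computable (fun u => size _) => apply: comp_size
  | |- computable (fun u => nth _ _ _) => apply: comp_nth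
  | |- computable (fun u => index _ _) => apply: comp_index
  | |- computable (fun u => uniq _) => apply: comp_uniq
  | |- computable (fun u => count _ _) => apply: comp_count
  | |- computable (fun u => in_mem _ _) => apply: comp_mem
  | |- computable (fun u => eq_op _ _) => apply: comp_eqn
  end.
Ltac comp_user ::= comp_lists.

Fixpoint tuples (n : nat) (pool : seq nat) : seq (seq nat) :=
  if n is n'.+1 then flatten [seq [seq x :: s | s <- tuples n' pool] | x <- pool]
  else [:: [::]].

Lemma tuplesP n pool s :
  reflect (size s = n /\ {subset s <= pool}) (s \in tuples n pool).
Proof.
elim: n s => [|n IHn] s /=.
  by rewrite mem_seq1; apply: (iffP eqP) => [-> | [/size0nil]].
apply: (iffP flatten_mapP) => [[x xp /mapP[s' /IHn[<- sub] ->]] | ].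
  by split=> // y; rewrite inE => /predU1P[-> | /sub].
case: s => [|x s] [] // [sz] sub; exists x; first by apply: sub; rewrite mem_head.
by apply: map_f; apply/IHn; split=> // y ys; apply: sub; rewrite inE ys orbT.
Qed.

Lemma comp_tuples G (cG : coded G) (n : G -> nat) (pool : G -> seq nat) :
  computable n -> computable pool -> computable (fun g => tuples (n g) (pool g)).
Proof.
move=> hn hp; apply: (comp_ext (f := fun g => iter (n g) (fun ss =>
  flatten [seq [seq x :: s | s <- ss] | x <- pool g]) [:: [::]])).
  by move=> g; elim: (n g) => //= k ->.
by comp_tac.
Qed.

Fixpoint sublists (s : seq nat) : seq (seq nat) :=
  if s is x :: s' then sublists s' ++ [seq x :: t | t <- sublists s'] else [:: [::]].

(** Every set of names taken from [s] is thereby represented, which is all that guessing a set of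
    free names requires. *)
Lemma filter_sublists p s : filter p s \in sublists s.
Proof.
elim: s => //= x s IHs; rewrite mem_cat; case: (p x); last by rewrite IHs.
by rewrite map_f ?orbT.
Qed.

Lemma sublists_subset t s : t \in sublists s -> {subset t <= s}.
Proof.
elim: s t => [|x s IHs] t /=; first by rewrite mem_seq1 => /eqP->.
rewrite mem_cat => /orP[/IHs sub | /mapP[t' /IHs sub ->]] y.
  by rewrite inE => /sub->; rewrite orbT.
by rewrite !inE => /orP[-> // | /sub->]; rewrite orbT.
Qed.

Lemma comp_sublists G (cG : coded G) (s : G -> seq nat) :
  computable s -> computable (fun g => sublists (s g)).
Proof.
move=> hs; apply: (comp_ext (f := fun g =>
  foldr (fun x ss => ss ++ [seq x :: t | t <- ss]) [:: [::]] (s g))).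
  by move=> g; elim: (s g) => //= x t ->.
by comp_tac.
Qed.

(* The code of a tree is the code of the sequence [GenTree.encode t] of its
   tokens, so tree recursion is a left-to-right scan of the tokens with a stack
   of the nodes that are currently open. *)

#[export] Instance coded_token : coded (nat + nat) := pickle.

(** The [pickle] of a token is the code of this pair of lists of length at most one, so tokens are
    built and inspected with the combinators for pairs and lists. *)
Definition token_seqs (u : nat + nat) : seq nat * seq nat :=
  match u with inl n => ([:: n], [::]) | inr x => ([::], [:: x]) end.

Lemma code_token u : code u = code (token_seqs u).
Proof. by case: u. Qed.

Lemma comp_token_seqs G (cG : coded G) (e : G -> nat + nat) :
  computable e -> computable (fun g => token_seqs (e g)).
Proof. by case=> p hp; exists p => g; rewrite -code_token. Qed.

Lemma comp_of_token_seqs G (cG : coded G) (e : G -> nat + nat) :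
  computable (fun g => token_seqs (e g)) -> computable e.
Proof. by case=> p hp; exists p => g; rewrite code_token. Qed.

Lemma comp_encode G (cG : coded G) (t : G -> GenTree.tree nat) :
  computable t -> computable (fun g => GenTree.encode (t g)).
Proof. by case=> p hp; exists p. Qed.

Lemma comp_of_encode G (cG : coded G) (t : G -> GenTree.tree nat) :
  computable (fun g => GenTree.encode (t g)) -> computable t.
Proof. by case=> p hp; exists p. Qed.

Lemma comp_leaf G (cG : coded G) (x : G -> nat) :
  computable x -> computable (fun g => GenTree.Leaf (x g)).
Proof.
move=> hx; apply: comp_of_encode => /=; comp_tac.
by apply: comp_of_token_seqs => /=; comp_tac.
Qed.

Lemma comp_node G (cG : coded G) (f : G -> nat) (ts : G -> seq (GenTree.tree nat)) :
  computable f -> computable ts -> computable (fun g => GenTree.Node (f g) (ts g)).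
Proof.
move=> hf hts; apply: comp_of_encode => /=.
apply: comp_cons; first by apply: comp_of_token_seqs => /=; comp_tac.
apply: (comp_ext (f := fun g => flatten (map (@GenTree.encode nat) (ts g)) ++ [:: inl 0])).
  by move=> g; rewrite cats1.
by comp_tac; apply: comp_encode; comp_tac.
Qed.

Section TreeFold.
Variables (P B : Type).
Variables (leaf : P -> nat -> B) (down : P -> nat -> seq B -> P)
  (node : P -> nat -> seq B -> B).

(* The parameter passed to a child may depend on the values of its left
   siblings; these are listed from right to left. *)
Fixpoint tfold (p : P) (t : GenTree.tree nat) : B :=
  match t with
  | GenTree.Leaf x => leaf p x
  | GenTree.Node f ts => node p f
      (foldl (fun acc h => h (down p f acc) :: acc) [::] (map (fun t p => tfold p t) ts))
  end.

(** A frame holds an opening token, a parameter and the values of the children so far. Opening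
    tokens are successors of labels, which leaves 0 to mark the bottom frame; its child receives the
    parameter unchanged. *)
Definition child_param (fr : nat * P * seq B) :=
  if fr.1.1 is f.+1 then down fr.1.2 f fr.2 else fr.1.2.

Definition tfold_step (st : seq (nat * P * seq B)) (tok : nat + nat) :=
  if st is fr :: rest then
    if (token_seqs tok).1 is n :: _ then
      if n is n'.+1 then (n, child_param fr, [::]) :: st
      else if rest is fr2 :: rest2 then
        (fr2.1, node fr.1.2 (if fr.1.1 is f.+1 then f else 0) fr.2 :: fr2.2) :: rest2
      else [::]
    else if (token_seqs tok).2 is x :: _ then
      (fr.1, leaf (child_param fr) x :: fr.2) :: rest
    else [::]
  else [::].

Lemma tfold_encode f p acc rest t :
  foldl tfold_step ((f, p, acc) :: rest) (GenTree.encode t) =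
  (f, p, tfold (child_param (f, p, acc)) t :: acc) :: rest.
Proof.
elim: t f p acc rest => [x|n ts IHt] f p acc rest //=.
rewrite -cats1 foldl_cat /=.
set st := (f, p, acc) :: rest; set p' := child_param _.
suff ->: forall acc', foldl tfold_step ((n.+1, p', acc') :: st)
    (flatten [seq GenTree.encode i | i <- ts]) =
  (n.+1, p', foldl (fun acc h => h (down p' n acc) :: acc) acc'
    [seq tfold^~ t | t <- ts]) :: st by [].
elim: ts IHt => //= t ts IHts [IHt /IHts{}IHts] acc'.
by rewrite foldl_cat IHt IHts.
Qed.
End TreeFold.

Lemma comp_tfold P B (cP : coded P) (cB : coded B)
    (leaf : P -> nat -> B) (down : P -> nat -> seq B -> P) (node : P -> nat -> seq B -> B)
    G (cG : coded G) (p : G -> P) (t : G -> GenTree.tree nat) :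
  computable (fun u : P * nat => leaf u.1 u.2) ->
  computable (fun u : P * nat * seq B => down u.1.1 u.1.2 u.2) ->
  computable (fun u : P * nat * seq B => node u.1.1 u.1.2 u.2) ->
  computable p -> computable t ->
  computable (fun g => tfold leaf down node (p g) (t g)).
Proof.
move=> hl hd hn hp ht; apply: (comp_ext (f := fun g =>
  if foldl (tfold_step leaf down node) [:: (0, p g, [::])] (GenTree.encode (t g))
  is fr :: _ then if fr.2 is b :: _ then b else leaf (p g) 0 else leaf (p g) 0)).
  by move=> g; rewrite tfold_encode.
have hcp : computable (child_param down).
  by rewrite /child_param; comp_tac.
have htok := comp_token_seqs (@comp_id (nat + nat) _).
by apply: comp_case_seq; comp_tac; rewrite /tfold_step; comp_tac.
Qed.

(** * Messages and derivability *)

Definition ubound (s : seq nat) := (\max_(a <- s) a).+1.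

Lemma ltn_ubound a s : a \in s -> a < ubound s.
Proof. by move=> ain; rewrite ltnS; apply: leq_bigmax_seq. Qed.

(** Invariance of derivability asks for a renaming injective on all names. A renaming injective on
    [s] is extended to one by shifting every other name beyond the image of [s]. *)
Definition inj_ext (s : seq nat) (f : nat -> nat) (a : nat) :=
  if a \in s then f a else a + ubound (map f s).

Lemma inj_extE s f : {in s, inj_ext s f =1 f}.
Proof. by move=> a ain; rewrite /inj_ext ain. Qed.

Lemma inj_ext_inj s f : {in s &, injective f} -> injective (inj_ext s f).
Proof.
move=> inj a b; rewrite /inj_ext; case: ifPn => ain; case: ifPn => bin; first exact: inj.
- by move=> e; have := ltn_ubound (map_f f ain); rewrite e ltnNge leq_addl.
- by move=> e; have := ltn_ubound (map_f f bin); rewrite -e ltnNge leq_addl.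
- by move=> /addIn.
Qed.

Section Messages.
Variables (nc : nat) (ar : nat -> nat).
Notation msg := (Defs.msg nc ar).
Implicit Types (M N : msg) (G : seq msg).

Lemma wf_tren rho t : wf_term nc ar t -> wf_term nc ar (tren rho t).
Proof.
elim: t => //= f ts IHt /and3P[-> /eqP sz wts]; rewrite size_map sz eqxx /=.
by elim: ts IHt wts {sz} => //= t ts IHts [IHt /IHts{}IHts] /andP[/IHt-> /IHts].
Qed.

Lemma val_mren rho M : val (mren rho M) = tren rho (val M).
Proof. by rewrite val_insubd wf_tren // (valP M). Qed.

Lemma tren_ext rho rho' t : {in tnames t, rho =1 rho'} -> tren rho t = tren rho' t.
Proof.
elim: t => /= [x eqr|f ts IHt eqr]; first by rewrite eqr // mem_head.
congr GenTree.Node; elim: ts IHt eqr => //= t ts IHts [IHt /IHts{}IHts] eqr.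
by rewrite IHt ?IHts // => a ain; apply: eqr; rewrite mem_cat ain ?orbT.
Qed.

Lemma tren_comp rho rho' t : tren rho (tren rho' t) = tren (rho \o rho') t.
Proof.
elim: t => //= f ts IHt; congr GenTree.Node.
by elim: ts IHt => //= t ts IHts [-> /IHts->].
Qed.

Lemma tren_id t : tren id t = t.
Proof.
elim: t => //= f ts IHt; congr GenTree.Node.
by elim: ts IHt => //= t ts IHts [-> /IHts->].
Qed.

Lemma tnames_tren rho t : tnames (tren rho t) = map rho (tnames t).
Proof.
elim: t => //= f ts IHt.
by elim: ts IHt => //= t ts IHts [-> /IHts->]; rewrite map_cat.
Qed.

Lemma mren_ext rho rho' M : {in mnames M, rho =1 rho'} -> mren rho M = mren rho' M.
Proof. by move=> eqr; apply: val_inj; rewrite !val_mren; apply: tren_ext. Qed.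

Lemma mren_comp rho rho' M : mren rho (mren rho' M) = mren (rho \o rho') M.
Proof. by apply: val_inj; rewrite !val_mren tren_comp. Qed.

Lemma mren_id M : mren id M = M.
Proof. by apply: val_inj; rewrite val_mren tren_id. Qed.

Lemma mnames_mren rho M : mnames (mren rho M) = map rho (mnames M).
Proof. by rewrite /mnames val_mren tnames_tren. Qed.

Lemma mren_mname rho a : mren rho (mname nc ar a) = mname nc ar (rho a).
Proof. by apply: val_inj; rewrite val_mren. Qed.

Lemma namesP a G : reflect (exists2 M, M \in G & a \in mnames M) (a \in names G).
Proof. exact: flatten_mapP. Qed.

Lemma names_ren rho G : names (map (mren rho) G) = map rho (names G).
Proof.
by rewrite /names map_flatten -!map_comp; congr flatten; apply: eq_map => M /=; rewrite mnames_mren.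
Qed.

Lemma names_cat G1 G2 : names (G1 ++ G2) = names G1 ++ names G2.
Proof. by rewrite /names map_cat flatten_cat. Qed.

Lemma names_mname s : names (map (mname nc ar) s) = s.
Proof. by rewrite /names; elim: s => //= a s ->. Qed.

Lemma mren_ext_in rho rho' G :
  {in names G, rho =1 rho'} -> map (mren rho) G = map (mren rho') G.
Proof.
move=> eqr; apply/eq_in_map => M MG; apply: mren_ext => a aM.
by apply: eqr; apply/namesP; exists M.
Qed.

Section Model.
Variable der : seq msg -> msg -> Prop.
Hypothesis model : intruder_model der.

Lemma der_id G M : M \in G -> der G M. Proof. by case: model => h _; apply: h. Qed.
Lemma der_mono G G' M : {subset G <= G'} -> der G M -> der G' M.
Proof. by case: model => _ [h _ _ _ _]; apply: h. Qed.
Lemma der_cut G M N : der G M -> der (M :: G) N -> der G N.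
Proof. by case: model => _ [_ h _ _ _]; apply: h. Qed.
Lemma der_ctor f Ms : f < nc -> size Ms = ar f -> der Ms (mapp f Ms).
Proof. by case: model => _ [_ _ h _ _]; apply: h. Qed.
Lemma der_ren rho G M : injective rho -> der G M -> der (map (mren rho) G) (mren rho M).
Proof. by case: model => _ [_ _ _ h _]; apply: h. Qed.
Lemma der_rel G a M : a \notin names G -> a \notin mnames M ->
  der (mname nc ar a :: G) M -> der G M.
Proof. by case: model => _ [_ _ _ _ h]; apply: h. Qed.

Lemma der_cuts G1 G N : (forall M, M \in G1 -> der G M) -> der (G1 ++ G) N -> der G N.
Proof.
elim: G1 => //= M G1 IHG hG dN; apply: IHG => [M' M'G|].
  by apply: hG; rewrite inE M'G orbT.
apply: der_cut dN; apply: der_mono (hG M _); last by rewrite mem_head.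
by move=> x xG; rewrite mem_cat xG orbT.
Qed.

Lemma der_trans G1 G N : (forall M, M \in G1 -> der G M) -> der G1 N -> der G N.
Proof.
move=> hG dN; apply: (der_cuts hG); apply: der_mono dN => x xG.
by rewrite mem_cat xG.
Qed.

Lemma der_ren_in rho G M : {in names (M :: G) &, injective rho} -> der G M ->
  der (map (mren rho) G) (mren rho M).
Proof.
move=> inj dM; have := der_ren (inj_ext_inj inj) dM.
have -> : mren (inj_ext (names (M :: G)) rho) M = mren rho M.
  by apply: mren_ext => a aM; apply: inj_extE; rewrite mem_cat aM.
by rewrite (@mren_ext_in _ rho) // => a aM; apply: inj_extE; rewrite mem_cat aM orbT.
Qed.

Lemma der_names G M : (forall a, a \in mnames M -> mname nc ar a \in G) -> der G M.
Proof.
case: M => t; rewrite /mnames /=; elim: t => [a|f ts IHt] wt hG.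
  apply: der_id; have -> : (exist (wf_term nc ar) _ wt : msg) = mname nc ar a by apply: val_inj.
  by apply: hG; rewrite mem_head.
have /and3P[ltf /eqP sz wts] := wt.
have [Ms valMs dMs] : exists2 Ms : seq msg, map val Ms = ts &
    forall M, M \in Ms -> der G M.
  move: IHt hG wts; elim: {wt sz} ts => [|t ts IHts] /=; first by exists [::].
  move=> [IHt /IHts{}IHts] hG /andP[wt /IHts{}IHts].
  have [|Ms <- dMs] := IHts; first by move=> a aG; apply: hG; rewrite mem_cat aG orbT.
  exists ((exist (wf_term nc ar) t wt : msg) :: Ms) => // M; rewrite inE => /predU1P[->|/dMs //].
  by apply: IHt => a aG; apply: hG; rewrite mem_cat aG.
apply: (der_trans dMs).
have -> : (exist (wf_term nc ar) _ wt : msg) = mapp f Ms.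
  by apply: val_inj; rewrite val_insubd valMs wt.
by apply: der_ctor; rewrite // -sz -valMs size_map.
Qed.

Lemma der_rels s G M : (forall a, a \in s -> a \notin names G) ->
  (forall a, a \in s -> a \notin mnames M) ->
  der (map (mname nc ar) s ++ G) M -> der G M.
Proof.
elim: s => //= a s IHs hG hM dM.
have dM' : der (map (mname nc ar) s ++ G) M.
  have [ain|anin] := boolP (a \in s).
    apply: der_mono dM => x; rewrite inE => /predU1P[->|//].
    by rewrite mem_cat map_f.
  apply: der_rel dM; last by apply: hM; rewrite mem_head.
  rewrite names_cat names_mname mem_cat negb_or anin /=.
  by apply: hG; rewrite mem_head.
by apply: IHs dM' => b bs; [apply: hG | apply: hM]; rewrite inE bs orbT.
Qed.

Lemma der_names_self s M : der (map (mname nc ar) s) M ->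
  der (map (mname nc ar) [seq a <- s | a \in mnames M]) M.
Proof.
move=> dM; apply: (@der_rels [seq a <- s | a \notin mnames M]).
- move=> a; rewrite mem_filter names_mname mem_filter => /andP[/negbTE->] //.
- by move=> a; rewrite mem_filter => /andP[].
apply: der_mono dM => x /mapP[a ain ->]; rewrite -map_cat map_f //.
by rewrite mem_cat !mem_filter ain !andbT orNb.
Qed.

Lemma in_nsubst xs ys a : size xs = size ys -> nsubst xs ys a \in a :: ys.
Proof.
rewrite /nsubst inE => sz; case: ifP => [ain|_]; last by rewrite eqxx.
by rewrite mem_nth ?orbT // -sz index_mem.
Qed.

(* Absorption without the proviso on the names of M.  The names of M outside G
   are brought into the knowledge by a copy of M in which the other names are
   fresh: by relevancy that copy is derivable from those fresh names alone, and
   they can be discarded in the end. *)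
Lemma absorb (xs ys : seq nat) G M : absorbing der ->
  uniq xs -> uniq ys -> size xs = size ys ->
  (forall y, y \in ys -> y \notin names G) -> (forall y, y \in ys -> y \notin mnames M) ->
  der (G ++ map (mren (nsubst xs ys)) G) M -> der G M.
Proof.
move=> abs uxs uys sz ysG ysM dM.
set G' := map _ G in dM.
pose big := ubound (names G ++ ys ++ mnames M).
pose kap a := if a \in names G then a + big else a.
pose bs := [seq a <- mnames M | a \in names G].
have ltbig a : a \in names G ++ ys ++ mnames M -> a < big by apply: ltn_ubound.
(* A name of the renamed knowledge lies in [G] or in [ys], and the latter do not occur in [M]; so
   relevancy leaves only names common to [M] and [G]. *)
have d1 : der (map (mname nc ar) bs) M.
  have /der_names_self : der (map (mname nc ar) (names (G ++ G'))) M.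
    apply: der_trans dM => N NG; apply: der_names => a aN; apply: map_f.
    by apply/namesP; exists N.
  apply: der_mono => x /mapP[a]; rewrite mem_filter => /andP[aM aG] ->.
  apply: map_f; rewrite mem_filter aM andbT.
  move: aG; rewrite names_cat mem_cat names_ren => /orP[//|/mapP[b bG ea]].
  have := in_nsubst b sz; rewrite -ea inE => /predU1P[-> //|/ysM].
  by rewrite aM.
have d2 : der (map (mname nc ar) (map kap bs)) (mren kap M).
  have -> : map (mname nc ar) (map kap bs) = map (mren kap) (map (mname nc ar) bs).
    by rewrite -!map_comp; apply: eq_map => a /=; rewrite mren_mname.
  apply: der_ren_in d1 => a b.
  have e c : (c \in names (M :: map (mname nc ar) bs)) = (c \in mnames M).
    rewrite -cat1s names_cat names_mname {1}/names /= cats0 mem_cat mem_filter.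
    by case: (c \in mnames M); rewrite ?andbF.
  rewrite !e => aM bM; rewrite /kap.
  have := ltbig a; have := ltbig b; rewrite !mem_cat aM bM !orbT.
  by do 2!case: ifP => _; lia.
have d3 : der (mren kap M :: G) M.
  apply/(abs xs ys (mren kap M :: G) M) => //.
  - apply/allP => y yin; rewrite -cat1s names_cat {1}/names /= cats0 mem_cat negb_or ysG //.
    rewrite andbT mnames_mren; apply/mapP => -[a aM ey].
    have : y < big by apply: ltbig; rewrite !mem_cat yin orbT.
    by move: ey (ysM y yin); rewrite /kap; case: ifP => _ ->; [lia | rewrite aM].
  - move=> a aM; rewrite -cat1s names_cat {1}/names /= cats0 mem_cat.
    have [//|anG] := boolP (a \in names G); first by rewrite orbT.
    apply/orP; left; rewrite mnames_mren; apply/mapP; exists a => //.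
    by rewrite /kap (negbTE anG).
  apply: der_mono dM => x; rewrite /= !(inE, mem_cat) => /orP[] ->; rewrite !orbT //.
apply: (@der_rels (map kap bs)).
- move=> b /mapP[a]; rewrite mem_filter => /andP[aG aM] ->; rewrite /kap aG.
  by apply/negP => h; have := ltbig (a + big); rewrite mem_cat h => /(_ isT); lia.
- move=> b /mapP[a]; rewrite mem_filter => /andP[aG aM] ->; rewrite /kap aG.
  apply/negP => h; have := ltbig (a + big); rewrite !mem_cat h !orbT => /(_ isT); lia.
apply: der_cut (der_mono _ d2) (der_mono _ d3).
  by move=> x xin; rewrite mem_cat xin.
by move=> x; rewrite !inE mem_cat => /orP[] ->; rewrite ?orbT.
Qed.

End Model.
End Messages.

(** * Templates and their flattened instances *)

Section Multisets.
Variable T : eqType.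
Implicit Types s : seq T.

Definition msub s1 s2 := forall x, count_mem x s1 <= count_mem x s2.

Lemma msub_refl s : msub s s. Proof. by []. Qed.
Lemma msub_trans s2 s1 s3 : msub s1 s2 -> msub s2 s3 -> msub s1 s3.
Proof. by move=> h1 h2 x; apply: leq_trans (h1 x) (h2 x). Qed.
Lemma msub_perm s1 s2 : perm_eq s1 s2 -> msub s1 s2.
Proof. by move=> /permP e x; rewrite e. Qed.
Lemma msub_cat s1 s2 t1 t2 : msub s1 t1 -> msub s2 t2 -> msub (s1 ++ s2) (t1 ++ t2).
Proof. by move=> h1 h2 x; rewrite !count_cat leq_add. Qed.
Lemma msub0 s : msub [::] s. Proof. by []. Qed.
Lemma msub_catl s1 s2 : msub s1 (s1 ++ s2).
Proof. by move=> x; rewrite count_cat leq_addr. Qed.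
Lemma msub_catr s1 s2 : msub s2 (s1 ++ s2).
Proof. by move=> x; rewrite count_cat leq_addl. Qed.

Lemma msub_mem s1 s2 : msub s1 s2 -> {subset s1 <= s2}.
Proof.
move=> h x; rewrite -!has_pred1 !has_count => h1; exact: leq_trans h1 (h x).
Qed.

Lemma msub_cons x s1 s2 : msub (x :: s1) s2 -> x \in s2 /\ msub s1 (rem x s2).
Proof.
move=> h; have x2 : x \in s2 by apply: (msub_mem h); rewrite mem_head.
split=> // y; have := h y; rewrite (permP (perm_to_rem x2)) /=; lia.
Qed.

Lemma msubP s1 s2 : msub s1 s2 -> exists s3, perm_eq s2 (s1 ++ s3).
Proof.
elim: s1 s2 => [|x s1 IHs] s2 h; first by exists s2.
have [x2 /IHs[s3 p3]] := msub_cons h; exists s3.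
by apply: perm_trans (perm_to_rem x2) _; rewrite /= perm_cons.
Qed.

Lemma msub_split s s1 s2 : msub s (s1 ++ s2) ->
  exists s1' s2', [/\ perm_eq s (s1' ++ s2'), msub s1' s1 & msub s2' s2].
Proof.
elim: s1 s => [|x s1 IHs] s h; first by exists [::], s.
have [xs|xs] := boolP (x \in s).
  have [|s1' [s2' [p m1 m2]]] := IHs (rem x s).
    move=> y; have := h y; rewrite (permP (perm_to_rem xs)) /=; lia.
  exists (x :: s1'), s2'; split=> //.
    by apply: perm_trans (perm_to_rem xs) _; rewrite /= perm_cons.
  by move=> y /=; have := m1 y; lia.
have [|s1' [s2' [p m1 m2]]] := IHs s.
  move=> y; have := h y; rewrite /=; case: eqP => [<- _|_]; last by lia.
  by rewrite (count_memPn xs).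
exists s1', s2'; split=> // y; have := m1 y => /=; lia.
Qed.

Lemma msub_map (T' : eqType) (f : T -> T') s1 s2 :
  msub s1 s2 -> forall y, count_mem y (map f s1) <= count_mem y (map f s2).
Proof.
by move=> /msubP[s3 /(perm_map f)/permP e] y; rewrite e map_cat count_cat leq_addr.
Qed.
End Multisets.

Definition upd (rho : nat -> nat) x b := fun a => if a == x then b else rho a.

Ltac inv_par h X1 S1 X2 S2 f1 f2 :=
  inversion h as [|? ? ? X1 S1 X2 S2 f1 f2| | | | | |]; subst.
Ltac inv_nu h b X f := inversion h as [| | | | | | |? ? ? b X ? f]; subst.

Section Templates.
Variables (nc : nat) (ar : nat -> nat).
Notation msg := (Defs.msg nc ar).

(* Kind 0 is an output, kind q.+1 a call to the process identifier q. *)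
Notation atom := (nat * seq msg)%type.
Implicit Types (S : seq atom) (X : seq nat) (rho theta : nat -> nat).

Definition aren rho (a : atom) : atom := (a.1, map (mren rho) a.2).
Definition sren rho S := map (aren rho) S.
Definition snames S := flatten [seq names a.2 | a <- S].
Definition souts S : seq msg := flatten [seq a.2 | a <- S & a.1 == 0].
Definition scalls S : seq atom := [seq a <- S | a.1 != 0].

Lemma snamesP b S : reflect (exists2 a, a \in S & b \in names a.2) (b \in snames S).
Proof. exact: flatten_mapP. Qed.

Lemma snames_cat S1 S2 : snames (S1 ++ S2) = snames S1 ++ snames S2.
Proof. by rewrite /snames map_cat flatten_cat. Qed.
Lemma souts_cat S1 S2 : souts (S1 ++ S2) = souts S1 ++ souts S2.
Proof. by rewrite /souts filter_cat map_cat flatten_cat. Qed.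
Lemma scalls_cat S1 S2 : scalls (S1 ++ S2) = scalls S1 ++ scalls S2.
Proof. by rewrite /scalls filter_cat. Qed.
Lemma sren_cat rho S1 S2 : sren rho (S1 ++ S2) = sren rho S1 ++ sren rho S2.
Proof. exact: map_cat. Qed.

Lemma aren_comp rho rho' a : aren rho (aren rho' a) = aren (rho \o rho') a.
Proof.
by rewrite /aren /= -map_comp; congr pair; apply: eq_map => M /=; rewrite mren_comp.
Qed.

Lemma sren_comp rho rho' S : sren rho (sren rho' S) = sren (rho \o rho') S.
Proof. by rewrite /sren -map_comp; apply: eq_map => a /=; rewrite aren_comp. Qed.

Lemma aren_ext rho rho' (a : atom) : {in names a.2, rho =1 rho'} -> aren rho a = aren rho' a.
Proof. by move=> eqr; congr pair; apply: mren_ext_in. Qed.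

Lemma sren_ext rho rho' S : {in snames S, rho =1 rho'} -> sren rho S = sren rho' S.
Proof.
move=> eqr; apply/eq_in_map => a aS; apply: aren_ext => b bin.
by apply: eqr; apply/snamesP; exists a.
Qed.

Lemma sren_idE rho S : {in snames S, rho =1 id} -> sren rho S = S.
Proof.
move/sren_ext->; rewrite /sren -[RHS]map_id; apply: eq_map => -[k Ms].
rewrite /aren /=; congr pair; rewrite -[RHS]map_id; apply: eq_map => M.
exact: mren_id.
Qed.

Lemma snames_sren rho S : snames (sren rho S) = map rho (snames S).
Proof.
rewrite /snames /sren map_flatten -!map_comp; congr flatten; apply: eq_map => a /=.
exact: names_ren.
Qed.

Lemma souts_sren rho S : souts (sren rho S) = map (mren rho) (souts S).
Proof.
rewrite /souts /sren map_flatten filter_map -!map_comp; congr flatten.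
Qed.

Lemma scalls_sren rho S : scalls (sren rho S) = sren rho (scalls S).
Proof. by rewrite /scalls /sren filter_map. Qed.

Lemma names_souts S : {subset names (souts S) <= snames S}.
Proof.
move=> b /namesP[M /flatten_mapP[a]]; rewrite mem_filter => /andP[_ aS] Ma bM.
by apply/snamesP; exists a => //; apply/namesP; exists M.
Qed.

Lemma perm_souts S1 S2 : perm_eq S1 S2 -> souts S1 =i souts S2.
Proof.
move=> /perm_mem e M; apply/flatten_mapP/flatten_mapP => -[a];
  rewrite mem_filter => /andP[a0 aS] Ma; exists a; rewrite // mem_filter a0 /=.
  by rewrite -e.
by rewrite e.
Qed.

Lemma perm_scalls S1 S2 : perm_eq S1 S2 -> perm_eq (scalls S1) (scalls S2).
Proof. exact: perm_filter. Qed.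

Lemma perm_snames S1 S2 : perm_eq S1 S2 -> snames S1 =i snames S2.
Proof.
by move=> /perm_mem e b; apply/snamesP/snamesP => -[a]; [rewrite e|rewrite -e]; exists a.
Qed.

(* The constructors mirror the node labels 0, ..., 6 of [enc_lim], so that a
   limit and its template have the same code; [TId] is the wrapper [RB]. *)
Inductive tmpl : Type :=
| T0
| TPar (t1 t2 : tmpl)
| TId (t : tmpl)
| TOm (t : tmpl)
| TOut (M : msg)
| TCall (q : nat) (Ms : seq msg)
| TNu (x : nat) (t : tmpl).

Fixpoint tfn (t : tmpl) : seq nat :=
  match t with
  | T0 => [::]
  | TPar t1 t2 => tfn t1 ++ tfn t2
  | TId t | TOm t => tfn t
  | TOut M => names [:: M]
  | TCall _ Ms => names Ms
  | TNu x t => [seq a <- tfn t | a != x]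
  end.

(* [flat t rho X S]: some instance of t has the atoms S once its binders receive,
   in order, the names X and its free names are mapped by rho. *)
Inductive flat : tmpl -> (nat -> nat) -> seq nat -> seq atom -> Prop :=
| flat_0 rho : flat T0 rho [::] [::]
| flat_par t1 t2 rho X1 S1 X2 S2 : flat t1 rho X1 S1 -> flat t2 rho X2 S2 ->
    flat (TPar t1 t2) rho (X1 ++ X2) (S1 ++ S2)
| flat_id t rho X S : flat t rho X S -> flat (TId t) rho X S
| flat_om0 t rho : flat (TOm t) rho [::] [::]
| flat_omS t rho X1 S1 X2 S2 : flat t rho X1 S1 -> flat (TOm t) rho X2 S2 ->
    flat (TOm t) rho (X1 ++ X2) (S1 ++ S2)
| flat_out M rho : flat (TOut M) rho [::] [:: (0, map (mren rho) [:: M])]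
| flat_call q Ms rho : flat (TCall q Ms) rho [::] [:: (q.+1, map (mren rho) Ms)]
| flat_nu x t rho b X S : flat t (upd rho x b) X S -> flat (TNu x t) rho (b :: X) S.

Lemma flat_ext t rho rho' X S :
  flat t rho X S -> {in tfn t, rho =1 rho'} -> flat t rho' X S.
Proof.
move=> h; elim: h rho' => {t rho X S} /=.
- by move=> rho rho' _; constructor.
- move=> t1 t2 rho X1 S1 X2 S2 _ IH1 _ IH2 rho' e.
  by constructor; [apply: IH1|apply: IH2] => a ain; apply: e; rewrite mem_cat ain ?orbT.
- by move=> t rho X S _ IH rho' e; constructor; apply: IH.
- by move=> t rho rho' _; constructor.
- by move=> t rho X1 S1 X2 S2 _ IH1 _ IH2 rho' e; constructor; [apply: IH1|apply: IH2].
- by move=> M rho rho' /mren_ext_in/=[->]; apply: flat_out.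
- by move=> q Ms rho rho' e; rewrite (mren_ext_in e); constructor.
- move=> x t rho b X S _ IH rho' e; constructor; apply: IH => a ain.
  by rewrite /upd; case: eqP => // /eqP ax; apply: e; rewrite mem_filter ax.
Qed.

(** Binders receive their names explicitly, so a renaming acts on the environment and on the
    supplied names alike, and capture does not arise. *)
Lemma flat_ren theta t rho X S :
  flat t rho X S -> flat t (theta \o rho) (map theta X) (sren theta S).
Proof.
elim=> {t rho X S} /=; try by (move=> *; constructor).
- by move=> *; rewrite map_cat sren_cat; constructor.
- by move=> *; rewrite map_cat sren_cat; constructor.
- by move=> M rho; rewrite /sren /aren /= mren_comp; apply: flat_out.
- move=> q Ms rho; rewrite /sren /aren /= -map_comp.
  by under eq_map do rewrite /= mren_comp; constructor.
- move=> x t rho b X S _ IH; constructor; apply: flat_ext IH _ => a _.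
  by rewrite /upd /=; case: ifP.
Qed.

Lemma flat_ren_fix theta t rho X S : flat t rho X S ->
  (forall a, a \in tfn t -> theta (rho a) = rho a) ->
  flat t rho (map theta X) (sren theta S).
Proof. by move=> /(flat_ren theta) h e; apply: flat_ext h _. Qed.

Lemma flat_names t rho X S :
  flat t rho X S -> {subset snames S <= X ++ map rho (tfn t)}.
Proof.
elim=> {t rho X S} //=.
- move=> t1 t2 rho X1 S1 X2 S2 _ IH1 _ IH2 a; rewrite snames_cat !(map_cat, mem_cat).
  by case/orP => [/IH1|/IH2]; rewrite !mem_cat => /orP[]->; rewrite ?orbT.
- move=> t rho X1 S1 X2 S2 _ IH1 _ IH2 a; rewrite snames_cat !(map_cat, mem_cat).
  by case/orP => [/IH1|/IH2]; rewrite !mem_cat => /orP[]->; rewrite ?orbT.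
- by move=> M rho a; rewrite /snames /= cats0 -[[:: mren rho M]]/(map (mren rho) [:: M]) names_ren.
- by move=> q Ms rho a; rewrite /snames /= cats0 names_ren.
- move=> x t rho b X S _ IH a /IH; rewrite inE !mem_cat.
  case/orP => [->|/mapP[c cin ->]]; first by rewrite orbT.
  rewrite /upd; case: (c =P x) => [_|/eqP cx]; first by rewrite eqxx.
  by rewrite map_f ?orbT // mem_filter cx.
Qed.


(** * Unfoldings, replication-free templates and pruning *)

Definition copies k (t : tmpl) := iter k (TPar t) T0.

(** With all nesting levels unfolded equally often, an instance is determined by the names of its
    binders and the environment. *)
Fixpoint full m (t : tmpl) : tmpl :=
  match t with
  | TPar t1 t2 => TPar (full m t1) (full m t2)
  | TId t => TId (full m t)
  | TOm t => copies m (full m t)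
  | TNu x t => TNu x (full m t)
  | _ => t
  end.

(** Stops at the outermost replications: those nested in a block survive in its copies and are
    outermost in the result. *)
Fixpoint unf k (t : tmpl) : tmpl :=
  match t with
  | TPar t1 t2 => TPar (unf k t1) (unf k t2)
  | TId t => TId (unf k t)
  | TOm t => copies k t
  | TNu x t => TNu x (unf k t)
  | _ => t
  end.

Fixpoint omfree (t : tmpl) : bool :=
  match t with
  | TPar t1 t2 => omfree t1 && omfree t2
  | TId t | TNu _ t => omfree t
  | TOm _ => false
  | _ => true
  end.

Fixpoint nbind (t : tmpl) : nat :=
  match t with
  | TPar t1 t2 => nbind t1 + nbind t2
  | TId t => nbind t
  | TNu _ t => (nbind t).+1
  | _ => 0
  end.

(** On replication-free templates [flat] is the graph of this function; the value at a replication
    is a default. *)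
Fixpoint atoms (t : tmpl) (rho : nat -> nat) (X : seq nat) : seq atom :=
  match t with
  | TPar t1 t2 => atoms t1 rho (take (nbind t1) X) ++ atoms t2 rho (drop (nbind t1) X)
  | TId t => atoms t rho X
  | TOut M => [:: (0, map (mren rho) [:: M])]
  | TCall q Ms => [:: (q.+1, map (mren rho) Ms)]
  | TNu x t => atoms t (upd rho x (head 0 X)) (behead X)
  | _ => [::]
  end.

Lemma flat_omfree t rho X S : omfree t -> flat t rho X S ->
  size X = nbind t /\ S = atoms t rho X.
Proof.
move=> of_t h; elim: h of_t => {t rho X S} //=.
- move=> t1 t2 rho X1 S1 X2 S2 _ IH1 _ IH2 /andP[/IH1[sz1 ->] /IH2[sz2 ->]].
  by rewrite size_cat sz1 sz2 -sz1 take_size_cat // drop_size_cat.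
- by move=> x t rho b X S _ IH /IH[-> ->].
Qed.

Lemma flat_atoms t rho X : omfree t -> size X = nbind t -> flat t rho X (atoms t rho X).
Proof.
elim: t rho X => //=.
- by move=> rho X _ /size0nil->; constructor.
- move=> t1 IH1 t2 IH2 rho X /andP[of1 of2] sz.
  rewrite -{1}(cat_take_drop (nbind t1) X); constructor; [apply: IH1|apply: IH2] => //.
    by rewrite size_takel // sz leq_addr.
  by rewrite size_drop sz addKn.
- by move=> t IH rho X of_t sz; constructor; apply: IH.
- by move=> M rho X _ /size0nil->; constructor.
- by move=> q Ms rho X _ /size0nil->; constructor.
- by move=> x t IH rho [|b X] //= of_t [sz]; constructor; apply: IH.
Qed.

(** A replication-free template has a single shape, so matching the binders of two instances matches
    all their atoms. This makes copies of a block interchangeable. *)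
Lemma flat_det_ren t rho X X' S S' theta : omfree t ->
  flat t rho X S -> flat t rho X' S' -> map theta X = X' ->
  (forall a, a \in tfn t -> theta (rho a) = rho a) -> S' = sren theta S.
Proof.
move=> of_t h h' eX fixt.
have := flat_ren_fix h fixt; rewrite eX => /(flat_omfree of_t)[_ ->].
by case: (flat_omfree of_t h').
Qed.

Lemma omfree_copies k t : omfree t -> omfree (copies k t).
Proof. by move=> of_t; elim: k => //= k ->; rewrite of_t. Qed.

Lemma omfree_full m t : omfree (full m t).
Proof. by elim: t => //= [t1 -> t2 ->|t IHt] //; apply: omfree_copies. Qed.

Lemma tfn_copies k t : {subset tfn (copies k t) <= tfn t}.
Proof. by elim: k => //= k IHk a; rewrite mem_cat => /orP[|/IHk]. Qed.

Lemma tfn_full m t : {subset tfn (full m t) <= tfn t}.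
Proof.
elim: t => /=; try by move=> *.
- by move=> t1 IH1 t2 IH2 a; rewrite !mem_cat => /orP[/IH1|/IH2] ->; rewrite ?orbT.
- by move=> t IHt a /tfn_copies/IHt.
- by move=> x t IHt a; rewrite !mem_filter => /andP[-> /IHt].
Qed.

Lemma flat_copies k t rho X S : flat (copies k t) rho X S -> flat (TOm t) rho X S.
Proof.
elim: k X S => [|k IHk] X S /= h; inversion h; subst; first by constructor.
by constructor => //; apply: IHk.
Qed.

Lemma flat_om_sub t t' rho X S : (forall X S, flat t rho X S -> flat t' rho X S) ->
  flat (TOm t) rho X S -> flat (TOm t') rho X S.
Proof.
move=> sub h; move: {-1}(TOm t) (erefl (TOm t)) h => u eu h.
elim: h eu sub => {u rho X S} // [u rho _ _|u rho X1 S1 X2 S2 h1 _ _ IH2 [eu] sub].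
  by constructor.
by subst; constructor; [apply: sub | apply: IH2].
Qed.

Lemma flat_full m t rho X S : flat (full m t) rho X S -> flat t rho X S.
Proof.
elim: t rho X S => //=.
- move=> t1 IH1 t2 IH2 rho X S h; inversion h; subst.
  by constructor; [apply: IH1|apply: IH2].
- by move=> t IHt rho X S h; inversion h; subst; constructor; apply: IHt.
- by move=> t IHt rho X S /flat_copies; apply: flat_om_sub => *; apply: IHt.
- by move=> x t IHt rho X S h; inversion h; subst; constructor; apply: IHt.
Qed.

Lemma flat_unf k t rho X S : flat (unf k t) rho X S -> flat t rho X S.
Proof.
elim: t rho X S => //=.
- move=> t1 IH1 t2 IH2 rho X S h; inversion h; subst.
  by constructor; [apply: IH1|apply: IH2].
- by move=> t IHt rho X S h; inversion h; subst; constructor; apply: IHt.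
- by move=> t IHt rho X S /flat_copies.
- by move=> x t IHt rho X S h; inversion h; subst; constructor; apply: IHt.
Qed.

(* Free names that occur in every instance. *)
Fixpoint need (t : tmpl) : seq nat :=
  match t with
  | T0 | TOm _ => [::]
  | TPar t1 t2 => need t1 ++ need t2
  | TId t => need t
  | TOut M => names [:: M]
  | TCall _ Ms => names Ms
  | TNu x t => [seq a <- need t | a != x]
  end.

Definition prunable (B : seq nat) t := all (mem B) (need t).

(** Every copy of a block exhibits the names in [need], so an instance confined to the free names in
    [B] takes no copy of a block that needs another one. Under a binder the bound name is harmless
    and joins [B]. *)
Fixpoint prune (B : seq nat) (t : tmpl) : tmpl :=
  match t with
  | TPar t1 t2 => TPar (prune B t1) (prune B t2)
  | TId t => TId (prune B t)
  | TOm t => if prunable B t then TOm (prune B t) else T0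
  | TNu x t => TNu x (prune (x :: B) t)
  | _ => t
  end.

Lemma prunable_nu B x t : prunable B (TNu x t) = prunable (x :: B) t.
Proof.
rewrite /prunable /= all_filter; apply: eq_all => a /=; rewrite inE.
by case: (a == x).
Qed.

Lemma flat_prune B t rho X S : flat (prune B t) rho X S -> flat t rho X S.
Proof.
elim: t B rho X S => //=.
- move=> t1 IH1 t2 IH2 B rho X S h; inversion h; subst.
  by constructor; [apply: IH1; eassumption|apply: IH2; eassumption].
- by move=> t IHt B rho X S h; inversion h; subst; constructor; apply: IHt; eassumption.
- move=> t IHt B rho X S; case: ifP => _ h.
    by apply: flat_om_sub h => *; apply: IHt; eassumption.
  by inversion h; constructor.
- by move=> x t IHt B rho X S h; inversion h; subst; constructor; apply: IHt; eassumption.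
Qed.

Lemma tfn_prune B t : prunable B t -> {subset tfn (prune B t) <= B}.
Proof.
elim: t B => //=.
- move=> t1 IH1 t2 IH2 B; rewrite /prunable all_cat => /andP[/IH1 h1 /IH2 h2] a.
  by rewrite mem_cat => /orP[/h1|/h2].
- by move=> t IHt B _; case: ifP => // /IHt.
- by move=> M B /allP.
- by move=> q Ms B /allP.
- move=> x t IHt B; rewrite prunable_nu => /IHt h a; rewrite mem_filter => /andP[ax /h].
  by rewrite inE (negbTE ax).
Qed.

Lemma flat_prunable B t rho X S : flat t rho X S ->
  (forall a, a \in tfn t -> a \notin B -> rho a \notin snames S) ->
  prunable B t /\ flat (prune B t) rho X S.
Proof.
move=> h; elim: h B => {t rho X S} /=.
- by move=> rho B _; split=> //; constructor.
- move=> t1 t2 rho X1 S1 X2 S2 _ IH1 _ IH2 B hB.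
  have [|p1 f1] := IH1 B.
    move=> a a1 aB; have := hB a; rewrite snames_cat !mem_cat a1 negb_or.
    by case/(_ isT aB)/andP.
  have [|p2 f2] := IH2 B.
    move=> a a1 aB; have := hB a; rewrite snames_cat !mem_cat a1 orbT negb_or.
    by case/(_ isT aB)/andP.
  by split; [rewrite /prunable all_cat; apply/andP | constructor].
- by move=> t rho X S _ IH B /IH[p f]; split=> //; constructor.
- by move=> t rho B _; split=> //; case: ifP => _; constructor.
- move=> t rho X1 S1 X2 S2 _ IH1 _ IH2 B hB.
  have [|p1 f1] := IH1 B.
    move=> a a1 aB; have := hB a a1 aB; rewrite snames_cat !mem_cat negb_or.
    by case/andP.
  have [|p2 f2] := IH2 B.
    move=> a a1 aB; have := hB a a1 aB; rewrite snames_cat !mem_cat negb_or.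
    by case/andP.
  by split=> //; move: f2; rewrite p1; constructor.
- move=> M rho B hB; split; last by constructor.
  apply/allP => a aM /=; apply: contraT => aB; have := hB a aM aB.
  rewrite /snames /= cats0 -[[:: mren rho M]]/(map (mren rho) [:: M]) names_ren.
  by rewrite map_f.
- move=> q Ms rho B hB; split; last by constructor.
  apply/allP => a aM /=; apply: contraT => aB; have := hB a aM aB.
  by rewrite /snames /= cats0 names_ren map_f.
- move=> x t rho b X S _ IH B hB; rewrite prunable_nu.
  have [|p f] := IH (x :: B); last by split=> //; constructor.
  move=> a ain; rewrite inE negb_or /upd => /andP[ax aB]; rewrite (negbTE ax).
  by apply: hB => //; rewrite mem_filter ax.
Qed.
End Templates.

(** * Duplicating the unconstrained part of an instance *)

Section Instances.
Variables (nc : nat) (ar : nat -> nat).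
Notation msg := (Defs.msg nc ar).
Notation atom := (nat * seq msg)%type.
Notation tmpl := (tmpl nc ar).
Implicit Types (S : seq atom) (X : seq nat) (rho theta : nat -> nat) (t u : tmpl).

(* Bounds the number of binders and calls in the part of an instance of t that
   can neither be moved nor duplicated once c of them have been fixed. *)
Fixpoint kbound t (c : nat) : nat :=
  match t with
  | TPar t1 t2 => kbound t1 c + kbound t2 c
  | TId t => kbound t c
  | TOm t => c * kbound t c
  | TCall _ _ => 1
  | TNu _ t => (kbound t c).+1
  | _ => 0
  end.

Lemma kbound_mono t c c' : c <= c' -> kbound t c <= kbound t c'.
Proof.
by move=> le; elim: t => //= *; rewrite ?leq_add ?leq_mul.
Qed.

Lemma kbound_prune B t c : kbound (prune B t) c <= kbound t c.
Proof.
elim: t B => //=.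
- by move=> t1 IH1 t2 IH2 B; rewrite leq_add.
- by move=> t IHt B; case: ifP => //= _; rewrite leq_mul.
- by move=> x t IHt B; rewrite ltnS.
Qed.

(** The primed part stays fixed and the doubly primed part can be duplicated under any renaming that
    fixes the former and the free names. A copy of a replication without a name in [T] is duplicable
    as a whole; a copy with such a name is split recursively; binders, outputs and calls outside
    replications are fixed. Outputs are not counted in the bound, as knowledge can be used
    repeatedly. *)
Lemma flat_dup t rho X S : flat t rho X S -> forall T : seq nat,
  exists X' X'' S' S'',
    [/\ perm_eq X (X' ++ X''), perm_eq S (S' ++ S''),
        size X' + size (scalls S') <= kbound t (count (mem T) X) &
     [/\ (forall a, a \in X -> a \in T -> a \in X'),
        {subset snames S' <= X' ++ map rho (tfn t)} &
        forall theta, {in X', theta =1 id} ->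
          (forall a, a \in tfn t -> theta (rho a) = rho a) ->
          exists Y Z, [/\ flat t rho Y Z, perm_eq Y (X ++ map theta X'')
                        & perm_eq Z (S ++ sren theta S'')]]].
Proof.
elim=> {t rho X S} /=.
- move=> rho T; exists [::], [::], [::], [::]; do 2!split=> //.
  by move=> theta _ _; exists [::], [::]; split=> //; constructor.
- move=> t1 t2 rho X1 S1 X2 S2 h1 IH1 h2 IH2 T.
  have [Xa [Xb [Sa [Sb [pX pS sz [hT nm hth]]]]]] := IH1 T.
  have [Xc [Xd [Sc [Sd [pX' pS' sz' [hT' nm' hth']]]]]] := IH2 T.
  exists (Xa ++ Xc), (Xb ++ Xd), (Sa ++ Sc), (Sb ++ Sd).
  split; [| |rewrite scalls_cat !size_cat count_cat addnACA|split].
  + by apply/permP => x; rewrite !count_cat (permP pX) (permP pX') !count_cat; lia.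
  + by apply/permP => x; rewrite !count_cat (permP pS) (permP pS') !count_cat; lia.
  + apply: leq_add; [apply: leq_trans sz _|apply: leq_trans sz' _]; apply: kbound_mono;
      lia.
  + by move=> a; rewrite !mem_cat => /orP[/hT h /h|/hT' h /h] ->; rewrite ?orbT.
  + move=> a; rewrite snames_cat !(map_cat, mem_cat).
    by case/orP=> [/nm|/nm']; rewrite mem_cat => /orP[]->; rewrite ?orbT.
  + move=> theta fX ft.
    have [|a a1|Y [Z [f pY pZ]]] := hth theta.
    * by move=> a ain; apply: fX; rewrite mem_cat ain.
    * by apply: ft; rewrite mem_cat a1.
    have [|a a1|Y' [Z' [f' pY' pZ']]] := hth' theta.
    * by move=> a ain; apply: fX; rewrite mem_cat ain orbT.
    * by apply: ft; rewrite mem_cat a1 orbT.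
    exists (Y ++ Y'), (Z ++ Z'); split; first by constructor.
      by apply/permP => x; rewrite map_cat !count_cat (permP pY) (permP pY') !count_cat; lia.
    by apply/permP => x; rewrite sren_cat !count_cat (permP pZ) (permP pZ') !count_cat; lia.
- move=> t rho X S _ IH T; have [Xa [Xb [Sa [Sb [pX pS sz [hT nm hth]]]]]] := IH T.
  exists Xa, Xb, Sa, Sb; do 2!split=> //.
  move=> theta fX ft; have [Y [Z [f pY pZ]]] := hth theta fX ft.
  by exists Y, Z; split=> //; constructor.
- move=> t rho T; exists [::], [::], [::], [::]; do 2!split=> //.
  by move=> theta _ _; exists [::], [::]; split=> //; constructor.
- move=> t rho X1 S1 X2 S2 h1 IH1 h2 IH2 T.
  have [Xc [Xd [Sc [Sd [pX' pS' sz' [hT' nm' hth']]]]]] := IH2 T.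
  (* If the first copy contains no name of [T], all of it goes to the duplicable part. *)
  have [/eqP c0|tch] := boolP (count (mem T) X1 == 0).
    exists Xc, (X1 ++ Xd), Sc, (S1 ++ Sd).
    split; [| |rewrite count_cat c0 //|split=> //].
    + by apply/permP => x; rewrite !count_cat (permP pX') !count_cat; lia.
    + by apply/permP => x; rewrite !count_cat (permP pS') !count_cat; lia.
    + move=> a; rewrite mem_cat => /orP[a1 aT|/hT']; last by [].
      by move/eqP: c0; rewrite eqn0Ngt -has_count => /hasPn/(_ a a1)/negP[].
    + move=> theta fX ft; have [Y' [Z' [f' pY' pZ']]] := hth' theta fX ft.
      exists (X1 ++ map theta X1 ++ Y'), (S1 ++ sren theta S1 ++ Z').
      split; first by do 2?[constructor=> //]; apply: flat_ren_fix h1 ft.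
        by apply/permP => x; rewrite map_cat !count_cat (permP pY') !count_cat; lia.
      by apply/permP => x; rewrite sren_cat !count_cat (permP pZ') !count_cat; lia.
  have [Xa [Xb [Sa [Sb [pX pS sz [hT nm hth]]]]]] := IH1 T.
  exists (Xa ++ Xc), (Xb ++ Xd), (Sa ++ Sc), (Sb ++ Sd).
  split; [| |rewrite scalls_cat !size_cat count_cat addnACA|split].
  + by apply/permP => x; rewrite !count_cat (permP pX) (permP pX') !count_cat; lia.
  + by apply/permP => x; rewrite !count_cat (permP pS) (permP pS') !count_cat; lia.
  (* A copy that is split contains at least one of the counted names, and this name pays for its
     share of the factor in [kbound]. *)
  + set c1 := count _ X1 in sz tch *; set c2 := count _ X2 in sz' *.
    have c1P : 0 < c1 by rewrite lt0n.
    have h1' := @kbound_mono t c1 (c1 + c2) (leq_addr _ _).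
    have h2' := @kbound_mono t c2 (c1 + c2) (leq_addl _ _).
    apply: leq_trans (leq_add sz sz') _; rewrite mulnDl.
    apply: leq_add; last by rewrite leq_mul.
    by apply: leq_trans h1' _; rewrite leq_pmull.
  + by move=> a; rewrite !mem_cat => /orP[/hT h /h|/hT' h /h] ->; rewrite ?orbT.
  + move=> a; rewrite snames_cat !(map_cat, mem_cat).
    by case/orP=> [/nm|/nm']; rewrite mem_cat => /orP[]->; rewrite ?orbT.
  + move=> theta fX ft.
    have [|Y [Z [f pY pZ]]] := hth theta _ ft.
      by move=> a ain; apply: fX; rewrite mem_cat ain.
    have [|Y' [Z' [f' pY' pZ']]] := hth' theta _ ft.
      by move=> a ain; apply: fX; rewrite mem_cat ain orbT.
    exists (Y ++ Y'), (Z ++ Z'); split; first by constructor.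
      by apply/permP => x; rewrite map_cat !count_cat (permP pY) (permP pY') !count_cat; lia.
    by apply/permP => x; rewrite sren_cat !count_cat (permP pZ) (permP pZ') !count_cat; lia.
- move=> M rho T; exists [::], [::], [:: (0, [:: mren rho M])], [::].
  do 2!split=> //.
    rewrite /snames /= cats0 -[[:: mren rho M]]/(map (mren rho) [:: M]) names_ren.
    exact.
  move=> theta _ _; exists [::], [:: (0, [:: mren rho M])]; split=> //.
  exact: flat_out.
- move=> q Ms rho T; exists [::], [::], [:: (q.+1, map (mren rho) Ms)], [::].
  do 2!split=> //; first by rewrite /snames /= cats0 names_ren.
  move=> theta _ _; exists [::], [:: (q.+1, map (mren rho) Ms)]; split=> //.
  exact: flat_call.
- move=> x t rho b X S _ IH T; have [Xa [Xb [Sa [Sb [pX pS sz [hT nm hth]]]]]] := IH T.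
  exists (b :: Xa), Xb, Sa, Sb; split; rewrite ?perm_cons //=.
    rewrite addSn ltnS (leq_trans sz) // kbound_mono //; lia.
  split.
  + by move=> a; rewrite !inE => /orP[->//|/hT h /h ->]; rewrite orbT.
  + move=> a /nm; rewrite inE !mem_cat => /orP[->|/mapP[c cin ->]]; first by rewrite orbT.
    rewrite /upd; case: (c =P x) => [_|/eqP cx]; first by rewrite eqxx.
    by rewrite map_f ?orbT // mem_filter cx.
  + move=> theta fX ft; have [||Y [Z [f pY pZ]]] := hth theta.
    * by move=> a ain; apply: fX; rewrite inE ain orbT.
    * move=> a ain; rewrite /upd; case: (a =P x) => [_|/eqP ax].
        by apply: fX; rewrite mem_head.
      by apply: ft; rewrite mem_filter ax.
    by exists (b :: Y), Z; split; rewrite ?perm_cons //; constructor.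
Qed.

End Instances.

(** * Absorbing untouched copies *)

Lemma map_nsubst xs ys : uniq xs -> size xs = size ys -> map (nsubst xs ys) xs = ys.
Proof.
move=> uxs sz; apply: (@eq_from_nth _ 0); rewrite size_map // => i lti.
rewrite (nth_map 0) // /nsubst mem_nth // index_uniq //.
by apply: set_nth_default; rewrite -sz.
Qed.

Lemma nsubst_id xs ys a : a \notin xs -> nsubst xs ys a = a.
Proof. by rewrite /nsubst => /negbTE->. Qed.

Section Shrink.
Variables (nc : nat) (ar : nat -> nat).
Notation msg := (Defs.msg nc ar).
Notation atom := (nat * seq msg)%type.
Notation tmpl := (tmpl nc ar).
Implicit Types (S Qt : seq atom) (X R T Av : seq nat) (D : seq msg) (rho theta : nat -> nat) (t u : tmpl).
Variable der : seq msg -> msg -> Prop.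
Hypothesis model : intruder_model der.
Hypothesis abs : absorbing der.

(* u has an instance that keeps the names T and the calls Qt of (X, S) and all
   the knowledge that (X, S) gives about messages in which X occurs only via T. *)
Definition shrunk u rho (R : seq nat) X S (T : seq nat) Qt (Av : seq nat) :=
  exists X' S', [/\ flat u rho X' S', uniq X',
    (forall a, a \in X' -> a \in Av -> a \in X),
    (forall a, a \in X -> a \in T -> a \in X') &
    [/\ msub Qt (scalls S'), {subset snames S' <= X' ++ R} &
     forall D M, (forall a, a \in mnames M ++ names D -> a \in Av) ->
       (forall a, a \in mnames M ++ names D -> a \in X -> a \in T) ->
       der (D ++ souts S) M -> der (D ++ souts S') M]].

Lemma in_names_cat (M : msg) (D G : seq msg) a : a \in mnames M ++ names (D ++ G) ->
  a \in mnames M ++ names D \/ a \in names G.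
Proof. by rewrite names_cat catA mem_cat => /orP. Qed.

(** The second component is shrunk with the new names of the first among those to avoid. A
    derivation is then carried over one component at a time, the outputs of the other one belonging
    to the context [D]; this is why [shrunk] quantifies over [D]. *)
Lemma shrunk_pair u1 u2 rho R X1 S1 X2 S2 T (Qt1 Qt2 : seq atom) Av :
  uniq (X1 ++ X2) -> (forall a, a \in R -> a \notin X1 ++ X2) ->
  {subset X1 ++ X2 <= Av} -> {subset R <= Av} ->
  {subset snames S2 <= X2 ++ R} ->
  (forall Av, {subset X1 <= Av} -> {subset R <= Av} -> shrunk u1 rho R X1 S1 T Qt1 Av) ->
  (forall Av, {subset X2 <= Av} -> {subset R <= Av} -> shrunk u2 rho R X2 S2 T Qt2 Av) ->
  exists Xa Sa Xb Sb,
    [/\ flat u1 rho Xa Sa, flat u2 rho Xb Sb, uniq (Xa ++ Xb) &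
    [/\ forall a, a \in Xa -> a \in Av -> a \in X1,
        forall a, a \in Xb -> a \in Av -> a \in X2,
        forall a, a \in X1 -> a \in T -> a \in Xa &
        forall a, a \in X2 -> a \in T -> a \in Xb]] /\
    [/\ msub Qt1 (scalls Sa), msub Qt2 (scalls Sb),
        {subset snames Sa <= Xa ++ R}, {subset snames Sb <= Xb ++ R} &
     forall D M, (forall a, a \in mnames M ++ names D -> a \in Av) ->
       (forall a, a \in mnames M ++ names D -> a \in X1 ++ X2 -> a \in T) ->
       der (D ++ souts (S1 ++ S2)) M -> der (D ++ souts (Sa ++ Sb)) M].
Proof.
rewrite cat_uniq => /and3P[ux1 /hasPn dis ux2] hR XAv RAv nS2 h1 h2.
have X1Av : {subset X1 <= Av} by move=> a ain; apply: XAv; rewrite mem_cat ain.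
have X2Av : {subset X2 <= Av} by move=> a ain; apply: XAv; rewrite mem_cat ain orbT.
have [Xa [Sa [fa ua avA Ta [Qa na da]]]] := h1 Av X1Av RAv.
have [||Xb [Sb [fb ub avB Tb [Qb nb db]]]] := h2 (Av ++ Xa).
- by move=> a /X2Av ain; rewrite mem_cat ain.
- by move=> a /RAv ain; rewrite mem_cat ain.
exists Xa, Sa, Xb, Sb; do 2!split=> //.
- rewrite cat_uniq ua ub andbT /=; apply/hasPn => a ab; apply/negP => /= aa.
  have a2 : a \in X2 by apply: avB => //; rewrite mem_cat aa orbT.
  by have /negP := dis a a2; apply; apply: avA => //; apply: X2Av.
- by split=> // a ab aAv; apply: avB => //; rewrite mem_cat aAv.
move=> D M hAv hT dM.
have {}dM : der ((D ++ souts S2) ++ souts S1) M.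
  by apply: (der_mono model) dM => x; rewrite souts_cat !mem_cat => /or3P[]->; rewrite ?orbT.
have {}dM : der ((D ++ souts S2) ++ souts Sa) M.
  apply: da dM => a /in_names_cat[].
  - by apply: hAv.
  - by move/names_souts/nS2; rewrite mem_cat => /orP[/X2Av|/RAv].
  - by move=> h a1; apply: (hT a h); rewrite mem_cat a1.
  - move/names_souts/nS2; rewrite mem_cat => /orP[/dis/negbTE /= -> //|/hR].
    by rewrite mem_cat negb_or => /andP[/negbTE->].
have {}dM : der ((D ++ souts Sa) ++ souts S2) M.
  by apply: (der_mono model) dM => x; rewrite !mem_cat => /orP[/orP[]|]->; rewrite ?orbT.
have {}dM : der ((D ++ souts Sa) ++ souts Sb) M.
  apply: db dM => a /in_names_cat[].
  - by move/hAv; rewrite mem_cat => ->.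
  - move/names_souts/na; rewrite !mem_cat => /orP[->|/RAv->]; by rewrite ?orbT.
  - by move=> h a1; apply: (hT a h); rewrite mem_cat a1 orbT.
  - move/names_souts/na; rewrite mem_cat => /orP[aa a2|/hR].
      by have /negP[] := dis a a2; apply: avA aa _; apply: X2Av.
    by rewrite mem_cat negb_or => /andP[_ /negbTE->].
by apply: (der_mono model) dM => x; rewrite souts_cat !mem_cat => /orP[/orP[]|]->; rewrite ?orbT.
Qed.

Lemma shrunk_par u1 u2 rho R X1 S1 X2 S2 T (Qt1 Qt2 : seq atom) Av :
  uniq (X1 ++ X2) -> (forall a, a \in R -> a \notin X1 ++ X2) ->
  {subset X1 ++ X2 <= Av} -> {subset R <= Av} ->
  {subset snames S2 <= X2 ++ R} ->
  (forall Av, {subset X1 <= Av} -> {subset R <= Av} -> shrunk u1 rho R X1 S1 T Qt1 Av) ->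
  (forall Av, {subset X2 <= Av} -> {subset R <= Av} -> shrunk u2 rho R X2 S2 T Qt2 Av) ->
  shrunk (TPar u1 u2) rho R (X1 ++ X2) (S1 ++ S2) T (Qt1 ++ Qt2) Av.
Proof.
move=> uX hR XAv RAv nS2 h1 h2.
have [Xa [Sa [Xb [Sb [[fa fb uab [avA avB Ta Tb]] [Qa Qb na nb d]]]]]] :=
  shrunk_pair uX hR XAv RAv nS2 h1 h2.
exists (Xa ++ Xb), (Sa ++ Sb); split=> //; first by constructor.
- by move=> a; rewrite !mem_cat => /orP[/avA h /h->//|/avB h /h->]; rewrite orbT.
- by move=> a; rewrite !mem_cat => /orP[/Ta h /h|/Tb h /h] ->; rewrite ?orbT.
split=> //; first by rewrite scalls_cat; apply: msub_cat.
move=> a; rewrite snames_cat !mem_cat => /orP[/na|/nb]; rewrite !mem_cat.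
  by case/orP=> ->; rewrite ?orbT.
by case/orP=> ->; rewrite ?orbT.
Qed.

Lemma shrunk_perm u rho R X S T Qt Qt' Av : perm_eq Qt' Qt ->
  shrunk u rho R X S T Qt Av -> shrunk u rho R X S T Qt' Av.
Proof.
move=> pQ [X' [S' [f ux av hT [mQ nm d]]]]; exists X', S'; do 2!split=> //.
exact: msub_trans (msub_perm pQ) mQ.
Qed.

(* An untouched copy is absorbed by any other copy of the same block. *)
Lemma shrunk_absorb m t k rho R X1 S1 X2 S2 T Qt Av :
  {subset map rho (tfn t) <= R} ->
  uniq (X1 ++ X2) -> (forall a, a \in R -> a \notin X1 ++ X2) ->
  {subset X1 ++ X2 <= Av} -> {subset R <= Av} ->
  {subset snames S2 <= X2 ++ R} -> (forall a, a \in X1 -> a \notin T) ->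
  (forall Av, {subset X1 <= Av} -> {subset R <= Av} ->
     shrunk (full m t) rho R X1 S1 T [::] Av) ->
  (forall Av, {subset X2 <= Av} -> {subset R <= Av} ->
     shrunk (copies k.+1 (full m t)) rho R X2 S2 T Qt Av) ->
  shrunk (copies k.+1 (full m t)) rho R (X1 ++ X2) (S1 ++ S2) T Qt Av.
Proof.
move=> tR uX hR XAv RAv nS2 unT h1 h2.
have [Xa [Sa [Xb [Sb [[fa fb uab [avA avB Ta Tb]] [_ Qb na nb d]]]]]] :=
  shrunk_pair uX hR XAv RAv nS2 h1 h2.
move: uab; rewrite cat_uniq => /and3P[ua /hasPn dis ub].
have fb' := fb; inversion fb' as [|t1 t2 r Xq Sq Xr Sr fq fr| | | | | |]; subst.
exists (Xq ++ Xr), (Sq ++ Sr); split=> //.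
- by move=> a /avB h /h; rewrite mem_cat orbC => ->.
- move=> a; rewrite mem_cat => /orP[/unT/negbTE-> //|/Tb h /h //].
split=> // D M hAv hT dM; have {}dM := d D M hAv hT dM.
have of_t := omfree_full m t.
have [uq _] : uniq Xq /\ uniq Xr by move: ub; rewrite cat_uniq => /and3P[].
have sz : size Xq = size Xa.
  by have [-> _] := flat_omfree of_t fq; have [-> _] := flat_omfree of_t fa.
have RXa a : a \in R -> a \notin Xa.
  move=> aR; apply/negP => aa; have := hR a aR.
  by rewrite mem_cat (avA a aa (RAv a aR)).
have RXq a : a \in R -> a \notin Xq.
  move=> aR; apply/negP => aq; have := hR a aR; rewrite mem_cat negb_or => /andP[_ /negP[]].
  by apply: avB (RAv a aR); rewrite mem_cat aq.
have eS : Sa = sren (nsubst Xq Xa) Sq.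
  apply: (flat_det_ren of_t fq fa); first exact: map_nsubst.
  move=> a /tfn_full at_; apply: nsubst_id; apply: RXq; apply: tR; exact: map_f.
have DXa y : y \in Xa -> y \notin mnames M ++ names D.
  move=> ya; apply/negP => yD; have y1 := avA y ya (hAv y yD).
  by have /negP[] := unT y y1; apply: (hT y yD); rewrite mem_cat y1.
(* Renaming the names [Xq] of a remaining copy to [Xa] in the whole knowledge yields a duplicate
   that includes the outputs of [Sa], so absorption discards the latter. *)
apply: (absorb model abs uq ua sz) => [y ya|y ya|].
- rewrite names_cat mem_cat negb_or; have := DXa y ya.
  rewrite mem_cat negb_or => /andP[_ ->] /=; apply/negP => /names_souts/nb.
  rewrite mem_cat => /orP[/dis/negP[]//|/RXa/negP[]//].
- by have := DXa y ya; rewrite mem_cat negb_or => /andP[].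
apply: (der_mono model) dM => x.
rewrite eS !souts_cat souts_sren !map_cat !mem_cat.
by case/or4P=> ->; rewrite ?orbT.
Qed.

Lemma msub_scalls_cat Qt S1 S2 : msub Qt (scalls (S1 ++ S2)) ->
  exists Qt1 Qt2 : seq atom, [/\ perm_eq Qt (Qt1 ++ Qt2),
    msub Qt1 (scalls S1), msub Qt2 (scalls S2) & size Qt = size Qt1 + size Qt2].
Proof.
rewrite scalls_cat => /msub_split[Qt1 [Qt2 [pQ m1 m2]]]; exists Qt1, Qt2; split=> //.
by rewrite (perm_size pQ) size_cat.
Qed.

(** Each copy that holds a name of [T] or a call of [Qt] occupies one of the [m] slots of its
    replication; the strict bound leaves a slot free, whose copy absorbs all untouched copies. Slots
    still empty are filled with fresh copies, which only add knowledge. *)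
Lemma shrink m t rho R X S T Qt Av : flat t rho X S -> uniq X ->
  {subset map rho (tfn t) <= R} -> (forall a, a \in R -> a \notin X) ->
  msub Qt (scalls S) -> count (mem T) X + size Qt < m ->
  {subset X <= Av} -> {subset R <= Av} ->
  shrunk (full m t) rho R X S T Qt Av.
Proof.
have triv u rho' R' S' T' Qt' Av' : flat u rho' [::] S' ->
    {subset map rho' (tfn u) <= R'} -> msub Qt' (scalls S') ->
    shrunk u rho' R' [::] S' T' Qt' Av'.
  move=> f tR mQ; exists [::], S'; do 2!split=> //.
  by move=> a /(flat_names f)/tR.
elim: t rho R X S T Qt Av => /=.
- by move=> rho R X S T Qt Av h; inversion h; subst=> *; apply: triv.
- move=> t1 IH1 t2 IH2 rho R X S T Qt Av h.
  inv_par h X1 S1 X2 S2 f1 f2=> uX tR hR.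
  move=> /msub_scalls_cat[Qt1 [Qt2 [pQ mQ1 mQ2 szQ]]].
  rewrite count_cat szQ => ltm XAv RAv.
  apply: shrunk_perm pQ _.
  have [uX1 uX2] : uniq X1 /\ uniq X2 by move: uX; rewrite cat_uniq => /and3P[].
  have tR1 : {subset map rho (tfn t1) <= R}.
    by move=> a ain; apply: tR; rewrite map_cat mem_cat ain.
  have tR2 : {subset map rho (tfn t2) <= R}.
    by move=> a ain; apply: tR; rewrite map_cat mem_cat ain orbT.
  apply: shrunk_par => //.
  + by move=> a /(flat_names f2); rewrite !mem_cat => /orP[->|/tR2->]; rewrite ?orbT.
  + move=> Av' *; apply: IH1 => //; last by lia.
    by move=> a /hR; rewrite mem_cat negb_or => /andP[].
  + move=> Av' *; apply: IH2 => //; last by lia.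
    by move=> a /hR; rewrite mem_cat negb_or => /andP[].
- move=> t IHt rho R X S T Qt Av h; inversion h; subst=> *.
  have [X' [S' [f ux av hT [mQ nm d]]]] : shrunk (full m t) rho R X S T Qt Av.
    exact: IHt.
  by exists X', S'; split=> //; constructor.
- move=> t IHt rho R X S T Qt Av h uX tR hR mQ ltm XAv RAv.
  (* The number of open slots is separated from the depth parameter: it decreases along the copies
     while [m] remains in force inside each of them. *)
  have [k ek] : exists k, k = m by exists m.
  rewrite -{1}ek; have : k <= m by rewrite ek.
  move: (ltm); rewrite -{1}ek => {ltm ek}.
  move: {-1}(TOm t) (erefl (TOm t)) h => u eu h.
  elim: h eu k Qt Av uX tR hR mQ XAv RAv => {u rho X S} //.
    move=> u rho [eu] k Qt Av _ tR _ mQ _ RAv _ _; subst u.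
    (* No copy is left to place; the open slots receive copies on names beyond [Av]. *)
    pose Y := iota (ubound Av) (nbind (copies k (full m t))).
    have of_c := omfree_copies k (omfree_full m t).
    have f : flat (copies k (full m t)) rho Y (atoms (copies k (full m t)) rho Y).
      by apply: flat_atoms; rewrite ?size_iota.
    exists Y, (atoms (copies k (full m t)) rho Y).
    split; [exact: f | exact: iota_uniq | | by [] |].
      move=> a; rewrite mem_iota => /andP[le _] /ltn_ubound; by rewrite ltnNge le.
    split; first exact: msub_trans mQ (msub0 _).
      move=> a /(flat_names f); rewrite !mem_cat => /orP[->//|/mapP[b]].
      by move=> /tfn_copies/tfn_full bt ->; rewrite tR ?orbT // map_f.
    move=> D M _ _; rewrite cats0; apply: (der_mono model) => x xin.
    by rewrite mem_cat xin.
  move=> u rho X1 S1 X2 S2 f1 _ f2 IH2 [eu] k Qt Av uX tR hR; subst u.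
  move=> /msub_scalls_cat[Qt1 [Qt2 [pQ mQ1 mQ2 szQ]]] XAv RAv.
  rewrite count_cat szQ => ltk lekm.
  have [uX1 uX2] : uniq X1 /\ uniq X2 by move: uX; rewrite cat_uniq => /and3P[].
  have nS2 : {subset snames S2 <= X2 ++ R}.
    by move=> a /(flat_names f2); rewrite !mem_cat => /orP[->|/tR->]; rewrite ?orbT.
  have hR1 a : a \in R -> a \notin X1.
    by move=> /hR; rewrite mem_cat negb_or => /andP[].
  have hR2 a : a \in R -> a \notin X2.
    by move=> /hR; rewrite mem_cat negb_or => /andP[].
  (* An untouched copy is absorbed and takes no slot; a touched one takes a slot and lowers the
     count by at least one. *)
  have [/eqP un|tch] := boolP (count (mem T) X1 + size Qt1 == 0).
    case: k ltk lekm => // k ltk lekm; apply: (shrunk_absorb (m := m) (t := t)) => //.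
    + move=> a a1; apply/negP => aT.
      have : has (mem T) X1 by apply/hasP; exists a.
      by rewrite has_count; lia.
    + by move=> Av' *; apply: IHt => //=; lia.
    + move=> Av' *; apply: IH2 => //; last by rewrite szQ; lia.
      apply: msub_trans (msub_perm pQ) _; rewrite (size0nil (_ : size Qt1 = 0)) //; lia.
  case: k ltk lekm => // k ltk lekm; apply: shrunk_perm pQ _.
  apply: (shrunk_par (u1 := full m t) (u2 := copies k (full m t))) => //.
  + by move=> Av' *; apply: IHt => //; lia.
  + move=> Av' *; apply: IH2 => //; last exact: ltnW.
    move: ltk; rewrite addnACA ltnS; apply: leq_trans.
    by rewrite -add1n leq_add2r lt0n.
- by move=> M rho R X S T Qt Av h; inversion h; subst=> *; apply: triv.
- by move=> q Ms rho R X S T Qt Av h; inversion h; subst=> *; apply: triv.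
- move=> x t IHt rho R X S T Qt Av h.
  inv_nu h b X1 f1=> /= /andP[bX1 uX1] tR hR mQ ltm XAv RAv.
  have bAv : b \in Av by apply: XAv; rewrite mem_head.
  have XAv1 : {subset X1 <= Av} by move=> a ain; apply: XAv; rewrite inE ain orbT.
  have [X' [S' [f ux av hT [mQ' nm d]]]] :
    shrunk (full m t) (upd rho x b) (b :: R) X1 S T Qt Av.
    apply: IHt => //.
    * move=> a /mapP[c ct ->]; rewrite /upd inE; case: (c =P x) => [_|/eqP cx].
        by rewrite eqxx.
      by rewrite tR ?orbT // map_f // mem_filter cx.
    * move=> a; rewrite inE => /predU1P[->//|/hR]; rewrite inE negb_or => /andP[] //.
    * lia.
    * by move=> a; rewrite inE => /predU1P[->|/RAv].
  exists (b :: X'), S'; split.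
  + by constructor.
  + rewrite /= ux andbT; apply/negP => bX'.
    by rewrite (av b bX' bAv) in bX1.
  + by move=> a; rewrite !inE => /predU1P[->|/av h' /h' ->]; rewrite ?eqxx ?orbT.
  + by move=> a; rewrite !inE => /orP[->//|/hT h' /h' ->]; rewrite orbT.
  split=> //.
    by move=> a /nm; rewrite /= !(mem_cat, inE) => /or3P[]->; rewrite ?orbT.
  move=> D M hAv hX; apply: d => // a aD a1; apply: hX => //.
  by rewrite inE a1 orbT.
Qed.

(** Missing copies are added on fresh names until all replications, at all depths, are taken equally
    often; [n0] only has to exceed the numbers of copies present in the given instance. *)
Lemma flat_grow t rho X S : flat t rho X S -> exists n0, forall n, n0 <= n ->
  forall Av : seq nat, exists X' S' Y Z,
    [/\ flat (full n t) rho Y Z, perm_eq Y (X ++ X'), perm_eq Z (S ++ S'),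
        uniq X' & forall a, a \in X' -> a \notin Av].
Proof.
elim: t rho X S => /=.
- move=> rho X S h; exists 0 => n _ Av; exists [::], [::], X, S.
  by rewrite !cats0.
- move=> t1 IH1 t2 IH2 rho X S h; inv_par h X1 S1 X2 S2 f1 f2.
  have [n1 g1] := IH1 _ _ _ f1; have [n2 g2] := IH2 _ _ _ f2.
  exists (n1 + n2) => n len Av.
  have [|Xa [Sa [Ya [Za [fa pa qa ua va]]]]] := g1 n _ Av; first by lia.
  have [|Xb [Sb [Yb [Zb [fb pb qb ub vb]]]]] := g2 n _ (Av ++ Xa); first by lia.
  exists (Xa ++ Xb), (Sa ++ Sb), (Ya ++ Yb), (Za ++ Zb); split; first by constructor.
  + by apply/permP => a; rewrite !count_cat (permP pa) (permP pb) !count_cat; lia.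
  + by apply/permP => a; rewrite !count_cat (permP qa) (permP qb) !count_cat; lia.
  + rewrite cat_uniq ua ub andbT; apply/hasPn => a /vb.
    by rewrite mem_cat negb_or => /andP[].
  + by move=> a; rewrite mem_cat => /orP[/va|/vb] //; rewrite mem_cat negb_or => /andP[].
- move=> t IHt rho X S h; inversion h; subst.
  have [|n1 g1] := IHt rho X S; first by [].
  exists n1 => n len Av; have [Xa [Sa [Ya [Za [fa pa qa ua va]]]]] := g1 n len Av.
  by exists Xa, Sa, Ya, Za; split=> //; constructor.
- move=> t IHt rho X S h.
  suff [n0 g] : exists n0, forall n k, n0 <= n -> n0 <= k -> forall Av : seq nat,
    exists X' S' Y Z, [/\ flat (copies k (full n t)) rho Y Z, perm_eq Y (X ++ X'),
      perm_eq Z (S ++ S'), uniq X' & forall a, a \in X' -> a \notin Av].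
    by exists n0 => n len Av; apply: g.
  move: {-1}(TOm t) (erefl (TOm t)) h => u eu h.
  elim: h eu => {u rho X S} //.
    move=> u rho [eu]; subst u; exists 0 => n k _ _ Av.
    pose Y := iota (ubound Av) (nbind (copies k (full n t))).
    exists Y, (atoms (copies k (full n t)) rho Y), Y, (atoms (copies k (full n t)) rho Y).
    split=> //; [|exact: iota_uniq|].
      by apply: flat_atoms; rewrite ?size_iota // omfree_copies ?omfree_full.
    move=> a; rewrite mem_iota => /andP[le _]; apply/negP => /ltn_ubound.
    by rewrite ltnNge le.
  move=> u rho X1 S1 X2 S2 f1 _ f2 IH2 [eu]; subst u.
  have [n1 g1] := IHt _ _ _ f1; have [//|n2 g2] := IH2 _.
  exists (n1 + n2).+1 => n [//|k] len lek Av.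
  have [|Xa [Sa [Ya [Za [fa pa qa ua va]]]]] := g1 n _ Av; first by lia.
  have [||Xb [Sb [Yb [Zb [fb pb qb ub vb]]]]] := g2 n k _ _ (Av ++ Xa); [by lia|by lia|].
  exists (Xa ++ Xb), (Sa ++ Sb), (Ya ++ Yb), (Za ++ Zb); split; first by constructor.
  + by apply/permP => a; rewrite !count_cat (permP pa) (permP pb) !count_cat; lia.
  + by apply/permP => a; rewrite !count_cat (permP qa) (permP qb) !count_cat; lia.
  + rewrite cat_uniq ua ub andbT; apply/hasPn => a /vb.
    by rewrite mem_cat negb_or => /andP[].
  + by move=> a; rewrite mem_cat => /orP[/va|/vb] //; rewrite mem_cat negb_or => /andP[].
- move=> M rho X S h; exists 0 => n _ Av; exists [::], [::], X, S.
  by rewrite !cats0.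
- move=> q Ms rho X S h; exists 0 => n _ Av; exists [::], [::], X, S.
  by rewrite !cats0.
- move=> x t IHt rho X S h; inv_nu h b X1 f1.
  have [n1 g1] := IHt _ _ _ f1.
  exists n1 => n len Av; have [Xa [Sa [Ya [Za [fa pa qa ua va]]]]] := g1 n len Av.
  by exists Xa, Sa, (b :: Ya), Za; split; rewrite /= ?perm_cons //; constructor.
Qed.
End Shrink.

(** * Groups of copies of the outermost replications *)

Section Pump.
Variables (nc : nat) (ar : nat -> nat).
Notation msg := (Defs.msg nc ar).
Notation atom := (nat * seq msg)%type.
Notation tmpl := (tmpl nc ar).
Implicit Types (S : seq atom) (X A B : seq nat) (rho theta sigma : nat -> nat) (t u : tmpl).

(* [ctx t rho X S Cl]: outside its replications t has the atoms S once its
   binders receive the names X; Cl lists the outermost replicated blocks,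
   each with its environment. *)
Inductive ctx : tmpl -> (nat -> nat) -> seq nat -> seq atom ->
    seq (tmpl * (nat -> nat)) -> Prop :=
| ctx_0 rho : ctx (T0 _ _) rho [::] [::] [::]
| ctx_par t1 t2 rho X1 S1 C1 X2 S2 C2 : ctx t1 rho X1 S1 C1 -> ctx t2 rho X2 S2 C2 ->
    ctx (TPar t1 t2) rho (X1 ++ X2) (S1 ++ S2) (C1 ++ C2)
| ctx_id t rho X S C : ctx t rho X S C -> ctx (TId t) rho X S C
| ctx_om t rho : ctx (TOm t) rho [::] [::] [:: (t, rho)]
| ctx_out M rho : ctx (TOut M) rho [::] [:: (0, map (mren rho) [:: M])] [::]
| ctx_call q Ms rho : ctx (TCall q Ms) rho [::] [:: (q.+1, map (mren rho) Ms)] [::]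
| ctx_nu x t rho b X S C : ctx t (upd rho x b) X S C -> ctx (TNu x t) rho (b :: X) S C.

(** One copy of each outermost block, taken together. A [k]-fold unfolding is then a context with
    [k] interchangeable groups, so a single count governs all outermost replications. *)
Inductive group n : seq (tmpl * (nat -> nat)) -> seq nat -> seq atom -> Prop :=
| group_nil : group n [::] [::] [::]
| group_cons t rho C X1 S1 X2 S2 : flat (full n t) rho X1 S1 -> group n C X2 S2 ->
    group n ((t, rho) :: C) (X1 ++ X2) (S1 ++ S2).

Lemma group_cat n C1 C2 X1 S1 X2 S2 : group n C1 X1 S1 -> group n C2 X2 S2 ->
  group n (C1 ++ C2) (X1 ++ X2) (S1 ++ S2).
Proof.
by elim=> //= *; rewrite -!catA; constructor => //; auto.
Qed.

Lemma group_split n C1 C2 X S : group n (C1 ++ C2) X S -> exists X1 S1 X2 S2,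
  [/\ group n C1 X1 S1, group n C2 X2 S2, X = X1 ++ X2 & S = S1 ++ S2].
Proof.
elim: C1 X S => [|[t rho] C1 IHC] X S /= h.
  by exists [::], [::], X, S; split=> //; constructor.
inversion h as [|? ? ? Xa Sa Xb Sb fa gb]; subst.
have [X1 [S1 [X2 [S2 [g1 g2 -> ->]]]]] := IHC _ _ gb.
by exists (Xa ++ X1), (Sa ++ S1), X2, S2; split; rewrite ?catA //; constructor.
Qed.

Lemma ctx_names t rho X S C : ctx t rho X S C ->
  {subset snames S <= X ++ map rho (tfn t)} /\
  forall n Y Z, group n C Y Z -> {subset snames Z <= Y ++ (X ++ map rho (tfn t))}.
Proof.
elim=> {t rho X S C}.
- by move=> rho; split=> // n Y Z h; inversion h.
- move=> t1 t2 rho X1 S1 C1 X2 S2 C2 _ [IH1 IG1] _ [IH2 IG2]; split=> [a|n Y Z].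
    rewrite snames_cat !mem_cat map_cat mem_cat => /orP[/IH1|/IH2]; rewrite mem_cat;
    by case/orP=> ->; rewrite ?orbT.
  move=> /group_split[Y1 [Z1 [Y2 [Z2 [/IG1 g1 /IG2 g2 -> ->]]]]] a.
  rewrite snames_cat !mem_cat map_cat mem_cat => /orP[/g1|/g2]; rewrite !mem_cat;
  by case/or3P=> ->; rewrite ?orbT.
- by move=> t rho X S C _ [IH IG].
- move=> t rho; split=> // n Y Z h.
  inversion h as [|? ? ? Xa Sa Xb Sb fa gb]; subst; inversion gb; subst.
  rewrite !cats0 /= => a /(flat_names fa); rewrite !mem_cat => /orP[->//|/mapP[b]].
  by move=> /tfn_full bt ->; rewrite map_f ?orbT.
- move=> M rho; split=> [a|n Y Z h]; last by inversion h.
  by rewrite /snames /= cats0 -[[:: mren rho M]]/(map (mren rho) [:: M]) names_ren.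
- move=> q Ms rho; split=> [a|n Y Z h]; last by inversion h.
  by rewrite /snames /= cats0 names_ren.
- move=> x t rho b X S C _ [IH IG].
  have sub a : a \in map (upd rho x b) (tfn t) ->
      a \in b :: map rho [seq a <- tfn t | a != x].
    case/mapP=> c cin ->; rewrite /upd inE; case: (c =P x) => [_|/eqP cx].
      by rewrite eqxx.
    by rewrite map_f ?orbT // mem_filter cx.
  split=> [a /IH|n Y Z /IG h a /h]; rewrite /= !(mem_cat, inE).
    by case/orP=> [->|/sub]; rewrite ?orbT // inE => /orP[]->; rewrite ?orbT.
  by case/or3P=> [->|->|/sub]; rewrite ?orbT // inE => /orP[]->; rewrite ?orbT.
Qed.

Lemma group_size n C Y Z Y' Z' : group n C Y Z -> group n C Y' Z' -> size Y = size Y'.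
Proof.
elim: C Y Y' Z Z' => [|[t r] C IHC] Y Y' Z Z' h h'; first by inversion h; inversion h'.
inversion h as [|? ? ? Xa Sa Xb Sb fa gb]; subst.
inversion h' as [|? ? ? Xa' Sa' Xb' Sb' fa' gb']; subst.
rewrite !size_cat (IHC _ _ _ _ gb gb').
have [-> _] := flat_omfree (omfree_full n t) fa.
by have [-> _] := flat_omfree (omfree_full n t) fa'.
Qed.

Lemma group_ren n t rho X S C Y Z Y' Z' theta : ctx t rho X S C ->
  group n C Y Z -> group n C Y' Z' -> map theta Y = Y' ->
  {in X ++ map rho (tfn t), theta =1 id} -> Z' = sren theta Z.
Proof.
move=> h; elim: h Y Z Y' Z' => {t rho X S C}.
- by move=> rho Y Z Y' Z' h h' _ _; inversion h; inversion h'.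
- move=> t1 t2 rho X1 S1 C1 X2 S2 C2 _ IH1 _ IH2 Y Z Y' Z'.
  move=> /group_split[Y1 [Z1 [Y2 [Z2 [g1 g2 -> ->]]]]].
  move=> /group_split[Y1' [Z1' [Y2' [Z2' [g1' g2' -> ->]]]]] eY fx.
  have sz : size (map theta Y1) = size Y1'.
    by rewrite size_map; apply: group_size g1 g1'.
  move/eqP: eY; rewrite map_cat eqseq_cat // => /andP[/eqP e1 /eqP e2].
  rewrite sren_cat; congr (_ ++ _); [apply: IH1 g1 g1' e1 _|apply: IH2 g2 g2' e2 _];
    by move=> a; rewrite mem_cat => /orP[] ain; apply: fx; rewrite map_cat !mem_cat ain ?orbT.
- by move=> t rho X S C _ IH.
- move=> t rho Y Z Y' Z' h h' + fx.
  inversion h as [|? ? ? Xa Sa Xb Sb fa gb]; subst; inversion gb; subst.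
  inversion h' as [|? ? ? Xa' Sa' Xb' Sb' fa' gb']; subst; inversion gb'; subst.
  rewrite !cats0 => eY; apply: flat_det_ren (omfree_full n t) fa fa' eY _.
  by move=> a /tfn_full at_; apply: fx; rewrite /= map_f.
- by move=> M rho Y Z Y' Z' h h' _ _; inversion h; inversion h'.
- by move=> q Ms rho Y Z Y' Z' h h' _ _; inversion h; inversion h'.
- move=> x t rho b X S C _ IH Y Z Y' Z' g g' eY fx; apply: IH g g' eY _ => a.
  rewrite mem_cat => /orP[aX|/mapP[c cin ->]]; first by apply: fx; rewrite inE mem_cat aX orbT.
  rewrite /upd; case: (c =P x) => [_|/eqP cx]; first by apply: fx; rewrite mem_head.
  by apply: fx; rewrite inE mem_cat map_f ?orbT // mem_filter cx.
Qed.

(** At 0 the replications contribute nothing to [kbound], and what remains counts at least the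
    binders outside them. *)
Lemma ctx_size t rho X S C : ctx t rho X S C -> size X <= kbound t 0.
Proof.
by elim=> //= *; rewrite size_cat leq_add.
Qed.

Notation copy := (seq nat * seq atom)%type.
Definition cnames (gs : seq copy) := flatten [seq g.1 | g <- gs].
Definition catoms (gs : seq copy) := flatten [seq g.2 | g <- gs].

Definition gzip (gs gs' : seq copy) : seq copy :=
  [seq (p.1.1 ++ p.2.1, p.1.2 ++ p.2.2) | p <- zip gs gs'].

Lemma gzip_perm gs gs' : size gs = size gs' ->
  perm_eq (cnames (gzip gs gs')) (cnames gs ++ cnames gs') /\
  perm_eq (catoms (gzip gs gs')) (catoms gs ++ catoms gs').
Proof.
elim: gs gs' => [|[Y Z] gs IHg] [|[Y' Z'] gs'] //= [/IHg[p1 p2]].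
split; apply/permP => a; rewrite /cnames /catoms /gzip /= !count_cat.
  by have /permP/(_ a) := p1; rewrite /cnames /catoms /gzip count_cat => ->; rewrite addnACA.
by have /permP/(_ a) := p2; rewrite /cnames /catoms /gzip count_cat => ->; rewrite addnACA.
Qed.

Lemma full_copies n k t : full n (copies k t) = copies k (full n t).
Proof. by elim: k => //= k ->. Qed.

Lemma full_unf n t : full n (unf n t) = full n t.
Proof.
elim: t => //= [t1 -> t2 -> //|t -> //|t IHt|x t -> //].
exact: full_copies.
Qed.

Lemma flat_groups n k t rho X S : flat (full n (unf k t)) rho X S ->
  exists Xc Sc C (gs : seq copy), [/\ ctx t rho Xc Sc C, size gs = k,
    forall g, g \in gs -> group n C g.1 g.2,
    perm_eq X (Xc ++ cnames gs) & perm_eq S (Sc ++ catoms gs)].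
Proof.
have triv u rho' X' S' : ctx u rho' X' S' [::] -> exists Xc Sc C (gs : seq copy),
  [/\ ctx u rho' Xc Sc C, size gs = k, forall g, g \in gs -> group n C g.1 g.2,
    perm_eq X' (Xc ++ cnames gs) & perm_eq S' (Sc ++ catoms gs)].
  move=> c; exists X', S', [::], (nseq k ([::], [::])); split; rewrite ?size_nseq //.
  + by move=> g; rewrite mem_nseq => /andP[_ /eqP->]; constructor.
  + by rewrite /cnames; elim: (k) => /= [|? IH]; rewrite ?cats0.
  + by rewrite /catoms; elim: (k) => /= [|? IH]; rewrite ?cats0.
elim: t rho X S => /=.
- by move=> rho X S h; inversion h; subst; apply: triv; constructor.
- move=> t1 IH1 t2 IH2 rho X S h; inv_par h X1 S1 X2 S2 f1 f2.
  have [Xa [Sa [Ca [ga [ca sa ha pa qa]]]]] := IH1 _ _ _ f1.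
  have [Xb [Sb [Cb [gb [cb sb hb pb qb]]]]] := IH2 _ _ _ f2.
  have [|p1 p2] := @gzip_perm ga gb; first by rewrite sa sb.
  exists (Xa ++ Xb), (Sa ++ Sb), (Ca ++ Cb), (gzip ga gb); split.
  + by constructor.
  + by rewrite size_map size_zip sa sb minnn.
  + move=> g /mapP[[g1 g2] /= gz ->] /=; apply: group_cat.
      have : (g1, g2).1 \in unzip1 (zip ga gb) by apply: map_f.
      by rewrite unzip1_zip ?sa ?sb // => /ha.
    have : (g1, g2).2 \in unzip2 (zip ga gb) by apply: map_f.
    by rewrite unzip2_zip ?sa ?sb // => /hb.
  + by apply/permP => a; rewrite !count_cat (permP pa) (permP pb) (permP p1) !count_cat; lia.
  + by apply/permP => a; rewrite !count_cat (permP qa) (permP qb) (permP p2) !count_cat; lia.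
- move=> t IHt rho X S h; inversion h; subst.
  have [|Xa [Sa [Ca [ga [ca sa ha pa qa]]]]] := IHt rho X S; first by [].
  by exists Xa, Sa, Ca, ga; split=> //; constructor.
- move=> t _ rho X S; rewrite full_copies => h.
  exists [::], [::], [:: (t, rho)].
  have [gs [sg hg eX eS]] : exists gs : seq copy, [/\ size gs = k,
      forall g, g \in gs -> flat (full n t) rho g.1 g.2, X = cnames gs & S = catoms gs].
    elim: (k) X S h => [|j IHj] X S /= h.
      by exists [::]; inversion h.
    inv_par h X1 S1 X2 S2 f1 f2.
    have [gs [sg hg eX eS]] := IHj _ _ f2; exists ((X1, S1) :: gs).
    split; rewrite /= ?sg ?eX ?eS // => g; rewrite inE => /predU1P[->//|/hg //].
  exists gs; split=> //; rewrite -?eX -?eS //; first by constructor.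
  move=> g /hg f; rewrite -[g.1]cats0 -[g.2]cats0; do 2?constructor=> //.
- by move=> M rho X S h; inversion h; subst; apply: triv; apply: ctx_out.
- by move=> q Ms rho X S h; inversion h; subst; apply: triv; constructor.
- move=> x t IHt rho X S h; inv_nu h b X1 f1.
  have [Xa [Sa [Ca [ga [ca sa ha pa qa]]]]] := IHt _ _ _ f1.
  by exists (b :: Xa), Sa, Ca, ga; split; rewrite ?perm_cons //; constructor.
Qed.

(** Reassembles any list of groups, so that after the removal of a group the rest is an instance of
    a smaller unfolding. *)
Lemma groups_flat n t rho Xc Sc C (gs : seq copy) : ctx t rho Xc Sc C ->
  (forall g, g \in gs -> group n C g.1 g.2) ->
  exists X S, [/\ flat (full n (unf (size gs) t)) rho X S,
    perm_eq X (Xc ++ cnames gs) & perm_eq S (Sc ++ catoms gs)].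
Proof.
have nilg (gs' : seq copy) : (forall g, g \in gs' -> group n [::] g.1 g.2) ->
    cnames gs' = [::] /\ catoms gs' = [::].
  elim: gs' => //= g gs' IHg hg.
  have [|] := IHg; first by move=> g' g'in; apply: hg; rewrite inE g'in orbT.
  have : group n [::] g.1 g.2 by apply: hg; rewrite mem_head.
  case: g {hg} => Y Z /= h; inversion h; subst.
  by rewrite /cnames /catoms => /= -> ->.
move=> h; elim: h gs => {t rho Xc Sc C} /=.
- move=> rho gs /nilg[-> ->]; exists [::], [::]; split=> //; constructor.
- move=> t1 t2 rho X1 S1 C1 X2 S2 C2 _ IH1 _ IH2 gs hg.
  have [ga [gb [sa sb ha hb [ep eq]]]] : exists ga gb : seq copy,
    [/\ size ga = size gs, size gb = size gs,
        forall g, g \in ga -> group n C1 g.1 g.2,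
        forall g, g \in gb -> group n C2 g.1 g.2 &
        perm_eq (cnames gs) (cnames ga ++ cnames gb) /\
        perm_eq (catoms gs) (catoms ga ++ catoms gb)].
    elim: gs hg => [|[Y Z] gs IHg] hg; first by exists [::], [::].
    have [|ga [gb [sa sb ha hb [ep eq]]]] := IHg.
      by move=> g gin; apply: hg; rewrite inE gin orbT.
    have /group_split[Y1 [Z1 [Y2 [Z2 [g1 g2 eY eZ]]]]] := hg _ (mem_head _ _).
    move: eY eZ => /= -> ->; exists ((Y1, Z1) :: ga), ((Y2, Z2) :: gb).
    split; rewrite /= ?sa ?sb //.
    + by move=> g; rewrite inE => /predU1P[->|/ha].
    + by move=> g; rewrite inE => /predU1P[->|/hb].
    split; apply/permP => a; rewrite /cnames /catoms /= !count_cat.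
      by have /permP/(_ a) := ep; rewrite /cnames count_cat => ->; rewrite addnACA.
    by have /permP/(_ a) := eq; rewrite /catoms count_cat => ->; rewrite addnACA.
  have [Xa [Sa [fa pa qa]]] := IH1 _ ha; have [Xb [Sb [fb pb qb]]] := IH2 _ hb.
  exists (Xa ++ Xb), (Sa ++ Sb); split; first by constructor; rewrite -?sa // sa -sb.
  + by apply/permP => a; rewrite !count_cat (permP pa) (permP pb) (permP ep) !count_cat; lia.
  + by apply/permP => a; rewrite !count_cat (permP qa) (permP qb) (permP eq) !count_cat; lia.
- move=> t rho X S C _ IH gs /IH[Xa [Sa [fa pa qa]]].
  by exists Xa, Sa; split=> //; constructor.
- move=> t rho gs hg; exists (cnames gs), (catoms gs); split=> //.
  rewrite full_copies; elim: gs hg => [|[Y Z] gs IHg] hg /=; first by constructor.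
  have := hg _ (mem_head _ _) => /= h.
  inversion h as [|? ? ? Xa Sa Xb Sb fa gb]; subst; inversion gb; subst.
  rewrite !cats0; constructor=> //; apply: IHg => g gin.
  by apply: hg; rewrite inE gin orbT.
- move=> M rho gs /nilg[-> ->]; exists [::], [:: (0, map (mren rho) [:: M])]; split=> //.
  exact: flat_out.
- move=> q Ms rho gs /nilg[-> ->]; exists [::], [:: (q.+1, map (mren rho) Ms)]; split=> //.
  exact: flat_call.
- move=> x t rho b X S C _ IH gs /IH[Xa [Sa [fa pa qa]]].
  by exists (b :: Xa), Sa; split; rewrite ?perm_cons //; constructor.
Qed.
End Pump.

(** * Embeddings and pumping *)

Section Covered.
Variables (nc : nat) (ar : nat -> nat).
Notation msg := (Defs.msg nc ar).
Notation atom := (nat * seq msg)%type.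
Notation copy := (seq nat * seq atom)%type.
Notation tmpl := (tmpl nc ar).
Implicit Types (S : seq atom) (X A B : seq nat) (rho theta sigma : nat -> nat) (t u : tmpl).
Variable der : seq msg -> msg -> Prop.
Hypothesis model : intruder_model der.

Definition below S S' :=
  (forall M, M \in souts S -> der (souts S') M) /\ msub (scalls S) (scalls S').

Lemma below_trans S2 S1 S3 : below S1 S2 -> below S2 S3 -> below S1 S3.
Proof.
move=> [d1 m1] [d2 m2]; split; last exact: msub_trans m1 m2.
by move=> M /d1; apply: der_trans.
Qed.

Lemma below_ren theta S S' : injective theta ->
  below S S' -> below (sren theta S) (sren theta S').
Proof.
move=> inj [d m]; split; last by rewrite !scalls_sren; apply: msub_map.
rewrite !souts_sren => _ /mapP[M /d dM ->]; exact: der_ren.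
Qed.

Lemma below_catl S S' : below S (S ++ S').
Proof.
split; last by rewrite scalls_cat; apply: msub_catl.
by move=> M MS; apply: (der_id model); rewrite souts_cat mem_cat MS.
Qed.

Lemma below_perm S S' : perm_eq S S' -> below S S'.
Proof.
move=> pS; split; last by apply: msub_perm; apply: perm_scalls.
by move=> M; rewrite (perm_souts pS); apply: der_id.
Qed.

Definition emb A S S' := exists sigma,
  [/\ injective sigma, {in A, sigma =1 id} & below (sren sigma S) S'].

Lemma emb_below A S1 S2 S3 : below S1 S2 -> emb A S2 S3 -> emb A S1 S3.
Proof.
move=> b12 [sigma [inj fx b23]]; exists sigma; split=> //.
exact: below_trans (below_ren inj b12) b23.
Qed.

Lemma emb_ren A S S' pi : injective pi -> {in A, pi =1 id} ->
  emb A (sren pi S) S' -> emb A S S'.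
Proof.
move=> injp fxp [sigma [inj fx b]]; exists (sigma \o pi); split.
- exact: inj_comp.
- by move=> a aA /=; rewrite fxp ?fx.
- by rewrite -sren_comp.
Qed.

Lemma emb_in A S S' (s : seq nat) sigma : {subset A <= s} -> {subset snames S <= s} ->
  {in s &, injective sigma} -> {in A, sigma =1 id} -> below (sren sigma S) S' ->
  emb A S S'.
Proof.
move=> As Ss inj fx b; exists (inj_ext s sigma); split; first exact: inj_ext_inj.
  by move=> a aA; rewrite inj_extE ?fx // As.
by rewrite (@sren_ext _ _ _ sigma) // => a /Ss; apply: inj_extE.
Qed.

(* The free names of an instance of t are treated as constants; all the other
   names, including the free names of the process S that the instance does not
   use, may be identified with bound names of the instance. *)
Definition covered t S := exists A,
  [/\ {subset A <= tfn t}, prunable A t & exists X2 S2,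
    [/\ flat (prune A t) id X2 S2, uniq X2, forall x, x \in X2 -> x \notin tfn t
      & emb A S S2]].

Lemma covered_below t S S' : below S S' -> covered t S' -> covered t S.
Proof.
move=> b [A [sA pA [X2 [S2 [f u d e]]]]]; exists A; split=> //.
by exists X2, S2; split=> //; apply: emb_below e.
Qed.

(** Different groups have disjoint names, so each group that meets [V] uses up an element of [V] of
    its own. *)
Lemma size_touching (V : seq nat) (f : nat -> nat) (gs : seq copy) :
  uniq (map f (cnames gs)) ->
  size [seq g <- gs | has (fun a => f a \in V) g.1] <= size V.
Proof.
elim: gs V => //= g gs IHg V; rewrite /cnames /= map_cat cat_uniq => /and3P[_ /hasPn dis ug].
case: ifP => [/hasP[a ag faV]|_]; last exact: IHg.
have szV : 0 < size V by case: (V) faV.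
rewrite /= -(prednK szV) ltnS -(size_rem faV).
rewrite (eq_in_filter (a2 := fun g' : copy => has (fun b => f b \in rem (f a) V) g'.1)).
  exact: IHg.
move=> g' g'in; apply: eq_in_has => b bg.
have neq : f b != f a.
  apply/negP => /eqP e.
  have fb : f b \in map f (flatten [seq g.1 | g <- gs]).
    by apply: map_f; apply/flatten_mapP; exists g'.
  by have := dis _ fb; rewrite /= e map_f.
have /permP/(_ (pred1 (f b))) := perm_to_rem faV.
by rewrite -!has_pred1 !has_count /= eq_sym (negbTE neq) add0n => ->.
Qed.

Lemma size_filter_norm (I : Type) (P Q : pred I) (s : seq I) :
  size s <= size (filter P s) + size (filter Q s)
            + size (filter (fun g => ~~ P g && ~~ Q g) s).
Proof.
rewrite !size_filter; elim: s => //= g s IHs.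
by case: (P g); case: (Q g) => /=; lia.
Qed.

(** A part that does not fit into [Q] takes an element of [R]; with more parts than elements of [R],
    some part takes none. *)
Lemma msub_pigeonhole (I T : eqType) (f : I -> seq T) (gs : seq I) (R Q : seq T) :
  msub (flatten (map f gs)) (R ++ Q) -> size R < size gs ->
  exists2 g, g \in gs & msub (f g) Q.
Proof.
elim: gs R Q => //= g gs IHg R Q h lt.
have /msub_split[r [q [p mr mq]]] : msub (f g) (R ++ Q).
  by apply: msub_trans h; apply: msub_catl.
case: r p mr => [|x r] p mr.
  by exists g; [rewrite mem_head | apply: msub_trans (msub_perm p) mq].
have [R' pR] := msubP mr; have [Q' pQ] := msubP mq.
have [||g' g'in mg'] := IHg R' Q'.
- move=> y; have := h y; rewrite !count_cat (permP p) (permP pR) (permP pQ) !count_cat; lia.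
- by move: lt; rewrite (perm_size pR) /= size_cat; lia.
exists g'; first by rewrite inE g'in orbT.
apply: msub_trans mg' _; apply: msub_trans (msub_perm (_ : perm_eq _ _)).
  exact: msub_catr q Q'.
by rewrite perm_sym.
Qed.

Lemma scalls_catoms (gs : seq copy) :
  scalls (catoms gs) = flatten [seq scalls g.2 | g <- gs].
Proof. by rewrite /catoms; elim: gs => //= g gs IHg; rewrite scalls_cat IHg. Qed.

(** A group [g0] is removed, the rest is embedded by induction, and [g0] is sent to a duplicate of
    the image of another group [g]. Binders may carry names of [tfn t2], which the embedding may
    have to fix, so [g0] and [g] must avoid these: hence the summand [size (tfn t2)]. The summand
    [kbound] covers the groups that reach the fixed part of the instance through a name or a call;
    its argument bounds the number of names shared between groups and context. *)
Lemma pump_step n k t1 t2 B : {subset tfn t1 <= B} ->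
  kbound t2 (kbound t1 0 + size B) + size (tfn t2) < k ->
  (forall X S, flat (full n (unf k t1)) id X S -> uniq X ->
     (forall x, x \in X -> x \notin B) -> covered t2 S) ->
  forall X S, flat (full n (unf k.+1 t1)) id X S -> uniq X ->
    (forall x, x \in X -> x \notin B) -> covered t2 S.
Proof.
move=> tB ltk hk X S /flat_groups[Xc [Sc [C [gs [cC szg hg pX pS]]]]] uX dX.
set W := tfn t2 in ltk.
move: (uX); rewrite (perm_uniq pX) => uXc.
have {uX}dX x : x \in Xc ++ cnames gs -> x \notin B.
  by rewrite -(perm_mem pX); apply: dX.
have [g0 g0in g0W] : exists2 g : copy, g \in gs & ~~ has (mem W) g.1.
  have := @size_touching W id gs; rewrite map_id.
  move: (uXc); rewrite cat_uniq => /and3P[_ _ ->] /(_ isT) le.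
  apply/hasP; rewrite -[has _ _]negbK -all_predC; apply/negP => /all_filterP e.
  have : size gs <= size W.
    by rewrite -e (leq_trans _ le) // eq_leq //; congr size; apply: eq_filter => g /=; rewrite negbK.
  by rewrite szg; clear -ltk; lia.
have pg := perm_to_rem g0in; set gs' := rem g0 gs in pg.
have pcn : perm_eq (cnames gs) (g0.1 ++ cnames gs').
  exact: perm_flatten (perm_map (fun g : copy => g.1) pg).
have pca : perm_eq (catoms gs) (g0.2 ++ catoms gs').
  exact: perm_flatten (perm_map (fun g : copy => g.2) pg).
have hg0 : group n C g0.1 g0.2 by apply: hg.
have {}hg g : g \in gs' -> group n C g.1 g.2 by move=> /mem_rem/hg.
have szg' : size gs' = k by rewrite size_rem // szg.
have [X' [S' [f' pX' pS']]] := groups_flat cC hg; rewrite szg' in f'.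
have uall : uniq (Xc ++ g0.1 ++ cnames gs').
  rewrite (perm_uniq (_ : perm_eq _ (Xc ++ cnames gs))) //.
  by rewrite perm_cat2l perm_sym.
have {}dX x : x \in Xc ++ g0.1 ++ cnames gs' -> x \notin B.
  move=> xin; apply: dX; move: xin; rewrite !mem_cat => /or3P[|xg|xg].
  - by move->.
  - by rewrite (perm_mem pcn) mem_cat xg orbT.
  - by rewrite (perm_mem pcn) mem_cat xg !orbT.
have [uc ug0 ug' [dc0 dc' d0']] : [/\ uniq Xc, uniq g0.1, uniq (cnames gs') &
  [/\ forall x, x \in Xc -> x \notin g0.1, forall x, x \in Xc -> x \notin cnames gs' &
      forall x, x \in g0.1 -> x \notin cnames gs']].
  move: uall; rewrite !cat_uniq has_cat => /and5P[-> /norP[/hasPn h1 /hasPn h2] -> /hasPn h3 ->].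
  split=> //; split=> x xin; apply/negP.
  - by move/h1/negP; apply.
  - by move/h2/negP; apply.
  - by move/h3/negP; apply.
have [|x|A [sA pA [X2 [S2 [f2 u2 d2 [sigma [inj fx b]]]]]]] := hk X' S' f'.
- rewrite (perm_uniq pX') cat_uniq uc ug' andbT; apply/hasPn => x xg.
  by apply/negP => /dc'; rewrite xg.
- by rewrite (perm_mem pX') mem_cat => xin; apply: dX; rewrite !mem_cat; case/orP: xin => ->; rewrite ?orbT.
have {}b : below (sren sigma (Sc ++ catoms gs')) S2.
  by apply: below_trans b; apply: below_ren => //; apply: below_perm; rewrite perm_sym.
(* A group shares with its surroundings only binders of the context and free names of [t1]; their
   images must stay in place when the image of a group is duplicated. *)
pose T := map sigma (Xc ++ B).
have [Xa [Xb [Sa [Sb [pX2 pS2 sz [hT nm hth]]]]]] := flat_dup f2 T.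
have szT : count (mem T) X2 <= kbound t1 0 + size B.
  apply: (@leq_trans (size T)).
    rewrite -size_filter; apply: uniq_leq_size; first exact: filter_uniq.
    by move=> x; rewrite mem_filter => /andP[].
  by rewrite size_map size_cat leq_add2r (ctx_size cC).
have {}sz : size Xa + size (scalls Sa) <= kbound t2 (kbound t1 0 + size B).
  by apply: leq_trans sz (leq_trans (kbound_prune _ _ _) (kbound_mono _ szT)).
(* Groups meeting [W], groups meeting [Xa] and groups with a call in [Sa] together number fewer than
   [k]. *)
have [g gin [gW gXa mg]] : exists2 g : copy, g \in gs' &
    [/\ ~~ has (mem W) g.1, ~~ has (fun a => sigma a \in Xa) g.1 &
        msub (sren sigma (scalls g.2)) (scalls Sb)].
  pose P1 (g : copy) := has (mem W) g.1; pose P2 (g : copy) := has (fun a => sigma a \in Xa) g.1.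
  have l1 : size (filter P1 gs') <= size W.
    by have := @size_touching W id gs'; rewrite map_id ug'; apply.
  have l2 : size (filter P2 gs') <= size Xa.
    by apply: (@size_touching Xa sigma gs'); rewrite map_inj_uniq.
  pose P3 (g : copy) := ~~ P1 g && ~~ P2 g.
  have l3 : size gs' <= size (filter P1 gs') + size (filter P2 gs') + size (filter P3 gs').
    exact: size_filter_norm.
  have [||g] := @msub_pigeonhole _ _ (fun g : copy => sren sigma (scalls g.2))
     (filter P3 gs') (scalls Sa) (scalls Sb).
  - have [_] := b; rewrite sren_cat scalls_cat => mb.
    have {}mb : msub (scalls (sren sigma (catoms gs'))) (scalls Sa ++ scalls Sb).
      apply: msub_trans (msub_catr _ _) (msub_trans mb _).
      by rewrite -scalls_cat; apply: msub_perm; apply: perm_scalls.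
    apply: msub_trans mb; rewrite scalls_sren scalls_catoms /sren map_flatten -map_comp.
    elim: (gs') => //= g gl IH; case: (P3 g) => /=.
      by apply: msub_cat; [apply: msub_refl|apply: IH].
    by apply: msub_trans IH (msub_catr _ _).
  - have ar3 (w xa q K j s1 s2 s3 : nat) : s1 <= w -> s2 <= xa -> j <= s1 + s2 + s3 ->
      xa + q <= K -> K + w < j -> q < s3 by clear; lia.
    by apply: ar3 l1 l2 _ sz ltk; rewrite -szg'.
  by rewrite mem_filter => /andP[/andP[p1 p2] gin] mg; exists g.
have hgg := hg g gin.
have gcn : {subset g.1 <= cnames gs'} by move=> x xg; apply/flatten_mapP; exists g.
have ug : uniq g.1.
  move: ug'; rewrite /cnames; elim: (gs') gin => //= g' gl IH; rewrite inE cat_uniq.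
  by case/predU1P=> [->|/IH h] /and3P[].
have szgg : size g0.1 = size g.1 by apply: group_size hg0 hgg.
pose Fx := Xa ++ A ++ T.
pose Nm := Xc ++ B ++ A ++ cnames gs' ++ g0.1.
pose big := ubound (Fx ++ X2 ++ W ++ map sigma Nm).
have ltbig x : x \in Fx ++ X2 ++ W ++ map sigma Nm -> x < big by apply: ltn_ubound.
(* The duplicate lives beyond all names in sight, apart from the fixed ones. *)
pose theta a := if a \in Fx then a else a + big.
have thetaFx : {in Fx, theta =1 id} by move=> a aF; rewrite /theta aF.
have injth : injective theta.
  move=> x y; rewrite /theta; case: ifPn => xF; case: ifPn => yF //.
  - by move=> e; have := ltbig x; rewrite mem_cat xF e => /(_ isT); rewrite ltnNge leq_addl.
  - by move=> e; have := ltbig y; rewrite mem_cat yF -e => /(_ isT); rewrite ltnNge leq_addl.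
  - by move/addIn.
have tA a : a \in tfn (prune A t2) -> a \in A by apply: tfn_prune.
have [||Y [Z [fY pY pZ]]] := hth theta.
- by move=> a aXa; apply: thetaFx; rewrite mem_cat aXa.
- by move=> a /tA aA; apply: thetaFx; rewrite !mem_cat aA orbT.
have XbFx x : x \in Xb -> x \notin Fx.
  move=> xb; have xX2 : x \in X2 by rewrite (perm_mem pX2) mem_cat xb orbT.
  move: (u2); rewrite (perm_uniq pX2) cat_uniq => /and3P[_ /hasPn/(_ _ xb)/= xa _].
  rewrite !mem_cat !negb_or xa /=; apply/andP; split.
    by apply/negP => /sA; apply/negP; apply: d2.
  by apply/negP => xT; rewrite (hT x xX2 xT) in xa.
have fxXcB a : a \in Xc ++ B -> theta (sigma a) = sigma a.
  by move=> aX; apply: thetaFx; rewrite !mem_cat map_f ?orbT.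
pose phi := nsubst g0.1 g.1.
(* On [g0]: over to [g], along the old embedding, and on to the duplicate. *)
pose sigma' a := if a \in g0.1 then theta (sigma (phi a)) else sigma a.
have phi_in a : a \in g0.1 -> phi a \in g.1.
  by move=> a0; rewrite /phi /nsubst a0 mem_nth // -szgg index_mem.
have gFx a : a \in g.1 -> sigma a \notin Fx.
  move=> ag; rewrite !mem_cat !negb_or; apply/and3P; split.
  - by apply: (hasPn gXa).
  - apply/negP => sa; have /inj ea := fx _ sa.
    by have /negP[] := hasPn gW a ag; rewrite -ea; apply: sA.
  - rewrite mem_map // mem_cat negb_or; apply/andP; split.
      by apply/negP => /dc'; rewrite gcn.
    by apply: dX; rewrite !mem_cat (gcn a ag) !orbT.
have sig0 a : a \in g0.1 -> sigma' a = sigma (phi a) + big.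
  by move=> a0; rewrite /sigma' a0 /theta (negbTE (gFx _ (phi_in a a0))).
have A0 a : a \in A -> a \notin g0.1.
  by move=> aA; apply/negP => a0; have /negP[] := hasPn g0W a a0; apply: sA.
have injphi : {in g0.1 &, injective phi}.
  move=> x y x0 y0; rewrite /phi /nsubst x0 y0 => /eqP.
  rewrite (set_nth_default y) ?nth_uniq -?szgg ?index_mem // => /eqP e.
  by rewrite -(nth_index 0 x0) e nth_index.
exists A; split=> //; exists Y, Z; split=> //.
- rewrite (perm_uniq pY) cat_uniq u2 map_inj_uniq //=.
  move: (u2); rewrite (perm_uniq pX2) cat_uniq => /and3P[_ _ ->]; rewrite andbT.
  apply/hasPn => _ /mapP[x xb ->]; rewrite /theta (negbTE (XbFx x xb)) /=.
  by apply/negP => h; have := ltbig (x + big); rewrite !mem_cat h !orbT => /(_ isT); rewrite ltnNge leq_addl.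
- move=> x; rewrite (perm_mem pY) mem_cat => /orP[/d2 //|/mapP[y yb ->]].
  rewrite /theta (negbTE (XbFx y yb)).
  by apply/negP => h; have := ltbig (y + big); rewrite !mem_cat h !orbT => /(_ isT); rewrite ltnNge leq_addl.
have [nSc nG] := ctx_names cC; rewrite map_id in nSc nG.
have XcB x : x \in Xc ++ tfn t1 -> x \in Xc ++ B.
  by rewrite !mem_cat => /orP[->//|/tB->]; rewrite orbT.
have ncat : {subset snames (catoms gs') <= cnames gs' ++ Xc ++ B}.
  move=> x /snamesP[a /flatten_mapP[h hin ah] xa].
  have : x \in snames h.2 by apply/snamesP; exists a.
  move/(nG _ _ _ (hg h hin)); rewrite mem_cat => /orP[xh|/XcB xc].
    by rewrite mem_cat; apply/orP; left; apply/flatten_mapP; exists h.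
  by rewrite mem_cat xc orbT.
have n0 : {subset snames g0.2 <= g0.1 ++ Xc ++ B}.
  by move=> x /(nG _ _ _ hg0); rewrite mem_cat [in X in _ -> X]mem_cat => /orP[->//|/XcB->]; rewrite orbT.
have XcB0 x : x \in Xc ++ B -> x \notin g0.1.
  rewrite mem_cat => /orP[/dc0 //|xB]; apply/negP => x0.
  by have /negP[] : x \notin B by apply: dX; rewrite !mem_cat x0 orbT.
have pSS : perm_eq S ((Sc ++ catoms gs') ++ g0.2).
  apply: perm_trans pS _; rewrite -catA perm_cat2l; apply: perm_trans pca _.
  by rewrite perm_catC.
apply: (@emb_in A S Z Nm sigma').
- by move=> a aA; rewrite !mem_cat aA !orbT.
- move=> x; rewrite (perm_snames pSS) !snames_cat !mem_cat -orbA.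
  case/or3P=> [/nSc/XcB|/ncat|/n0]; rewrite !mem_cat.
  + by case/orP=> ->; rewrite ?orbT.
  + by case/or3P=> ->; rewrite ?orbT.
  + by case/or3P=> ->; rewrite ?orbT.
- move=> x y xN yN; have [x0|x0] := boolP (x \in g0.1); have [y0|y0] := boolP (y \in g0.1).
  + by rewrite !sig0 // => /addIn/inj/injphi->.
  + rewrite (sig0 x x0) /sigma' (negbTE y0) => e; have := ltbig (sigma y).
    by rewrite !mem_cat (map_f sigma yN) !orbT => /(_ isT); rewrite -e ltnNge leq_addl.
  + rewrite (sig0 y y0) /sigma' (negbTE x0) => e; have := ltbig (sigma x).
    by rewrite !mem_cat (map_f sigma xN) !orbT => /(_ isT); rewrite e ltnNge leq_addl.
  + by rewrite /sigma' (negbTE x0) (negbTE y0) => /inj.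
- by move=> a aA; rewrite /sigma' (negbTE (A0 a aA)) fx.
have e1 : sren sigma' (Sc ++ catoms gs') = sren sigma (Sc ++ catoms gs').
  apply: sren_ext => x; rewrite snames_cat mem_cat /sigma' => h.
  suff /negbTE->: x \notin g0.1 by [].
  case/orP: h => [/nSc/XcB/XcB0 //|/ncat]; rewrite mem_cat => /orP[xc|/XcB0 //].
  by apply/negP => /d0'; rewrite xc.
have e2 : sren sigma' g0.2 = sren theta (sren sigma g.2).
  have -> : g.2 = sren phi g0.2.
    apply: (group_ren cC hg0 hgg); first exact: map_nsubst.
    by rewrite map_id => x /XcB/XcB0; apply: nsubst_id.
  rewrite !sren_comp; apply: sren_ext => x /n0; rewrite mem_cat /sigma' /=.
  case/orP=> [->//|xc]; rewrite (negbTE (XcB0 x xc)) /phi nsubst_id ?fxXcB //.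
  exact: XcB0.
have gS : {subset g.2 <= catoms gs'} by move=> a ag; apply/flatten_mapP; exists g.
have S2Z : below S2 Z.
  by apply: below_trans (below_catl _ _) (below_perm _); rewrite perm_sym; apply: pZ.
apply: (@below_trans (sren sigma' ((Sc ++ catoms gs') ++ g0.2))).
  by apply: below_perm; apply: perm_map.
rewrite sren_cat e1 e2; split.
  move=> M; rewrite souts_cat mem_cat => /orP[MS|].
    by have [d _] := below_trans b S2Z; apply: d.
  rewrite souts_sren => /mapP[N Ng ->].
  have dN : der (souts S2) N.
    have [d _] := b; apply: d; rewrite sren_cat souts_cat mem_cat; apply/orP; right.
    move: Ng; rewrite !souts_sren => /mapP[N' /flatten_mapP[a]].
    rewrite mem_filter => /andP[a0 ag] Na ->; apply: map_f; apply/flatten_mapP.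
    by exists a => //; rewrite mem_filter a0 gS.
  (* Applied to the derivation for [g], [theta] leaves the fixed outputs unchanged and turns the
     other ones into outputs of the duplicate, so all premises occur in [Z]. *)
  apply: (der_mono model) (der_ren model injth dN).
  move=> _ /mapP[N' N'S ->]; rewrite (perm_souts pZ) souts_cat mem_cat.
  move: (N'S); rewrite (perm_souts pS2) souts_cat mem_cat => /orP[Na|Nb].
    suff -> : mren theta N' = N' by rewrite N'S.
    rewrite -[RHS]mren_id; apply: mren_ext => x xN.
    have : x \in snames Sa.
      by apply: names_souts; apply/namesP; exists N'.
    by move/nm; rewrite map_id mem_cat => xin; apply: thetaFx; case/orP: xin => [|/tA] h;
       rewrite !mem_cat h ?orbT.
  by apply/orP; right; rewrite souts_sren map_f.
rewrite scalls_cat; apply: msub_trans (msub_perm (perm_scalls _)); last by rewrite perm_sym; apply: pZ.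
rewrite scalls_cat; apply: msub_cat; first by case: b.
rewrite !scalls_sren; apply: msub_map; rewrite -/(sren _ _).
exact: mg.
Qed.

(** The least number of groups from which [pump_step] applies. *)
Definition nunf t1 t2 (b : nat) := (kbound t2 (kbound t1 0 + b) + size (tfn t2)).+1.

(** For fixed [n], induction on the number of groups carries the hypothesis from [N] groups to all
    larger numbers. An arbitrary instance is contained in a uniform one with [n] equal to the number
    of groups, where [full_unf] identifies the two unfoldings. *)
Lemma pump t1 t2 B : {subset tfn t1 <= B} ->
  (forall X S, flat (unf (nunf t1 t2 (size B)) t1) id X S -> uniq X ->
     (forall x, x \in X -> x \notin B) -> covered t2 S) ->
  forall X S, flat t1 id X S -> uniq X -> (forall x, x \in X -> x \notin B) -> covered t2 S.
Proof.
move=> tB h0; set N := nunf _ _ _ in h0.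
have hall n k : N <= k -> forall X S, flat (full n (unf k t1)) id X S -> uniq X ->
    (forall x, x \in X -> x \notin B) -> covered t2 S.
  elim: k => [//|k IHk]; rewrite leq_eqVlt => /predU1P[<-|ltk].
    by move=> X S /flat_full; apply: h0.
  exact: pump_step tB ltk (IHk ltk).
move=> X S f uX dX; have [n0 g] := flat_grow f.
have [|X' [S' [Y [Z [fY pY pZ uX' dX']]]]] := g (n0 + N) _ (B ++ X); first exact: leq_addr.
apply: (@covered_below _ _ Z).
  by apply: below_trans (below_catl _ _) (below_perm _); rewrite perm_sym; apply: pZ.
apply: (hall (n0 + N) (n0 + N)); first exact: leq_addl.
- by rewrite full_unf; apply: fY.
- rewrite (perm_uniq pY) cat_uniq uX uX' andbT; apply/hasPn => x /dX'.
  by rewrite mem_cat negb_or => /andP[].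
- move=> x; rewrite (perm_mem pY) mem_cat => /orP[/dX //|/dX'].
  by rewrite mem_cat negb_or => /andP[].
Qed.
End Covered.

(** * Structural congruence and standard forms *)

Section Processes.
Variables (nc : nat) (ar : nat -> nat) (nq : nat).
Notation msg := (Defs.msg nc ar).
Notation atom := (nat * seq msg)%type.
Notation tmpl := (tmpl nc ar).
Notation proc := (proc nc ar nq).
Implicit Types (S : seq atom) (X Av : seq nat) (rho : nat -> nat) (t u : tmpl) (P Q R : proc).

Fixpoint tproc P : tmpl :=
  match P with
  | P0 => T0 _ _
  | PNu x P => TNu x (tproc P)
  | PPar P Q => TPar (tproc P) (tproc Q)
  | POut M => TOut M
  | PCall q Ms => TCall q Ms
  end.

Lemma tfn_tproc P : tfn (tproc P) =i fn P.
Proof.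
elim: P => //= [x P IH|P IHP Q IHQ|M] a.
- by rewrite !mem_filter IH.
- by rewrite !mem_cat IHP IHQ.
- by rewrite /names /= cats0.
Qed.

Lemma omfree_tproc P : omfree (tproc P).
Proof. by elim: P => //= P -> Q ->. Qed.

Lemma flat_free t rho X S a :
  flat t rho X S -> omfree t -> a \in tfn t -> rho a \in snames S.
Proof.
move=> h; elim: h => {t rho X S} //=.
- move=> t1 t2 rho X1 S1 X2 S2 _ IH1 _ IH2 /andP[o1 o2].
  by rewrite snames_cat !mem_cat => /orP[/(IH1 o1)|/(IH2 o2)] ->; rewrite ?orbT.
- move=> M rho _ ain.
  by rewrite /snames /= cats0 -[[:: mren rho M]]/(map (mren rho) [:: M]) names_ren map_f.
- by move=> q Ms rho _ ain; rewrite /snames /= cats0 names_ren map_f.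
- move=> x t rho b X S _ IH of_t; rewrite mem_filter => /andP[ax /(IH of_t)].
  by rewrite /upd (negbTE ax).
Qed.

Lemma nswapK x y : involutive (nswap x y).
Proof.
move=> a; rewrite /nswap; case: (a =P x) => [->|ax].
  by rewrite eqxx; case: eqP.
case: (a =P y) => [->|ay]; first by rewrite eqxx.
by do 2!case: eqP => //.
Qed.

Lemma pswapK x y P : pswap x y (pswap x y P) = P.
Proof.
have mK : cancel (mren (nswap x y)) (mren (nswap x y) : msg -> msg).
  move=> M; rewrite mren_comp -[RHS]mren_id; apply: mren_ext => a _ /=.
  exact: nswapK.
elim: P => //= [z P ->|P -> Q ->|M|q Ms] //; first by rewrite nswapK.
  by rewrite mK.
by rewrite -map_comp map_id_in // => M _ /=; apply: mK.
Qed.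

Lemma fn_pswap x y P : fn (pswap x y P) = map (nswap x y) (fn P).
Proof.
elim: P => //= [z P ->|P -> Q ->|M|q Ms].
- rewrite filter_map; congr map; apply: eq_filter => a /=.
  by rewrite (inj_eq (can_inj (nswapK x y))).
- by rewrite map_cat.
- exact: mnames_mren.
- exact: names_ren.
Qed.

Lemma flat_pswap x y P rho rho' X S : flat (tproc P) rho' X S ->
  (forall a, rho' a = rho (nswap x y a)) -> flat (tproc (pswap x y P)) rho X S.
Proof.
elim: P rho rho' X S => /= [|z P IH|P IHP Q IHQ|M|q Ms] rho rho' X S h er.
- by inversion h; subst; constructor.
- inv_nu h b X1 f1; constructor.
  apply: IH f1 _ => a; rewrite /upd er.
  by rewrite (inj_eq (can_inj (nswapK x y))).
- inversion h; subst; constructor; [apply: IHP|apply: IHQ]; eassumption.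
- inversion h; subst => /=.
  have -> : mren rho' M = mren rho (mren (nswap x y) M).
    by rewrite mren_comp; apply: mren_ext => a _ /=.
  exact: flat_out.
- inversion h; subst.
  have -> : map (mren rho') Ms = map (mren rho) (map (mren (nswap x y)) Ms).
    by rewrite -map_comp; apply: eq_map => M /=; rewrite mren_comp; apply: mren_ext => a _ /=.
  exact: flat_call.
Qed.

(** The invariant of structural congruence: equal atoms up to order, in the same environment. The
    binder names may change, since the law for [PNu a P0] creates and removes binders; [Av] keeps
    created names out of the way of an outer context. *)
Definition refines P P' := forall rho X S Av, flat (tproc P) rho X S -> uniq X ->
  (forall a, a \in X -> a \notin map rho (fn P)) ->
  exists X' S', [/\ flat (tproc P') rho X' S', uniq X', perm_eq S S' &
    forall a, a \in X' -> a \notin X -> a \notin Av].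

Lemma refines_same P P' : (forall rho X S, flat (tproc P) rho X S ->
  (forall a, a \in X -> a \notin map rho (fn P)) -> uniq X ->
  exists X' S', [/\ flat (tproc P') rho X' S', perm_eq S S' & perm_eq X X']) -> refines P P'.
Proof.
move=> h rho X S Av f uX dX; have [X' [S' [f' pS pX]]] := h rho X S f dX uX.
exists X', S'; split=> //; first by rewrite -(perm_uniq pX).
by move=> a; rewrite -(perm_mem pX) => ->.
Qed.

Lemma refines_nu x P Q : refines P Q -> refines (PNu x P) (PNu x Q).
Proof.
move=> r rho X S Av h; inv_nu h b X1 f1.
move=> /= /andP[bX uX] dX.
have [||X' [S' [f' u' p' av]]] := r (upd rho x b) X1 S (b :: Av) f1.
- by [].
- move=> a aX; apply/mapP => -[c cP ea].
  have := dX a; rewrite inE aX orbT => /(_ isT)/mapP[]; move: ea; rewrite /upd.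
  case: (c =P x) => [_ ea|/eqP cx ea]; first by rewrite -ea aX in bX.
  by exists c => //; rewrite mem_filter cx.
exists (b :: X'), S'; split=> //; first by constructor.
  rewrite /= u' andbT; apply/negP => bX'; have := av b bX' bX.
  by rewrite mem_head.
move=> a; rewrite !inE negb_or => /orP[->//|aX'] /andP[_ aX].
by have := av a aX' aX; rewrite inE negb_or => /andP[].
Qed.

Lemma refines_parl P P' Q : refines P P' -> refines (PPar P Q) (PPar P' Q).
Proof.
move=> r rho X S Av h; inv_par h X1 S1 X2 S2 f1 f2.
rewrite cat_uniq => /and3P[u1 /hasPn dis u2] dX.
have [|X' [S' [f' u' p' av]]] := r rho X1 S1 (X2 ++ Av) f1 u1.
  by move=> a aX; have := dX a; rewrite /= map_cat !mem_cat aX negb_or => /(_ isT)/andP[].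
exists (X' ++ X2), (S' ++ S2); split; first by constructor.
- rewrite cat_uniq u' u2 andbT; apply/hasPn => a aX2; apply/negP => /= aX'.
  by have := av a aX' (dis a aX2); rewrite mem_cat aX2.
- by rewrite perm_cat2r.
- move=> a; rewrite !mem_cat negb_or => aX' /andP[aX1 /negbTE aX2].
  move: aX'; rewrite aX2 orbF => aX'; have := av a aX' aX1.
  by rewrite mem_cat negb_or => /andP[].
Qed.

Lemma refines_trans P Q R : fn P =i fn Q -> refines P Q -> refines Q R -> refines P R.
Proof.
move=> eP r1 r2 rho X S Av f uX dX.
have eM : map rho (fn P) =i map rho (fn Q) by apply: eq_mem_map.
have [X1 [S1 [f1 u1 p1 av1]]] := r1 rho X S (map rho (fn P) ++ Av) f uX dX.
have [|X2 [S2 [f2 u2 p2 av2]]] := r2 rho X1 S1 Av f1 u1.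
  move=> a aX1; rewrite -eM; have [/dX //|aX] := boolP (a \in X).
  by have := av1 a aX1 aX; rewrite mem_cat negb_or => /andP[].
exists X2, S2; split=> //; first exact: perm_trans p1 p2.
move=> a aX2 aX; have [aX1|/(av2 a aX2)//] := boolP (a \in X1).
by have := av1 a aX1 aX; rewrite mem_cat negb_or => /andP[].
Qed.

Lemma refines_comm P Q : refines (PPar P Q) (PPar Q P).
Proof.
apply: refines_same => rho X S h _ _.
inv_par h X1 S1 X2 S2 f1 f2.
exists (X2 ++ X1), (S2 ++ S1); split; first by constructor.
  by rewrite perm_catC.
by rewrite perm_catC.
Qed.

Lemma fn_alpha x y P : y \notin fn (PNu x P) -> fn (PNu x P) =i fn (PNu y (pswap x y P)).
Proof.
rewrite /= mem_filter => yP a; rewrite fn_pswap !mem_filter.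
have -> : (a \in map (nswap x y) (fn P)) = (nswap x y a \in fn P).
  by rewrite -{1}(nswapK x y a) mem_map //; apply: can_inj (nswapK x y).
rewrite /nswap; have [ax|ax] := eqVneq a x; last have [ay|//] := eqVneq a y.
  by move: yP; rewrite ax /= eq_sym; case: (x == y) => //= /negbTE->.
by move: yP; rewrite -ay ax /= => /negbTE->.
Qed.

Lemma refines_alpha x y P : y \notin fn (PNu x P) ->
  refines (PNu x P) (PNu y (pswap x y P)) /\ refines (PNu y (pswap x y P)) (PNu x P).
Proof.
rewrite /= mem_filter => yP; split; apply: refines_same => rho X S h _ _;
  inv_nu h b X1 f1;
  exists (b :: X1), S; split=> //; constructor.
  have f2 : flat (tproc P) (upd rho y b \o nswap x y) X1 S.
    apply: flat_ext f1 _ => a; rewrite tfn_tproc /upd /nswap /= => aP.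
    case: (a =P x) => [_|/eqP ax]; first by rewrite eqxx.
    case: (a =P y) => [ay|/eqP/negbTE->//].
    by move: yP; rewrite -ay ax aP.
  by apply: flat_pswap f2 _.
have f2 : flat (tproc (pswap x y (pswap x y P))) (upd rho y b \o nswap x y) X1 S.
  by apply: flat_pswap f1 _ => a /=; rewrite nswapK.
rewrite pswapK in f2; apply: flat_ext f2 _ => a; rewrite tfn_tproc /upd /nswap /= => aP.
case: (a =P x) => [_|/eqP ax]; first by rewrite eqxx.
case: (a =P y) => [ay|/eqP/negbTE->//].
by move: yP; rewrite -ay ax aP.
Qed.

Lemma upd_comm rho a b c d e : a != b -> upd (upd rho a c) b d e = upd (upd rho b d) a c e.
Proof.
move=> ab; rewrite /upd; case: (e =P b) => [->|//].
by rewrite eq_sym (negbTE ab).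
Qed.

(** Both directions are carried along for the sake of symmetry, and the equality of free names for
    the sake of transitivity, where the intermediate binder names have to avoid them. *)
Lemma sc_refines P P' : sc P P' ->
  [/\ fn P =i fn P', refines P P' & refines P' P].
Proof.
elim=> {P P'}.
- by move=> P; split=> //; apply: refines_same => rho X S h _ _; exists X, S.
- by move=> P Q _ [e r1 r2]; split=> // a; rewrite e.
- move=> P Q R _ [e1 r1 r1'] _ [e2 r2 r2']; split.
  + by move=> a; rewrite e1 e2.
  + exact: refines_trans e1 r1 r2.
  + by apply: refines_trans _ r2' r1' => a; rewrite e2.
- move=> x P Q _ [e r1 r2]; split; [|exact: refines_nu|exact: refines_nu].
  by move=> a /=; rewrite !mem_filter e.
- move=> P P' Q _ [e r1 r2]; split; [|exact: refines_parl|exact: refines_parl].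
  by move=> a /=; rewrite !mem_cat e.
- have pc P Q : fn (PPar P Q) =i fn (PPar Q P) by move=> a /=; rewrite !mem_cat orbC.
  move=> P Q Q' _ [e r1 r2]; split.
  + by move=> a /=; rewrite !mem_cat e.
  + apply: (refines_trans (pc P Q) (@refines_comm P Q) _).
    apply: (refines_trans _ (refines_parl r1) (@refines_comm Q' P)).
    by move=> a /=; rewrite !mem_cat e.
  + apply: (refines_trans (pc P Q') (@refines_comm P Q') _).
    apply: (refines_trans _ (refines_parl r2) (@refines_comm Q P)).
    by move=> a /=; rewrite !mem_cat e.
- move=> x y P yP; have [r1 r2] := refines_alpha yP; split=> //; exact: fn_alpha.
- move=> P Q R; split; first by move=> a /=; rewrite catA.
  + apply: refines_same => rho X S h _ _.
    inv_par h X1 S1 X2 S2 f1 f2.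
    inv_par f2 X3 S3 X4 S4 f3 f4.
    by exists ((X1 ++ X3) ++ X4), ((S1 ++ S3) ++ S4); split; rewrite -?catA //;
      rewrite !catA; do 2?constructor.
  + apply: refines_same => rho X S h _ _.
    inv_par h X1 S1 X2 S2 f1 f2.
    inv_par f1 X3 S3 X4 S4 f3 f4.
    by exists (X3 ++ (X4 ++ X2)), (S3 ++ (S4 ++ S2)); split; rewrite ?catA //;
      rewrite -!catA; do 2?constructor.
- move=> P Q; split; [|exact: refines_comm|exact: refines_comm].
  by move=> a /=; rewrite !mem_cat orbC.
- move=> P; split; first by move=> a /=; rewrite cats0.
  + apply: refines_same => rho X S h _ _.
    inv_par h X1 S1 X2 S2 f1 f2; inversion f2; subst.
    by exists X1, S1; split; rewrite ?cats0.
  + apply: refines_same => rho X S h _ _; exists (X ++ [::]), (S ++ [::]).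
    by split; rewrite ?cats0 //; rewrite -[X]cats0 -[S]cats0; constructor=> //; constructor.
- move=> a; split=> //.
  + move=> rho X S Av h _ _; inv_nu h b X1 f1.
    by inversion f1; subst; exists [::], [::]; split=> //; constructor.
  + move=> rho X S Av h _ _; inversion h; subst.
    exists [:: ubound Av], [::]; split=> //; first by do 2!constructor.
    move=> b; rewrite mem_seq1 => /eqP-> _; apply/negP => /ltn_ubound.
    by rewrite ltnn.
- have nn a b P : refines (PNu a (PNu b P)) (PNu b (PNu a P)).
    apply: refines_same => rho X S h _ _.
    inv_nu h c X1 f1.
    inv_nu f1 d X2 f2.
    have [ab|ab] := eqVneq a b.
      subst b; exists [:: c, d & X2], S; split=> //; do 2!constructor; exact: f2.
    exists [:: d, c & X2], S; split=> //.
      by do 2!constructor; apply: flat_ext f2 _ => e _; apply: upd_comm.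
    by rewrite -[[:: c, d & X2]]/([:: c; d] ++ X2) -[[:: d, c & X2]]/([:: d; c] ++ X2)
      perm_cat2r -[[:: c; d]]/([:: c] ++ [:: d]) perm_catC.
  move=> a b P; split=> // c /=; rewrite !mem_filter !andbA; congr (_ && _).
  exact: andbC.
- move=> a P Q aP; split.
  + move=> b /=; rewrite mem_cat !mem_filter mem_cat.
    by case: (b =P a) => [->|_] //=; rewrite (negbTE aP).
  + apply: refines_same => rho X S h _ _.
    inv_par h X1 S1 X2 S2 f1 f2.
    inv_nu f2 b X3 f3.
    exists (b :: X1 ++ X3), (S1 ++ S2); split=> //.
      constructor; constructor=> //; apply: flat_ext f1 _ => c; rewrite tfn_tproc /upd.
      by case: (c =P a) => // ->; rewrite (negbTE aP).
    by rewrite -(cat1s b X3) -(cat1s b (X1 ++ X3)) perm_catCA.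
  + apply: refines_same => rho X S h _ _.
    inv_nu h b X3 f3.
    inv_par f3 X1 S1 X2 S2 f1 f2.
    exists (X1 ++ b :: X2), (S1 ++ S2); split=> //.
      constructor; last by constructor.
      apply: flat_ext f1 _ => c; rewrite tfn_tproc /upd.
      by case: (c =P a) => // ->; rewrite (negbTE aP).
    by rewrite -(cat1s b X2) -(cat1s b (X1 ++ X2)) perm_catCA.
Qed.

Lemma sc_flat P P' rho X S Av : sc P P' -> flat (tproc P) rho X S -> uniq X ->
  (forall a, a \in X -> a \notin map rho (fn P)) ->
  exists X' S', [/\ flat (tproc P') rho X' S', uniq X', perm_eq S S' &
    forall a, a \in X' -> a \notin X -> a \notin Av].
Proof. by move=> /sc_refines[_ r _]; apply: r. Qed.

Lemma sc_fn P P' : sc P P' -> fn P =i fn P'.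
Proof. by case/sc_refines. Qed.

(** * Standard forms with prescribed bound names *)

Lemma sc_par P P' Q Q' : sc P P' -> sc Q Q' -> sc (PPar P Q) (PPar P' Q').
Proof. by move=> h1 h2; apply: sc_trans (sc_parl _ h1) (sc_parr _ h2). Qed.

Lemma sc_nus X P Q : sc P Q -> sc (nus X P) (nus X Q).
Proof. by move=> h; elim: X => //= x X; apply: sc_nu. Qed.

Lemma sc_par4 P1 P2 Q1 Q2 :
  sc (PPar (PPar P1 P2) (PPar Q1 Q2)) (PPar (PPar P1 Q1) (PPar P2 Q2)).
Proof.
apply: sc_trans (sc_sym (sc_assoc _ _ _)) _; apply: sc_trans _ (sc_assoc _ _ _).
apply: sc_parr; apply: sc_trans (sc_assoc _ _ _) _.
by apply: sc_trans (sc_parl _ (sc_comm _ _)) (sc_sym (sc_assoc _ _ _)).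
Qed.

Lemma sc_0par P : sc (PPar (P0 _ _ _) P) P.
Proof. exact: sc_trans (sc_comm _ _) (sc_zero _). Qed.

Lemma sc_outs_cat (G1 G2 : seq msg) :
  sc (outs nq (G1 ++ G2)) (PPar (outs nq G1) (outs nq G2)).
Proof.
elim: G1 => [|M G1 IH] /=; first exact: sc_sym (sc_0par _).
by apply: sc_trans (sc_parr _ IH) (sc_assoc _ _ _).
Qed.

Lemma sc_calls_cat (Q1 Q2 : seq ('I_nq * seq msg)) :
  sc (calls (Q1 ++ Q2)) (PPar (calls Q1) (calls Q2)).
Proof.
elim: Q1 => [|M Q1 IH] /=; first exact: sc_sym (sc_0par _).
by apply: sc_trans (sc_parr _ IH) (sc_assoc _ _ _).
Qed.

Lemma sc_calls_perm (Q1 Q2 : seq ('I_nq * seq msg)) :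
  perm_eq Q1 Q2 -> sc (calls Q1) (calls Q2).
Proof.
elim: Q1 Q2 => [|c Q1 IH] Q2 pQ.
  by rewrite (perm_nilP (_ : perm_eq Q2 [::])) ?(perm_sym Q2) //; apply: sc_refl.
have cQ2 : c \in Q2 by rewrite -(perm_mem pQ) mem_head.
case: (path.splitPr cQ2) pQ => s1 s2 pQ.
have p2 : perm_eq Q1 (s1 ++ s2).
  by rewrite -(perm_cons c); apply: perm_trans pQ _; rewrite perm_sym -cat1s perm_catCA.
apply: sc_trans (sc_parr _ (IH _ p2)) _.
apply: sc_trans (sc_parr _ (sc_calls_cat _ _)) _.
apply: sc_trans _ (sc_sym (sc_calls_cat _ _)) => /=.
apply: sc_trans (sc_assoc _ _ _) _.
by apply: sc_trans (sc_parl _ (sc_comm _ _)) (sc_sym (sc_assoc _ _ _)).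
Qed.

Definition acall (a : atom) : option ('I_nq * seq msg) :=
  if a.1 is q.+1 then omap (fun i => (i, a.2)) (insub q) else None.
Definition acalls S := pmap acall S.

Definition std S : proc := PPar (outs nq (souts S)) (calls (acalls S)).

Lemma acalls_cat S1 S2 : acalls (S1 ++ S2) = acalls S1 ++ acalls S2.
Proof. exact: pmap_cat. Qed.

Lemma sc_std_cat S1 S2 : sc (PPar (std S1) (std S2)) (std (S1 ++ S2)).
Proof.
rewrite /std souts_cat acalls_cat; apply: sc_trans (sc_par4 _ _ _ _) _.
by apply: sc_par; apply: sc_sym; [apply: sc_outs_cat|apply: sc_calls_cat].
Qed.

Lemma sc_nus_ext X P Q : (forall a, a \in X -> a \notin fn P) ->
  sc (PPar P (nus X Q)) (nus X (PPar P Q)).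
Proof.
elim: X => [|x X IH] dX /=; first exact: sc_refl.
apply: sc_trans (sc_ext _ _) _; first by apply: dX; rewrite mem_head.
by apply: sc_nu; apply: IH => a aX; apply: dX; rewrite inE aX orbT.
Qed.

Lemma sc_nus_fresh X P : (forall a, a \in X -> a \notin fn P) -> sc (nus X P) P.
Proof.
move=> dX; elim: X dX => [|x X IH] dX /=; first exact: sc_refl.
apply: sc_trans (sc_nu _ (IH _)) _; first by move=> a aX; apply: dX; rewrite inE aX orbT.
apply: sc_trans (sc_nu _ (sc_sym (sc_zero _))) _.
apply: sc_trans (sc_sym (sc_ext _ _)) _; first by apply: dX; rewrite mem_head.
by apply: sc_trans (sc_parr _ (sc_nu0 _ _ _ _)) (sc_zero _).
Qed.

Fixpoint psize P : nat :=
  match P with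
  | PNu _ P => (psize P).+1
  | PPar P Q => (psize P + psize Q).+1
  | _ => 1
  end.

Lemma psize_pswap x y P : psize (pswap x y P) = psize P.
Proof. by elim: P => //= [z P ->|P -> Q ->]. Qed.

Lemma fn_nus X P : fn (nus X P) = [seq a <- fn P | a \notin X].
Proof.
elim: X => [|x X IH] /=; first by rewrite filter_predT.
rewrite IH -filter_predI; apply: eq_filter => a /=.
by rewrite inE negb_or andbC.
Qed.

(** Induction on size instead of structure, since alpha-conversion replaces the body of a
    restriction by a swapped copy. The names [X] are at choice, which lets two processes be brought
    to standard forms that fit together. *)
Lemma sc_std P X S : flat (tproc P) id X S -> uniq X ->
  (forall a, a \in X -> a \notin fn P) -> sc P (nus X (std S)).
Proof.
have [n] := ubnP (psize P); elim: n P X S => // n IHn [|x P|P Q|M|q Ms] X S /= lt h uX dX.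
- by inversion h; subst; rewrite /std /=; apply: sc_sym; apply: sc_zero.
- inv_nu h b X1 f1.
  have bP : b \notin fn (PNu x P) by apply: dX; rewrite mem_head.
  apply: sc_trans (sc_alpha bP) _ => /=; apply: sc_nu; apply: IHn.
  + by rewrite psize_pswap; lia.
  + have f2 : flat (tproc P) (id \o nswap x b) X1 S.
      apply: flat_ext f1 _ => a; rewrite tfn_tproc /upd /nswap /= => aP.
      case: (a =P x) => [_|/eqP ax] //; case: (a =P b) => [ab|//].
      by move: bP; rewrite /= mem_filter -ab ax aP.
    by apply: flat_pswap f2 _.
  + by case/andP: uX.
  + move=> a aX; have := sc_fn (sc_alpha bP) a => /= e.
    have ab : a != b by apply: contraTneq aX => ->; case/andP: uX.
    have : a \notin [seq a <- fn P | a != x] by apply: dX; rewrite inE aX orbT.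
    by rewrite e mem_filter ab.
- inv_par h X1 S1 X2 S2 f1 f2.
  move: uX; rewrite cat_uniq => /and3P[u1 /hasPn dis u2].
  have d1 a : a \in X1 -> (a \notin fn P) && (a \notin fn Q).
    by move=> aX; have := dX a; rewrite !mem_cat aX negb_or => /(_ isT).
  have d2 a : a \in X2 -> (a \notin fn P) && (a \notin fn Q).
    by move=> aX; have := dX a; rewrite !mem_cat aX orbT negb_or => /(_ isT).
  have s1 : sc P (nus X1 (std S1)).
    by apply: IHn => //; [lia|move=> a /d1/andP[]].
  have s2 : sc Q (nus X2 (std S2)).
    by apply: IHn => //; [lia|move=> a /d2/andP[]].
  apply: sc_trans (sc_parl _ s1) _; apply: sc_trans (sc_comm _ _) _.
  apply: sc_trans (sc_nus_ext _ _) _; first by move=> a /d1/andP[].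
  rewrite /nus foldr_cat; apply: sc_nus; rewrite -/(nus X2 _).
  apply: sc_trans (sc_comm _ _) _; apply: sc_trans (sc_parr _ s2) _.
  apply: sc_trans (sc_nus_ext _ _) _; last by apply: sc_nus; apply: sc_std_cat.
  move=> a aX2; have /andP[aP _] := d2 a aX2.
  have := sc_fn s1 a; rewrite fn_nus mem_filter (negbTE aP).
  by rewrite (dis a aX2 : a \notin X1) /= => <-.
- inversion h; subst => /=; rewrite mren_id /std /=.
  by apply: sc_sym; apply: sc_trans (sc_zero _) (sc_zero _).
- inversion h; subst => /=; rewrite /std /acalls /= /acall /= valK /=.
  have -> : map (mren id) Ms = Ms by rewrite map_id_in // => M _; apply: mren_id.
  by apply: sc_sym; apply: sc_trans (sc_0par _) (sc_zero _).
Qed.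
End Processes.

(** * Denotations of limits *)

Scheme lim_mut := Induction for lim Sort Prop
  with rep_mut := Induction for rep Sort Prop
  with blk_mut := Induction for blk Sort Prop.
Combined Scheme lim_rep_blk_ind from lim_mut, rep_mut, blk_mut.

(** A left inverse of [sigma] on [N] made injective on all names, so that derivations can be
    transported back along it; names outside the image are shifted beyond [N]. *)
Definition ren_inv (sigma : nat -> nat) (N : seq nat) (c : nat) : nat :=
  if c \in map sigma N then nth 0 N (index c (map sigma N)) else c + ubound N.

Lemma nth_index_map (f : nat -> nat) (N : seq nat) a : {in N &, injective f} -> a \in N ->
  nth 0 N (index (f a) (map f N)) = a.
Proof.
move=> inj aN; have fa : f a \in map f N by apply: map_f.
have lt : index (f a) (map f N) < size N by rewrite -(size_map f) index_mem.
by apply: inj => //; [apply: mem_nth | rewrite -(nth_map 0 0) // nth_index].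
Qed.

Lemma ren_invK sigma N : {in N &, injective sigma} ->
  {in N, cancel sigma (ren_inv sigma N)}.
Proof.
by move=> inj a aN; rewrite /ren_inv map_f // nth_index_map.
Qed.

Lemma ren_inv_inj sigma N : injective (ren_inv sigma N).
Proof.
have lt c : c \in map sigma N -> nth 0 N (index c (map sigma N)) < ubound N.
  by move=> cN; apply: ltn_ubound; apply: mem_nth; rewrite -(size_map sigma) index_mem.
move=> c d; rewrite /ren_inv; case: ifPn => cN; case: ifPn => dN.
- move=> e; rewrite -(nth_index 0 cN) -(nth_index 0 dN).
  have lc : index c (map sigma N) < size N by rewrite -(size_map sigma) index_mem.
  have ld : index d (map sigma N) < size N by rewrite -(size_map sigma) index_mem.
  by rewrite (nth_map 0 0 _ lc) (nth_map 0 0 _ ld) e.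
- by move=> e; have := lt c cN; rewrite e ltnNge leq_addl.
- by move=> e; have := lt d dN; rewrite -e ltnNge leq_addl.
- exact: addIn.
Qed.

(** The environment under a block of restrictions. The list [xs] may repeat a name, and then the
    last, that is innermost, binder prevails. *)
Fixpoint updl (rho : nat -> nat) (xs bs : seq nat) : nat -> nat :=
  match xs, bs with
  | x :: xs', b :: bs' => updl (upd rho x b) xs' bs'
  | _, _ => rho
  end.

Lemma updl_id rho xs bs a : a \notin xs -> updl rho xs bs a = rho a.
Proof.
elim: xs rho bs => [|x xs IH] rho [|b bs] //=; rewrite inE negb_or => /andP[ax axs].
by rewrite IH // /upd (negbTE ax).
Qed.

Lemma updl_in rho xs bs a : size bs = size xs -> a \in xs -> updl rho xs bs a \in bs.
Proof.
elim: xs rho bs => [|x xs IH] rho [|b bs] //= [sz]; rewrite !inE.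
have [axs _|axs] := boolP (a \in xs); first by rewrite IH ?orbT.
by rewrite orbF => ax; rewrite updl_id // /upd ax eqxx.
Qed.

Lemma updl_inj rho xs bs : size bs = size xs -> uniq bs ->
  {in xs &, injective (updl rho xs bs)}.
Proof.
elim: xs rho bs => [|x xs IH] rho [|b bs] //= [sz] /andP[bbs ubs] a c.
rewrite !inE; have [axs|axs] := boolP (a \in xs); have [cxs|cxs] := boolP (c \in xs);
  rewrite ?orbT ?orbF.
- by move=> _ _; apply: IH.
- move=> _ /eqP cx; rewrite (updl_id _ _ cxs) /upd cx eqxx => e.
  by have := updl_in (upd rho x b) sz axs; rewrite e (negbTE bbs).
- move=> /eqP ax _; rewrite (updl_id _ _ axs) /upd ax eqxx => e.
  by have := updl_in (upd rho x b) sz cxs; rewrite -e (negbTE bbs).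
- by move=> /eqP-> /eqP->.
Qed.

Section Denotation.
Variables (nc : nat) (ar : nat -> nat) (nq : nat).
Notation msg := (Defs.msg nc ar).
Notation atom := (nat * seq msg)%type.
Notation tmpl := (tmpl nc ar).
Notation proc := (proc nc ar nq).
Notation lim := (lim nc ar nq).
Notation rep := (rep nc ar nq).
Notation blk := (blk nc ar nq).
Implicit Types (S : seq atom) (X A B Av : seq nat) (rho sigma : nat -> nat) (t u : tmpl)
  (P Q R : proc).

Fixpoint tlim (l : lim) : tmpl :=
  match l with
  | LNil => T0 _ _
  | LCons r l => TPar (trep r) (tlim l)
  end
with trep (r : rep) : tmpl :=
  match r with
  | RB b => TId (tblk b)
  | ROm b => TOm (tblk b)
  end
with tblk (b : blk) : tmpl :=
  match b with
  | BOut M => TOut M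
  | BCall q Ms => TCall q Ms
  | BNu x l => TNu x (tlim l)
  end.

Lemma inst_flat :
  (forall (l : lim) P rho X S, inst_lim l P -> flat (tproc P) rho X S -> flat (tlim l) rho X S) /\
  (forall (r : rep) P rho X S, inst_rep r P -> flat (tproc P) rho X S -> flat (trep r) rho X S) /\
  (forall (b : blk) P rho X S, inst_blk b P -> flat (tproc P) rho X S -> flat (tblk b) rho X S).
Proof.
apply: lim_rep_blk_ind.
- by move=> P rho X S /= ->.
- move=> r IHr l IHl P rho X S.
  (* The last component of a limit is instantiated without a trailing [P0], whereas the template
     keeps a [T0] there. *)
  case: l IHl => [|r' l'] IHl /=.
    by move=> iP f; rewrite -[X]cats0 -[S]cats0; constructor; [apply: IHr f|constructor].
  move=> [P1 [P2 [-> i1 i2]]] h.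
  inv_par h X1 S1 X2 S2 f1 f2.
  by constructor; [apply: IHr f1|apply: IHl f2].
- by move=> b IH P rho X S /= iP f; constructor; apply: IH f.
- move=> b IH P rho X S /= [ps [hps ->]] {P}.
  elim: ps X S hps => [|p ps IHps] X S hps /= h; first by inversion h; subst; constructor.
  have ip : inst_blk b p by apply: hps; left.
  case: ps IHps hps h => [|p' ps] IHps hps h.
    by rewrite -[X]cats0 -[S]cats0; constructor; [apply: IH ip h|constructor].
  inv_par h X1 S1 X2 S2 f1 f2.
  constructor; first exact: IH f1.
  by apply: IHps f2 => q qin; apply: hps; right.
- by move=> M P rho X S /= ->.
- by move=> q Ms P rho X S /= ->.
- move=> x l IH P rho X S /= [P' [-> iP]] h.
  by inversion h; subst; constructor; apply: IH iP _.
Qed.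

Lemma flat_inst :
  (forall (l : lim) rho X S, flat (tlim l) rho X S ->
     exists2 P, inst_lim l P & flat (tproc P) rho X S) /\
  (forall (r : rep) rho X S, flat (trep r) rho X S ->
     exists2 P, inst_rep r P & flat (tproc P) rho X S) /\
  (forall (b : blk) rho X S, flat (tblk b) rho X S ->
     exists2 P, inst_blk b P & flat (tproc P) rho X S).
Proof.
apply: lim_rep_blk_ind => /=.
- by move=> rho X S h; exists (P0 _ _ _).
- move=> r IHr l IHl rho X S h.
  inv_par h X1 S1 X2 S2 f1 f2.
  have [P1 i1 g1] := IHr _ _ _ f1; have [P2 i2 g2] := IHl _ _ _ f2.
  case: l {IHl h} f2 i2 => [|r' l'] f2 i2.
    by inversion f2; subst; rewrite !cats0; exists P1.
  by exists (PPar P1 P2); [exists P1, P2 | constructor].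
- by move=> b IH rho X S h; inversion h; subst; apply: IH.
- move=> b IH rho X S h; move: {-1}(TOm (tblk b)) (erefl (TOm (tblk b))) h => u eu h.
  suff [ps hps f] : exists2 ps : seq proc, (forall p, List.In p ps -> inst_blk b p) &
      flat (tproc (parl ps)) rho X S by exists (parl ps) => //; exists ps.
  elim: h eu IH => {u rho X S} //.
    by move=> u rho _ _; exists [::] => //; constructor.
  move=> u rho X1 S1 X2 S2 f1 _ f2 IH2 [eu] IH; subst u.
  have [p ip fp] := IH _ _ _ f1; have [//|ps hps fps] := IH2 _ IH.
  exists (p :: ps); first by move=> q [<-//|/hps].
  case: ps hps fps => [|p' ps] hps fps /=; last by constructor.
  by inversion fps; subst; rewrite !cats0.
- by move=> M rho X S h; exists (POut _ M).
- by move=> q Ms rho X S h; exists (PCall q Ms).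
- move=> x l IH rho X S h; inv_nu h b X1 f1.
  have [P iP fP] := IH _ _ _ f1.
  by exists (PNu x P); [exists P | constructor].
Qed.

Lemma flat_proc_fresh P Av : exists X S, [/\ flat (tproc P) id X S, uniq X &
  forall a, a \in X -> a \notin Av].
Proof.
pose X := iota (ubound Av) (nbind (tproc P)).
exists X, (atoms (tproc P) id X); split; last first.
- move=> a; rewrite mem_iota => /andP[le _]; apply/negP => /ltn_ubound.
  by rewrite ltnNge le.
- exact: iota_uniq.
by apply: flat_atoms; rewrite ?omfree_tproc ?size_iota.
Qed.

Lemma inst_fn (l : lim) P : inst_lim l P -> {subset fn P <= tfn (tlim l)}.
Proof.
move=> iP a aP; have [X [S [f uX dX]]] := flat_proc_fresh P (fn P).
have aS : a \in snames S by apply: (flat_free f) (omfree_tproc P) _; rewrite tfn_tproc.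
have := flat_names (inst_flat.1 _ _ _ _ _ iP f) aS; rewrite map_id mem_cat => /orP[|//].
by move/dX; rewrite aP.
Qed.

Definition call_atom (c : 'I_nq * seq msg) : atom := ((c.1 : nat).+1, c.2).

Definition satoms (G : seq msg) (Q : seq ('I_nq * seq msg)) : seq atom :=
  [seq (0, [:: M]) | M <- G] ++ map call_atom Q.

Lemma souts_satoms G (Q : seq ('I_nq * seq msg)) : souts (satoms G Q) = G.
Proof.
rewrite /satoms souts_cat /souts; elim: Q => [|c Q /= //].
by rewrite /= cats0; elim: G => //= M G ->.
Qed.

Lemma scalls_satoms G (Q : seq ('I_nq * seq msg)) : scalls (satoms G Q) = map call_atom Q.
Proof.
rewrite /satoms scalls_cat /scalls.
have -> : [seq a <- [seq (0, [:: M]) | M <- G] | a.1 != 0] = [::] :> seq atom.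
  by elim: G.
by elim: Q => //= c Q ->.
Qed.

Lemma flat_outs (G : seq msg) rho X S : flat (tproc (outs nq G)) rho X S ->
  X = [::] /\ S = sren rho (satoms G [::]).
Proof.
elim: G X S => [|M G IH] X S /= h; first by inversion h.
inv_par h X1 S1 X2 S2 f1 f2.
have [-> ->] := IH _ _ f2; inversion f1; subst.
by rewrite /satoms !cats0.
Qed.

Lemma flat_calls (Q : seq ('I_nq * seq msg)) rho X S : flat (tproc (calls Q)) rho X S ->
  X = [::] /\ S = sren rho (satoms [::] Q).
Proof.
elim: Q X S => [|c Q IH] X S /= h; first by inversion h.
inv_par h X1 S1 X2 S2 f1 f2.
by have [-> ->] := IH _ _ f2; inversion f1; subst.
Qed.

Lemma flat_nus xs P rho X S : flat (tproc (nus xs P)) rho X S -> exists Xs X',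
  [/\ size Xs = size xs, X = Xs ++ X' & flat (tproc P) (updl rho xs Xs) X' S].
Proof.
elim: xs rho X => [|x xs IH] rho X /= h; first by exists [::], X.
inv_nu h b X1 f1.
have [Xs [X' [sz -> f]]] := IH _ _ f1.
by exists (b :: Xs), X'; rewrite /= sz.
Qed.

Lemma nus_flat xs P rho Xs X' S : size Xs = size xs ->
  flat (tproc P) (updl rho xs Xs) X' S -> flat (tproc (nus xs P)) rho (Xs ++ X') S.
Proof.
elim: xs rho Xs => [|x xs IH] rho [|b Xs] //= [sz] f.
by constructor; apply: IH.
Qed.

Lemma flat_std G (Q : seq ('I_nq * seq msg)) rho X S :
  flat (tproc (PPar (outs nq G) (calls Q))) rho X S ->
  X = [::] /\ S = sren rho (satoms G Q).
Proof.
move=> /= h; inv_par h X1 S1 X2 S2 f1 f2.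
have [-> ->] := flat_outs f1; have [-> ->] := flat_calls f2.
by split=> //; rewrite -sren_cat /satoms /= cats0.
Qed.

Lemma std_flat G (Q : seq ('I_nq * seq msg)) rho :
  flat (tproc (PPar (outs nq G) (calls Q))) rho [::] (sren rho (satoms G Q)).
Proof.
have := flat_atoms rho (omfree_tproc (PPar (outs nq G) (calls Q))).
have nb : nbind (tproc (PPar (outs nq G) (calls Q))) = 0.
  rewrite /=; have -> : nbind (tproc (outs nq G)) = 0 by elim: (G).
  by elim: (Q).
move=> /(_ [::]); rewrite nb => /(_ erefl) f.
by have [_ <-] := flat_std f.
Qed.

Lemma flat_proc_valid P rho X S : flat (tproc P) rho X S ->
  forall a, a \in S -> if a.1 is q.+1 then q < nq else size a.2 = 1.
Proof.
elim: P rho X S => /= [|x P IH|P IHP Q IHQ|M|q Ms] rho X S h.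
- by inversion h.
- by inversion h; subst; apply: IH; eassumption.
- inv_par h X1 S1 X2 S2 f1 f2.
  by move=> a; rewrite mem_cat => /orP[/(IHP _ _ _ f1)|/(IHQ _ _ _ f2)].
- by inversion h; subst=> a; rewrite mem_seq1 => /eqP->.
- by inversion h; subst=> a; rewrite mem_seq1 => /eqP-> /=.
Qed.

Lemma satoms_perm S :
  (forall a : atom, a \in S -> if a.1 is q.+1 then q < nq else size a.2 = 1) ->
  perm_eq S (satoms (souts S) (acalls nq S)).
Proof.
elim: S => //= a S IH hS.
have {}IH : perm_eq S (satoms (souts S) (acalls nq S)).
  by apply: IH => b bS; apply: hS; rewrite inE bS orbT.
have := hS a (mem_head _ _); case: a {hS} => -[|q] Ms /=.
  case: Ms => [|M [|M' Ms]] // _.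
  by rewrite -[souts _]/(M :: souts S) -[acalls _ _]/(acalls nq S) /satoms /= perm_cons.
move=> ltq; rewrite -[souts _]/(souts S) /satoms.
rewrite [acalls _ _]/= /acalls /= /acall /= insubT /=.
by rewrite perm_sym -cat1s perm_catCA /= perm_cons perm_sym.
Qed.

Section Model.
Variable der : seq msg -> msg -> Prop.
Hypothesis model : intruder_model der.
Notation below := (below der).
Notation covered := (covered der).

Lemma below_ren_in theta S S' : {in snames S ++ snames S' &, injective theta} ->
  below S S' -> below (sren theta S) (sren theta S').
Proof.
move=> inj b; set s := snames S ++ snames S' in inj.
rewrite -(@sren_ext _ _ (inj_ext s theta) theta S); last first.
  by move=> a aS; apply: inj_extE; rewrite mem_cat aS.
rewrite -(@sren_ext _ _ (inj_ext s theta) theta S'); last first.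
  by move=> a aS; apply: inj_extE; rewrite mem_cat aS orbT.
exact: (below_ren model) (inj_ext_inj inj) b.
Qed.

(** The rigid names are the free names of the instance [P']. The bodies in [kemb] share their names;
    [rho1] and [rho2] translate these into the binder names of the two flat instances, and the
    embedding goes back along [rho1] and forth along [rho2]. A free name of [P] that occurs in [ys]
    is fixed by [rho1] and becomes a bound name under [rho2]. *)
Lemma den_covered (l : lim) P Xp Sp : flat (tproc P) id Xp Sp -> uniq Xp ->
  (forall a, a \in Xp -> a \notin fn P) -> (forall a, a \in Xp -> a \notin tfn (tlim l)) ->
  den der l P -> covered (tlim l) Sp.
Proof.
move=> fP uXp dP dl [P' [iP' [xs [ys [G1 [G2 [Q [Q' [sc1 sc2 prec]]]]]]]]].
set t := tlim l in dl *.
pose N := snames (satoms G1 Q) ++ fn P'.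
have fnP' : {subset fn P' <= tfn t} := inst_fn iP'.
have [|X1 [S1 [f1 u1 p1 av1]]] := sc_flat (N ++ tfn t) sc1 fP uXp.
  by move=> a aX; rewrite map_id; apply: dP.
have [Xs [X1' [sz1 e1 f1']]] := flat_nus f1.
have [e1' eS1] := flat_std f1'; subst X1'; rewrite cats0 in e1; subst Xs.
set rho1 := updl id xs X1 in eS1.
pose R2 := PPar (PPar (outs nq G2) (calls Q)) (calls Q').
have enus : nus xs (nus ys R2) = nus (xs ++ ys) R2 by rewrite /nus foldr_cat.
pose S0 := satoms G2 Q ++ satoms [::] Q'.
pose NN := N ++ snames S0 ++ tfn t ++ fn P'.
pose Z := iota (ubound NN) (size (xs ++ ys)).
have dZ a : a \in Z -> a \notin NN.
  by rewrite mem_iota => /andP[le _]; apply/negP => /ltn_ubound; rewrite ltnNge le.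
pose rho2 := updl id (xs ++ ys) Z.
have szZ : size Z = size (xs ++ ys) by rewrite size_iota.
have uZ : uniq Z by apply: iota_uniq.
have f2 : flat (tproc (nus xs (nus ys R2))) id Z (sren rho2 S0).
  rewrite enus -[Z]cats0; apply: nus_flat => //.
  rewrite -[X in flat _ _ X]/([::] ++ [::]) /S0 sren_cat; constructor; first exact: std_flat.
  have := flat_atoms rho2 (omfree_tproc (calls Q')) (X := [::]).
  have -> : nbind (tproc (calls Q')) = 0 by elim: (Q').
  by move=> /(_ erefl) f; have [_ <-] := flat_calls f.
have [|X2 [S2 [fP' u2 p2 av2]]] := sc_flat (tfn t) (sc_sym sc2) f2 uZ.
  move=> a aZ; rewrite map_id -(sc_fn sc2); have := dZ a aZ.
  by rewrite /NN !mem_cat !negb_or => /and4P[].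
have d2 a : a \in X2 -> a \notin tfn t.
  move=> aX2; have [/dZ|/(av2 a aX2)//] := boolP (a \in Z).
  by rewrite /NN !mem_cat !negb_or => /and4P[].
have ft := inst_flat.1 _ _ _ _ _ iP' fP'; rewrite -/t in ft.
have nsA a : a \in fn P' -> a \notin xs ++ ys.
  move=> aP'; have := aP'; rewrite (sc_fn sc2) enus fn_nus mem_filter.
  by case/andP.
have [pA fA] : prunable (fn P') t /\ flat (prune (fn P') t) id X2 S2.
  apply: flat_prunable ft _ => a at_ aP'; apply/negP => aS2.
  have := flat_names fP' aS2; rewrite map_id mem_cat tfn_tproc (negbTE aP') orbF.
  by move/d2; rewrite at_.
exists (fn P'); split=> //; exists X2, S2; split=> //.
have X1N c : c \in N -> c \notin xs -> c \notin X1.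
  move=> cN cxs; apply/negP => cX1.
  have [cXp|cXp] := boolP (c \in Xp); last first.
    by have := av1 c cX1 cXp; rewrite mem_cat cN.
  move: cN; rewrite mem_cat => /orP[cS|/fnP']; last by move/negP: (dl c cXp).
  have /negP[] := dP c cXp; rewrite (sc_fn sc1) fn_nus mem_filter cxs -tfn_tproc.
  have f := std_flat G1 Q id.
  have := flat_names f; rewrite (@sren_idE _ _ id) // => /(_ c cS).
  by rewrite map_id.
have inj1 : {in N &, injective rho1}.
  move=> a c aN cN; have [ax|ax] := boolP (a \in xs); have [cx|cx] := boolP (c \in xs).
  - exact: updl_inj.
  - rewrite /rho1 (updl_id _ _ cx) => e; have := updl_in id sz1 ax; rewrite e.
    by move/negP: (X1N c cN cx).
  - rewrite /rho1 (updl_id _ _ ax) => e; have := updl_in id sz1 cx; rewrite -e.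
    by move/negP: (X1N a aN ax).
  - by rewrite /rho1 !updl_id.
have inj2 : {in NN &, injective rho2}.
  move=> a c aN cN; have [ax|ax] := boolP (a \in xs ++ ys); have [cx|cx] := boolP (c \in xs ++ ys).
  - exact: updl_inj.
  - rewrite /rho2 (updl_id _ _ cx) => e; have := updl_in id szZ ax; rewrite e.
    by move/dZ; rewrite cN.
  - rewrite /rho2 (updl_id _ _ ax) => e; have := updl_in id szZ cx; rewrite -e.
    by move/dZ; rewrite aN.
  - by rewrite /rho2 !updl_id.
have NNN : {subset N <= NN} by move=> a aN; rewrite mem_cat aN.
pose sigma c := rho2 (nth 0 N (index c (map rho1 N))).
have sigE a : a \in N -> sigma (rho1 a) = rho2 a.
  by move=> aN; rewrite /sigma nth_index_map.
have rho1A a : a \in fn P' -> rho1 a = a.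
  by move=> /nsA; rewrite mem_cat negb_or => /andP[axs _]; apply: updl_id.
have AN : {subset fn P' <= N} by move=> a aA; rewrite mem_cat aA orbT.
apply: (emb_in (s := map rho1 N) (sigma := sigma)).
- by move=> a aA; rewrite -(rho1A a aA) map_f // AN.
- move=> a; rewrite (perm_snames p1) eS1 snames_sren => /mapP[c cS ->].
  by apply: map_f; rewrite mem_cat cS.
- move=> _ _ /mapP[a aN ->] /mapP[c cN ->]; rewrite !sigE // => e.
  by rewrite (inj2 a c) // NNN.
- by move=> a aA; rewrite -{1}(rho1A a aA) sigE ?AN // /rho2 updl_id // nsA.
apply: (below_trans model) (below_perm model (perm_map _ p1)) _; rewrite -/(sren _ _) eS1.
apply: (below_trans model) _ (below_perm model p2).
rewrite sren_comp (@sren_ext _ _ _ rho2); last first.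
  by move=> a aS; rewrite /= sigE // mem_cat aS.
apply: below_ren_in.
  move=> a c; rewrite !mem_cat => aS cS; apply: inj2; rewrite /NN /N !mem_cat.
    by case/orP: aS => ->; rewrite ?orbT.
  by case/orP: cS => ->; rewrite ?orbT.
split.
  rewrite souts_satoms /S0 souts_cat !souts_satoms cats0 => M MG.
  by apply: prec; apply: (der_id model).
by rewrite /S0 scalls_cat !scalls_satoms; apply: msub_catl.
Qed.

(** The common prefix of [kemb] is taken to be [Xp], which is vacuous in the instance [P'], and all
    binders of [P'] go to the inner prefix. Undoing [sigma] by [kap] makes the atoms of [P] appear
    under their own names, captured where [P'] binds them. *)
Lemma covered_den (l : lim) P Xp Sp : flat (tproc P) id Xp Sp -> uniq Xp ->
  (forall a, a \in Xp -> a \notin fn P) -> (forall a, a \in Xp -> a \notin tfn (tlim l)) ->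
  covered (tlim l) Sp -> den der l P.
Proof.
move=> fP uXp dP dl; set t := tlim l in dl *.
move=> [A [sA pA [X2 [S2 [f2 u2 d2 [sigma [inj fx [dS mS]]]]]]]].
have [P' iP' fP'] := flat_inst.1 _ _ _ _ (flat_prune f2).
have fnP' : {subset fn P' <= tfn t} := inst_fn iP'.
have fnA a : a \in fn P' -> a \in A.
  move=> aP'; have : a \in snames S2.
    by apply: (flat_free fP') (omfree_tproc P') _; rewrite tfn_tproc.
  move/(flat_names f2); rewrite map_id mem_cat => /orP[/d2/negP[]|/(tfn_prune pA)//].
  exact: fnP'.
pose N := A ++ snames Sp; pose kap := ren_inv sigma N.
have injk : injective kap by apply: ren_inv_inj.
have kapK a : a \in N -> kap (sigma a) = a by apply: ren_invK; apply: in2W.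
have kapA a : a \in A -> kap a = a.
  by move=> aA; rewrite -{1}(fx a aA) kapK // mem_cat aA.
have fk : flat (tproc P') id (map kap X2) (sren kap S2).
  by apply: flat_ren_fix fP' _ => a; rewrite tfn_tproc => /fnA; apply: kapA.
have sP : sc P (nus Xp (std nq Sp)) by apply: sc_std.
have sP' : sc P' (nus (map kap X2) (std nq (sren kap S2))).
  apply: sc_std fk _ _; first by rewrite map_inj_uniq.
  move=> _ /mapP[x xX ->]; apply/negP => kP'; have kA := fnA _ kP'.
  have /injk e := kapA _ kA; rewrite e in kP'.
  by have /negP[] := d2 x xX; apply: fnP'.
have [Q' pQ] : exists Q' : seq ('I_nq * seq msg), perm_eq (acalls nq (sren kap S2)) (acalls nq Sp ++ Q').
  have eq : scalls Sp = sren kap (scalls (sren sigma Sp)).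
    rewrite -scalls_sren sren_comp -[in LHS](@sren_idE _ _ (kap \o sigma) Sp) //.
    by move=> a aS /=; rewrite kapK // mem_cat aS orbT.
  have /msubP[R pR] : msub (scalls Sp) (scalls (sren kap S2)).
    by rewrite eq [scalls (sren kap S2)]scalls_sren; apply: msub_map.
  have acE S : acalls nq S = acalls nq (scalls S).
    rewrite /acalls; elim: S => //= a S IH; rewrite /scalls /=.
    by case: a => -[|q] Ms /=; rewrite IH.
  exists (acalls nq R); rewrite acE [acalls nq Sp]acE -acalls_cat.
  exact: perm_pmap.
exists P'; split=> //; exists Xp, (map kap X2), (souts Sp), (souts (sren kap S2)).
exists (acalls nq Sp), Q'; split=> //.
  apply: sc_trans (sc_sym (sc_nus_fresh (X := Xp) _)) _.
    by move=> a /dl; apply: contra; apply: fnP'.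
  apply: sc_nus; apply: sc_trans sP' _; apply: sc_nus.
  apply: sc_trans (sc_parr _ (sc_calls_perm pQ)) _.
  by apply: sc_trans (sc_parr _ (sc_calls_cat _ _)) (sc_assoc _ _ _).
move=> M; apply: (der_trans model) => M' M'S.
have dM' : der (souts S2) (mren sigma M').
  by apply: dS; rewrite souts_sren map_f.
have := der_ren model injk dM'; rewrite mren_comp souts_sren.
rewrite (_ : mren (kap \o sigma) M' = M') // -[RHS]mren_id; apply: mren_ext => a aM /=.
by rewrite kapK // mem_cat; apply/orP; right; apply: names_souts; apply/namesP; exists M'.
Qed.

(** Inclusion has to be tested only on processes without restrictions: a member of the first
    denotation lies below the bare atoms of some instance, its binders suitably named, and such bare
    atoms are themselves members because their names can be captured. The set [B] records which free
    names of the first limit are rigid. *)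
Lemma den_inclusion (l1 l2 : lim) :
  (forall P, den der l1 P -> den der l2 P) <->
  (forall B, {subset B <= tfn (tlim l1)} -> prunable B (tlim l1) ->
     forall X S, flat (prune B (tlim l1)) id X S -> uniq X ->
       (forall x, x \in X -> x \notin B) -> covered (tlim l2) S).
Proof.
set t1 := tlim l1; set t2 := tlim l2; split=> h.
  move=> B sB pB X S f uX dX.
  have [P1 iP1 fP1] := flat_inst.1 _ _ _ _ (flat_prune f).
  (* All restrictions are stripped, so the binder names [X] are free in this process. *)
  pose P : proc := PPar (outs nq (souts S)) (calls (acalls nq S)).
  pose Sp := satoms (souts S) (acalls nq S).
  have pS : perm_eq S Sp by apply: satoms_perm; apply: flat_proc_valid fP1.
  have fP : flat (tproc P) id [::] Sp.
    by have := std_flat (souts S) (acalls nq S) id; rewrite (@sren_idE _ _ id).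
  apply: (covered_below model) (below_perm model pS) _.
  apply: (den_covered fP) => //; apply: h; apply: (covered_den fP) => //.
  apply: (covered_below model) (below_perm model _) _; first by rewrite perm_sym; apply: pS.
  pose big := ubound (X ++ B ++ tfn t1).
  have ltbig a : a \in X ++ B ++ tfn t1 -> a < big by apply: ltn_ubound.
  (* The names in [X] may coincide with free names of [t1] outside [B], but the binder names that
     witness coverage must avoid all of [tfn t1]. *)
  pose pi a := if a \in X then a + big else a.
  have inj : {in X ++ B &, injective pi}.
    move=> a c aN cN; have := ltbig a; have := ltbig c.
    rewrite catA !(mem_cat _ _ (tfn t1)) aN cN => /(_ isT) lc /(_ isT) la.
    rewrite /pi; case: ifP => _; case: ifP => _ // e.
    - exact: addIn e.
    - by move: lc; rewrite -e ltnNge leq_addl.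
    - by move: la; rewrite e ltnNge leq_addl.
  have piB a : a \in B -> pi a = a.
    by rewrite /pi; case: ifP => // /dX/negbTE->.
  exists B; split=> //; exists (map pi X), (sren pi S); split.
  - by apply: flat_ren_fix f _ => a /(tfn_prune pB)/piB.
  - rewrite map_inj_in_uniq // => a c aX cX; apply: inj; by rewrite mem_cat ?aX ?cX.
  - move=> _ /mapP[a aX ->]; rewrite /pi aX; apply/negP => at1.
    by have := ltbig (a + big); rewrite !mem_cat at1 !orbT => /(_ isT); rewrite ltnNge leq_addl.
  - apply: (emb_in (s := X ++ B) (sigma := pi)) => //.
    + by move=> a aB; rewrite mem_cat aB orbT.
    + by move=> a /(flat_names f); rewrite map_id !mem_cat => /orP[->//|/(tfn_prune pB)->]; rewrite orbT.
    + exact: (below_perm model).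
move=> P dP; have [Xp [Sp [fP uXp dXp]]] := flat_proc_fresh P (fn P ++ tfn t1 ++ tfn t2).
have d1 a : a \in Xp -> a \notin fn P.
  by move/dXp; rewrite !mem_cat !negb_or => /and3P[].
have d2 a : a \in Xp -> a \notin tfn t1.
  by move/dXp; rewrite !mem_cat !negb_or => /and3P[].
have d3 a : a \in Xp -> a \notin tfn t2.
  by move/dXp; rewrite !mem_cat !negb_or => /and3P[].
have [B [sB pB [X1 [S1 [f1 u1 dX1 [sigma [inj fx b]]]]]]] := den_covered fP uXp d1 d2 dP.
apply: (covered_den fP) => //.
pose N := B ++ snames Sp; pose kap := ren_inv sigma N.
have injk : injective kap by apply: ren_inv_inj.
have kapK a : a \in N -> kap (sigma a) = a by apply: ren_invK; apply: in2W.
have kapB a : a \in B -> kap a = a.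
  by move=> aB; rewrite -{1}(fx a aB) kapK // mem_cat aB.
apply: (covered_below model (S' := sren kap S1)); last first.
  apply: (h B sB pB (map kap X1)).
  - by apply: flat_ren_fix f1 _ => a /(tfn_prune pB)/kapB.
  - by rewrite map_inj_uniq.
  - move=> _ /mapP[x xX ->]; apply/negP => kB; have /injk e := kapB _ kB.
    by rewrite e in kB; have /negP[] := dX1 x xX; apply: sB.
have := below_ren model injk b; rewrite sren_comp (@sren_idE _ _ (kap \o sigma)) //.
by move=> a aS /=; rewrite kapK // mem_cat aS orbT.
Qed.
End Model.
End Denotation.

(** * The decision procedure *)

(** A finite renaming as first-order data, so that programs can enumerate it and apply it. *)
Definition rfun (e : seq nat * seq nat) (a : nat) : nat :=
  if a \in e.1 then nth 0 e.2 (index a e.1) else a.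

Section Decision.
Variables (nc : nat) (ar : nat -> nat).
Notation msg := (Defs.msg nc ar).
Notation atom := (nat * seq msg)%type.
Notation tmpl := (tmpl nc ar).
Implicit Types (S : seq atom) (X A B : seq nat) (rho sigma : nat -> nat) (t u : tmpl).
Variable der : seq msg -> msg -> Prop.
Hypothesis model : intruder_model der.
Variable derb : seq msg -> msg -> bool.
Hypothesis derP : forall G M, reflect (der G M) (derb G M).
Notation below := (below der).
Notation covered := (covered der).
Notation emb := (emb der).

(** The inner test says that one multiplicity is at most the other: [n] is missing from [iota 0 m]
    exactly when [m <= n]. This form uses only operations already shown computable. *)
Definition belowb S S' :=
  all (derb (souts S')) (souts S) &&
  all (fun a => ~~ has (fun n => n == count_mem a (scalls S'))
                  (iota 0 (count_mem a (scalls S)))) (scalls S).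

Lemma belowbP S S' : reflect (below S S') (belowb S S').
Proof.
have e (m n : nat) : ~~ has (fun k => k == n) (iota 0 m) = (m <= n).
  rewrite (eq_has (a2 := pred1 n)) // has_pred1 mem_iota /= add0n; lia.
apply: (iffP andP) => [[/allP d /allP m]|[d m]]; split.
- by move=> M /d/derP.
- move=> a; have [/m|/count_memPn->//] := boolP (a \in scalls S); by rewrite e.
- by apply/allP => M /d/derP.
- by apply/allP => a _; rewrite e.
Qed.

(** The unfolding depth exceeds the number of name occurrences and calls of [S], as [shrink]
    demands. Fresh binder names matter only up to renaming, so an interval is fixed for them; the
    embedding takes values in it, in [A], or among spare names, one for each entry of [ns]. *)
Definition checkA t S A : bool :=
  let u := full (size (snames S) + size (scalls S)).+1 (prune A t) in
  let X := iota (ubound (tfn t)) (nbind u) in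
  let S2 := atoms u id X in
  let ns := snames S ++ A in
  prunable A t &&
  has (fun vs => let sigma := rfun (ns, vs) in
      [&& all (fun a => all (fun b => ~~ (sigma a == sigma b) || (a == b)) ns) ns,
          all (fun a => sigma a == a) A
        & belowb (sren sigma S) S2])
    (tuples (size ns) (X ++ A ++ iota (ubound (X ++ A)) (size ns))).

Definition check t S : bool := has (checkA t S) (sublists (tfn t)).

Lemma check_covered t S : check t S -> covered t S.
Proof.
case/hasP=> A /sublists_subset sA /andP[pA /hasP[vs _ /and3P[/allP inj /allP fx /belowbP b]]].
exists A; split=> //; move: b; set u := full _ _; set X := iota _ _ => b.
exists X, (atoms u id X); split.
- by apply: (@flat_full _ _ (size (snames S) + size (scalls S)).+1); apply: flat_atoms;
    rewrite ?omfree_full ?size_iota.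
- exact: iota_uniq.
- move=> x; rewrite mem_iota => /andP[le _]; apply/negP => /ltn_ubound.
  by rewrite ltnNge le.
apply: (emb_in (s := snames S ++ A)) b.
- by move=> a aA; rewrite mem_cat aA orbT.
- by move=> a aS; rewrite mem_cat aS.
- move=> a c aN cN e; have /allP/(_ c cN) := inj a aN.
  by rewrite e eqxx => /eqP.
- by move=> a /fx/eqP.
Qed.

Lemma prunable_eq B B' t : B =i B' -> prunable B t = prunable B' t.
Proof. by move=> e; apply: eq_all => a; apply: e. Qed.

Lemma prune_eq B B' t : B =i B' -> prune B t = prune B' t.
Proof.
elim: t B B' => //= [t1 IH1 t2 IH2|t IH|t IH|x t IH] B B' e.
- by rewrite (IH1 _ _ e) (IH2 _ _ e).
- by rewrite (IH _ _ e).
- by rewrite (prunable_eq _ e) (IH _ _ e).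
- by congr TNu; apply: IH => a; rewrite !inE e.
Qed.

Lemma filter_mem_eq A s : {subset A <= s} -> [seq a <- s | a \in A] =i A.
Proof. by move=> sA a; rewrite mem_filter; case: (boolP (a \in A)) => // /sA->. Qed.

Hypothesis abs : absorbing der.

(** [shrink] is applied with the images of the names and of the calls of [S] as the data to keep.
    The small instance obtained is then moved onto the canonical names, together with the
    embedding. *)
Lemma covered_check t S : covered t S -> check t S.
Proof.
case=> A0 [sA0 pA0 [Xo [So [f0 uo do_ [sig [inj fx0 b0]]]]]].
set A := [seq a <- tfn t | a \in A0].
have eA : A =i A0 by apply: filter_mem_eq.
have pA : prunable A t by rewrite (prunable_eq _ eA).
have f : flat (prune A t) id Xo So by rewrite (prune_eq _ eA).
have sA : {subset A <= tfn t} by move=> a; rewrite mem_filter => /andP[].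
have fx : {in A, sig =1 id} by move=> a; rewrite mem_filter => /andP[/fx0].
apply/hasP; exists A; first exact: filter_sublists.
rewrite /checkA pA /=; set m := (_ + _).+1; set u := full _ _.
set X := iota _ (nbind u); set ns := snames S ++ A.
have tA : {subset map id (tfn (prune A t)) <= A} by rewrite map_id; apply: tfn_prune.
pose T := map sig (snames S).
have [|||||Xs [Ss [fs us avs Ts [mQ nm d]]]] :=
   @shrink _ _ der model abs m (prune A t) id A Xo So T (scalls (sren sig S))
     (Xo ++ A ++ T) f uo tA.
- by move=> a /sA at_; apply/negP => /do_; rewrite at_.
- by case: b0.
- rewrite ltnS scalls_sren size_map leq_add2r.
  rewrite -[X in _ <= X](size_map sig) -size_filter.
  apply: uniq_leq_size; first exact: filter_uniq.
  by move=> x; rewrite mem_filter => /andP[].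
- by move=> a aX; rewrite mem_cat aX.
- by move=> a aA; rewrite !mem_cat aA orbT.
have {}b0 : below (sren sig S) Ss.
  split=> // M MS; apply: (d [::]); last by case: b0 => + _; apply.
    move=> a; rewrite cats0 => aM; rewrite !mem_cat; apply/orP; right; apply/orP; right.
    by rewrite /T -snames_sren; apply: names_souts; apply/namesP; exists M.
  move=> a; rewrite cats0 => aM _.
  by rewrite /T -snames_sren; apply: names_souts; apply/namesP; exists M.
have AXs a : a \in A -> a \notin Xs.
  move=> aA; apply/negP => aX; have := avs a aX; rewrite !mem_cat aA orbT => /(_ isT)/do_.
  by rewrite sA.
have [szs eSs] := flat_omfree (omfree_full m (prune A t)) fs; rewrite -/u in szs eSs.
have szX : size Xs = size X by rewrite szs size_iota.
have uX : uniq X by apply: iota_uniq.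
have XA a : a \in A -> a \notin X.
  move=> /sA at_; rewrite mem_iota negb_and -ltnNge; apply/orP; left.
  exact: ltn_ubound.
pose J := ubound (X ++ A); pose L := map sig ns.
have ltJ a : a \in X ++ A -> a < J by apply: ltn_ubound.
(* Binders go to the canonical interval and rigid names stay; any other image becomes a spare name,
   chosen by its position in [L] so that distinct names remain distinct. *)
pose pi c := if c \in Xs then nsubst Xs X c else if c \in A then c else J + index c L.
have piXs c : c \in Xs -> pi c \in X.
  by move=> cX; rewrite /pi cX /nsubst cX mem_nth // -szX index_mem.
have piA c : c \in A -> pi c = c by move=> cA; rewrite /pi (negbTE (AXs c cA)) cA.
have piJ c : c \notin Xs -> c \notin A -> pi c = J + index c L.
  by move=> /negbTE cX /negbTE cA; rewrite /pi cX cA.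
have injpi : {in Xs ++ A ++ L &, injective pi}.
  have lt c : c \in Xs ++ A -> pi c < J.
    by rewrite mem_cat => /orP[/piXs h|cA]; apply: ltJ; rewrite mem_cat ?h // piA // cA orbT.
  have nJ c : c \notin Xs ++ A -> pi c = J + index c L.
    by rewrite mem_cat negb_or => /andP[]; apply: piJ.
  have inL c : c \in Xs ++ A ++ L -> c \notin Xs ++ A -> c \in L.
    by rewrite catA mem_cat => /orP[->|].
  move=> a c aN cN; have [a1|a1] := boolP (a \in Xs ++ A); have [c1|c1] := boolP (c \in Xs ++ A).
  - move: a1 c1; rewrite !mem_cat; have [aX _|aX /= aA] := boolP (a \in Xs);
      have [cX _|cX /= cA] := boolP (c \in Xs).
    + rewrite /pi aX cX => e.
      rewrite -[a](nth_index 0 aX) -[c](nth_index 0 cX); congr nth.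
      move: e; rewrite /nsubst aX cX (set_nth_default c) -?szX ?index_mem // => /eqP.
      by rewrite nth_uniq -?szX ?index_mem // => /eqP.
    + by move=> e; have := piXs a aX; rewrite e piA // => /negP; case; apply/negP: (XA c cA).
    + by move=> e; have := piXs c cX; rewrite -e piA // => /negP; case; apply/negP: (XA a aA).
    + by rewrite !piA.
  - by move=> e; have := lt a a1; rewrite e nJ // ltnNge leq_addr.
  - by move=> e; have := lt c c1; rewrite -e nJ // ltnNge leq_addr.
  - rewrite !nJ // => /addnI e; rewrite -[a](nth_index 0 (inL a aN a1)) e.
    by rewrite nth_index // inL.
have eS2 : atoms u id X = sren pi Ss.
  have fu : flat u id X (atoms u id X) by apply: flat_atoms; rewrite ?omfree_full ?size_iota.
  apply: (flat_det_ren (omfree_full m (prune A t)) fs fu).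
    rewrite -[RHS](map_nsubst us szX); apply/eq_in_map => c cX.
    by rewrite /pi cX.
  move=> a /tfn_full at_; apply: piA; apply: tA; rewrite map_id //.
pose vs := map (pi \o sig) ns.
have lkE a : a \in ns -> rfun (ns, vs) a = pi (sig a).
  move=> aN; rewrite /rfun /= aN /vs (nth_map 0) ?index_mem //= nth_index //.
apply/hasP; exists vs.
  apply/tuplesP; split; first by rewrite size_map.
  move=> _ /mapP[a aN ->] /=; rewrite !mem_cat.
  have [/piXs->//|aX] := boolP (sig a \in Xs).
  have [aA|aA] := boolP (sig a \in A); first by rewrite piA // aA orbT.
  rewrite piJ // mem_iota leq_addr ltn_add2l.
  have -> : index (sig a) L < size ns by rewrite -(size_map sig) index_mem map_f.
  by rewrite !orbT.
have inL a : a \in ns -> sig a \in Xs ++ A ++ L.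
  by move=> aN; rewrite !mem_cat map_f ?orbT.
apply/and3P; split.
- apply/allP => a aN; apply/allP => c cN; rewrite !lkE //.
  case: eqP => //= /injpi e; apply/eqP; apply: inj; apply: e; exact: inL.
- by apply/allP => a aA; rewrite lkE ?fx ?piA // mem_cat aA orbT.
apply/belowbP; rewrite eS2 (@sren_ext _ _ _ (pi \o sig)); last first.
  by move=> a aS; rewrite lkE // mem_cat aS.
rewrite -sren_comp; apply: (below_ren_in model) b0.
have sub a : a \in snames (sren sig S) ++ snames Ss -> a \in Xs ++ A ++ L.
  rewrite mem_cat snames_sren => /orP[/mapP[c cS ->]|/nm].
    by apply: inL; rewrite mem_cat cS.
  by rewrite !mem_cat => /orP[]->; rewrite ?orbT.
by move=> a c /sub aN /sub cN; apply: injpi.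
Qed.

Lemma checkP t S : reflect (covered t S) (check t S).
Proof. by apply: (iffP idP); [apply: check_covered|apply: covered_check]. Qed.

(** * Eliminating the replications of the first limit *)

Fixpoint odepth t : nat :=
  match t with
  | TPar t1 t2 => maxn (odepth t1) (odepth t2)
  | TId t | TNu _ t => odepth t
  | TOm t => (odepth t).+1
  | _ => 0
  end.

Fixpoint ocount t : nat :=
  match t with
  | TPar t1 t2 => ocount t1 + ocount t2
  | TId t | TNu _ t => ocount t
  | TOm t => (ocount t).+1
  | _ => 0
  end.

Lemma odepth_ocount t : odepth t <= ocount t.
Proof. by elim: t => //= t1 IH1 t2 IH2; rewrite geq_max; lia. Qed.

Lemma odepth_copies k t : odepth (copies k t) <= odepth t.
Proof. by elim: k => //= k IHk; rewrite geq_max leqnn. Qed.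

Lemma odepth_unf k t : odepth (unf k t) <= (odepth t).-1.
Proof.
elim: t => //= [t1 IH1 t2 IH2|t _]; last exact: odepth_copies.
by rewrite geq_max; lia.
Qed.

Lemma odepth0 t : odepth t = 0 -> omfree t.
Proof.
elim: t => //= t1 IH1 t2 IH2 e.
by rewrite IH1 ?IH2 //; apply/eqP; rewrite -leqn0 -e ?leq_maxl ?leq_maxr.
Qed.

Lemma tfn_unf k t : {subset tfn (unf k t) <= tfn t}.
Proof.
elim: t => /=; try by move=> *.
- by move=> t1 IH1 t2 IH2 a; rewrite !mem_cat => /orP[/IH1|/IH2] ->; rewrite ?orbT.
- by move=> t _ a /tfn_copies.
- by move=> x t IHt a; rewrite !mem_filter => /andP[-> /IHt].
Qed.

Definition unfold_step t2 (b : nat) u := unf (nunf u t2 b) u.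
(** Each round removes a level of nesting and computes its number of copies from the template
    reached so far. The number of replications is at least the depth, and surplus rounds change
    nothing. *)
Definition unfold_all t2 (b : nat) t := iter (ocount t) (unfold_step t2 b) t.

Lemma odepth_iter t2 b d t : odepth (iter d (unfold_step t2 b) t) <= odepth t - d.
Proof.
elim: d => [|d IHd] /=; first by rewrite subn0.
by apply: leq_trans (odepth_unf _ _) _; lia.
Qed.

Lemma omfree_unfold_all t2 b t : omfree (unfold_all t2 b t).
Proof.
apply: odepth0; have := odepth_iter t2 b (ocount t) t; have := odepth_ocount t.
rewrite /unfold_all; lia.
Qed.

Lemma flat_iter t2 b d t rho X S :
  flat (iter d (unfold_step t2 b) t) rho X S -> flat t rho X S.
Proof. by elim: d => //= d IHd /flat_unf/IHd. Qed.

Lemma tfn_iter t2 b d t : {subset tfn (iter d (unfold_step t2 b) t) <= tfn t}.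
Proof. by elim: d => //= d IHd a /tfn_unf/IHd. Qed.

Lemma pump_iter t2 B d t : {subset tfn t <= B} ->
  (forall X S, flat (iter d (unfold_step t2 (size B)) t) id X S -> uniq X ->
     (forall x, x \in X -> x \notin B) -> covered t2 S) ->
  forall X S, flat t id X S -> uniq X -> (forall x, x \in X -> x \notin B) -> covered t2 S.
Proof.
move=> tB; elim: d => //= d IHd h; apply: IHd; apply: (pump model) h.
by move=> a /tfn_iter/tB.
Qed.

(** Since free names of [t2] can be rigid, a binder that carries one of them is a case of its own;
    other binder names matter only up to renaming. So the tuples range over [tfn t2] and as many
    fresh names as there are binders. *)
Definition decideB t1 t2 B : bool :=
  let u := unfold_all t2 (size B) (prune B t1) in
  ~~ prunable B t1 ||
  all (fun X => [|| ~~ uniq X, has (fun x => x \in B) X | check t2 (atoms u id X)])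
    (tuples (nbind u) (tfn t2 ++ iota (ubound (B ++ tfn t2)) (nbind u))).

Definition decide t1 t2 : bool := all (decideB t1 t2) (sublists (tfn t1)).

Lemma decideP t1 t2 : reflect
  (forall B, {subset B <= tfn t1} -> prunable B t1 ->
     forall X S, flat (prune B t1) id X S -> uniq X ->
       (forall x, x \in X -> x \notin B) -> covered t2 S)
  (decide t1 t2).
Proof.
apply: (iffP allP) => h; last first.
  move=> B Bin; rewrite /decideB; case: (boolP (prunable B t1)) => //= pB.
  apply/allP => X /tuplesP[szX _]; case: (boolP (uniq X)) => //= uX.
  case: (boolP (has _ X)) => //= /hasPn dX; apply/checkP.
  apply: (h B (sublists_subset Bin) pB X) => //; apply: flat_iter.
  by apply: flat_atoms; rewrite ?omfree_unfold_all.
move=> B0 sB0 pB0 X0 S0 f0 u0 d0.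
set B := [seq a <- tfn t1 | a \in B0].
have eB : B =i B0 by apply: filter_mem_eq.
have pB : prunable B t1 by rewrite (prunable_eq _ eB).
rewrite -(prune_eq _ eB) in f0.
have {}d0 x : x \in X0 -> x \notin B by rewrite eB; apply: d0.
have := h B (filter_sublists _ _); rewrite /decideB pB /=.
set u := unfold_all _ _ _ => /allP hu.
have tB : {subset tfn (prune B t1) <= B} by apply: tfn_prune.
move: X0 S0 f0 u0 d0; apply: (@pump_iter t2 B (ocount (prune B t1)) _ tB).
rewrite -/(unfold_all _ _ _) -/u => X S f uX dX.
have of_u : omfree u by apply: omfree_unfold_all.
have [szX _] := flat_omfree of_u f.
pose J := ubound (B ++ tfn t2).
have ltJ a : a \in B ++ tfn t2 -> a < J by apply: ltn_ubound.
(* Binder names outside [tfn t2] move into the enumerated interval by position; as [tfn t2] stays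
   fixed, coverage of the renamed atoms gives coverage of the original ones. *)
pose pi a := if a \in B ++ tfn t2 then a else J + index a X.
have piE a : a \in B ++ tfn t2 -> pi a = a by rewrite /pi => ->.
have injpi : {in X ++ B ++ tfn t2 &, injective pi}.
  have inX c : c \in X ++ B ++ tfn t2 -> c \notin B ++ tfn t2 -> c \in X.
    by rewrite [c \in X ++ _]mem_cat => /orP[//|->].
  move=> a c aN cN; rewrite /pi; case: ifPn => aF; case: ifPn => cF // e.
  - by have := ltJ a aF; rewrite e ltnNge leq_addr.
  - by have := ltJ c cF; rewrite -e ltnNge leq_addr.
  - move/addnI: e => e; rewrite -[a](nth_index 0 (inX a aN aF)) e.
    by rewrite nth_index // inX.
have tu : {subset tfn u <= B} by move=> a /tfn_iter/tB.
have fpi : flat u id (map pi X) (sren pi S).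
  by apply: flat_ren_fix f _ => a /tu aB; apply: piE; rewrite mem_cat aB.
have uX' : uniq (map pi X).
  rewrite map_inj_in_uniq // => a c aX cX; apply: injpi; by rewrite mem_cat ?aX ?cX.
have dX' : ~~ has (fun x => x \in B) (map pi X).
  apply/hasPn => _ /mapP[a aX ->]; rewrite /pi; case: ifPn => _; first exact: dX.
  by apply/negP => h'; have := ltJ (J + index a X); rewrite mem_cat h' ltnNge leq_addr => /(_ isT).
have : covered t2 (sren pi S).
  apply/checkP; have [_ ->] := flat_omfree of_u fpi.
  have := hu (map pi X); rewrite uX' (negbTE dX') /=; apply.
  apply/tuplesP; split; first by rewrite size_map.
  move=> _ /mapP[a aX ->]; rewrite /pi mem_cat (negbTE (dX a aX)) /=.
  case: ifPn => [at2|_]; first by rewrite mem_cat at2.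
  by rewrite mem_cat mem_iota leq_addr ltn_add2l -szX index_mem aX orbT.
move=> [A [sA pA [X2 [S2 [f2 u2 d2 e]]]]]; exists A; split=> //; exists X2, S2; split=> //.
apply: (@emb_ren _ _ der A S S2 (inj_ext (X ++ B ++ tfn t2) pi)).
- exact: inj_ext_inj.
- move=> a /sA at2; rewrite inj_extE; last by rewrite !mem_cat at2 !orbT.
  by apply: piE; rewrite mem_cat at2 orbT.
rewrite (@sren_ext _ _ _ pi) // => a /(flat_names f); rewrite map_id mem_cat => aN.
apply: inj_extE; rewrite !mem_cat.
by case/orP: aN => [->//|/tu->]; rewrite orbT.
Qed.
End Decision.

(** * Computability of the decision procedure *)

Lemma comp_iota G (cG : coded G) (m n : G -> nat) :
  computable m -> computable n -> computable (fun g => iota (m g) (n g)).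
Proof.
move=> hm hn; apply: (comp_ext (f := fun g =>
  nat_rect (fun _ => seq nat) [::] (fun k s => s ++ [:: m g + k]) (n g))).
  by move=> g; elim: (n g) => // k IHk; rewrite -[in RHS](addn1 k) iotaD -IHk.
by apply: comp_nrec; comp_tac.
Qed.

Lemma comp_ubound G (cG : coded G) (s : G -> seq nat) :
  computable s -> computable (fun g => ubound (s g)).
Proof.
move=> hs; apply: (comp_ext (f := fun g => (foldr (fun a n => a + (n - a)) 0 (s g)).+1)).
  move=> g; rewrite /ubound; congr S; elim: (s g) => [|a t IH]; rewrite ?big_nil //.
  by rewrite big_cons /= IH maxnE.
by comp_tac; apply: comp_subn; comp_tac.
Qed.

Lemma comp_rfun G (cG : coded G) (e : G -> seq nat * seq nat) (a : G -> nat) :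
  computable e -> computable a -> computable (fun g => rfun (e g) (a g)).
Proof. by move=> he ha; rewrite /rfun; comp_tac. Qed.

Section TreeSimple.
Variables (P B : Type) (leaf : P -> nat -> B) (node : P -> nat -> seq B -> B).

Lemma tfold_node p f ts :
  tfold leaf (fun p _ _ => p) node p (GenTree.Node f ts) =
  node p f (rev [seq tfold leaf (fun p _ _ => p) node p t | t <- ts]).
Proof.
congr node; rewrite -/(tfold _ _ _) -[rev _]cats0.
elim: ts [::] => //= t ts IHts acc; rewrite IHts rev_cons cat_rcons //.
Qed.
End TreeSimple.

Section Computability.
Variables (nc : nat) (ar : nat -> nat).
Notation msg := (Defs.msg nc ar).
Notation atom := (nat * seq msg)%type.
Notation tmpl := (tmpl nc ar).
Notation tree := (GenTree.tree nat).

#[global] Instance coded_msg : coded msg := pickle.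

Lemma comp_val G (cG : coded G) (M : G -> msg) :
  computable M -> computable (fun g => val (M g)).
Proof. by case=> p hp; exists p. Qed.

Lemma comp_of_val G (cG : coded G) (M : G -> msg) :
  computable (fun g => val (M g)) -> computable M.
Proof. by case=> p hp; exists p. Qed.

(** Only arities below [nc] are consulted; the table [mkseq ar nc] of these is a constant of the
    program, so [ar] may be an arbitrary function. *)
Lemma comp_wf_term G (cG : coded G) (t : G -> tree) :
  computable t -> computable (fun g => wf_term nc ar (t g)).
Proof.
move=> ht; pose node (_ f : nat) (acc : seq bool) :=
  [&& f \in iota 0 nc, size acc == nth 0 (mkseq ar nc) f & all (fun b => b) acc].
apply: (comp_ext (f := fun g => tfold (fun _ _ => true) (fun p _ _ => p) node 0 (t g))).
  move=> g; elim: (t g) => // f ts IHt; rewrite tfold_node /node /= mem_iota add0n.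
  case: (ltnP f nc) => //= ltf; rewrite nth_mkseq // size_rev size_map all_rev all_map.
  congr (_ && _); elim: ts IHt => //= t' ts IHts [-> /IHts->] //.
by apply: comp_tfold; rewrite /node; comp_tac.
Qed.

Definition to_msg (t : tree) : msg := insubd (mname nc ar 0) t.

Lemma to_msgK : cancel val to_msg.
Proof. exact: valKd. Qed.

Lemma comp_to_msg G (cG : coded G) (t : G -> tree) :
  computable t -> computable (fun g => to_msg (t g)).
Proof.
move=> ht; apply: comp_of_val.
apply: (comp_ext (f := fun g => if wf_term nc ar (t g) then t g else GenTree.Leaf 0)).
  by move=> g; rewrite val_insubd.
by comp_tac; apply: comp_wf_term.
Qed.

Lemma comp_mren G (cG : coded G) (e : G -> seq nat * seq nat) (M : G -> msg) :
  computable e -> computable M -> computable (fun g => mren (rfun (e g)) (M g)).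
Proof.
move=> he hM; apply: comp_of_val.
pose leaf (e : seq nat * seq nat) x := GenTree.Leaf (rfun e x).
pose node (_ : seq nat * seq nat) (f : nat) (acc : seq tree) := GenTree.Node f (rev acc).
apply: (comp_ext (f := fun g => tfold leaf (fun p _ _ => p) node (e g) (val (M g)))).
  move=> g; rewrite val_mren; elim: (val _) => // f ts IHt.
  rewrite tfold_node /node revK /=; congr GenTree.Node.
  by elim: ts IHt => //= t' ts IHts [-> /IHts->].
apply: comp_tfold; rewrite /leaf /node; comp_tac.
- by apply: comp_leaf; apply: comp_rfun; comp_tac.
- by apply: comp_node; comp_tac.
Qed.

Lemma comp_names G (cG : coded G) (Ms : G -> seq msg) :
  computable Ms -> computable (fun g => names (Ms g)).
Proof.
move=> hM; have hm : computable (fun M : msg => mnames M).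
  pose node (_ f : nat) (acc : seq (seq nat)) := flatten (rev acc).
  apply: (comp_ext (f := fun M : msg =>
      tfold (fun _ x => [:: x]) (fun p _ _ => p) node 0 (val M))).
    move=> M; rewrite /mnames; elim: (val _) => // f ts IHt.
    rewrite tfold_node /node revK /=; congr flatten.
    by elim: ts IHt => //= t' ts IHts [-> /IHts->].
  by apply: comp_tfold; rewrite /node; comp_tac; apply: comp_val; comp_tac.
by rewrite /names; comp_tac.
Qed.

Fixpoint enc_tmpl (t : tmpl) : tree :=
  match t with
  | T0 => GenTree.Node 0 [::]
  | TPar t1 t2 => GenTree.Node 1 [:: enc_tmpl t1; enc_tmpl t2]
  | TId t => GenTree.Node 2 [:: enc_tmpl t]
  | TOm t => GenTree.Node 3 [:: enc_tmpl t]
  | TOut M => GenTree.Node 4 [:: val M]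
  | TCall q Ms => GenTree.Node 5 (GenTree.Leaf q :: map val Ms)
  | TNu x t => GenTree.Node 6 [:: GenTree.Leaf x; enc_tmpl t]
  end.

#[global] Instance coded_tmpl : coded tmpl := fun t => code (enc_tmpl t).

Lemma comp_enc G (cG : coded G) (t : G -> tmpl) :
  computable t -> computable (fun g => enc_tmpl (t g)).
Proof. by case=> p hp; exists p. Qed.

Lemma comp_of_enc G (cG : coded G) (t : G -> tmpl) :
  computable (fun g => enc_tmpl (t g)) -> computable t.
Proof. by case=> p hp; exists p. Qed.

Lemma comp_TPar G (cG : coded G) (t1 t2 : G -> tmpl) :
  computable t1 -> computable t2 -> computable (fun g => TPar (t1 g) (t2 g)).
Proof.
move=> h1 h2; apply: comp_of_enc => /=.
by apply: comp_node; comp_tac; apply: comp_enc.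
Qed.

Lemma comp_TId G (cG : coded G) (t : G -> tmpl) :
  computable t -> computable (fun g => TId (t g)).
Proof.
move=> h1; apply: comp_of_enc => /=.
by apply: comp_node; comp_tac; apply: comp_enc.
Qed.

Lemma comp_TOm G (cG : coded G) (t : G -> tmpl) :
  computable t -> computable (fun g => TOm (t g)).
Proof.
move=> h1; apply: comp_of_enc => /=.
by apply: comp_node; comp_tac; apply: comp_enc.
Qed.

Lemma comp_TOut G (cG : coded G) (M : G -> msg) :
  computable M -> computable (fun g => TOut (M g)).
Proof.
move=> h1; apply: comp_of_enc => /=.
by apply: comp_node; comp_tac; apply: comp_val.
Qed.

Lemma comp_TCall G (cG : coded G) (q : G -> nat) (Ms : G -> seq msg) :
  computable q -> computable Ms -> computable (fun g => TCall (q g) (Ms g)).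
Proof.
move=> h1 h2; apply: comp_of_enc => /=.
apply: comp_node; comp_tac; first exact: comp_leaf.
by apply: comp_val; comp_tac.
Qed.

Lemma comp_TNu G (cG : coded G) (x : G -> nat) (t : G -> tmpl) :
  computable x -> computable t -> computable (fun g => TNu (x g) (t g)).
Proof.
move=> h1 h2; apply: comp_of_enc => /=.
by apply: comp_node; comp_tac; apply: comp_leaf.
Qed.

Section Recursion.
Variables (P B : Type) (cP : coded P) (cB : coded B).
Variables (a0 : P -> B) (apar : P -> B -> B -> B) (aid : P -> B -> B) (aom : P -> B -> B)
  (aout : P -> msg -> B) (acl : P -> nat -> seq msg -> B) (anu : P -> nat -> B -> B)
  (dpar : P -> B -> P) (dnu : P -> nat -> P).

(** The parameter for a right component may depend on the value of the left one: computing [atoms]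
    this way lets the left component pass on the binder names that it has not consumed. *)
Fixpoint trec (p : P) (t : tmpl) : B :=
  match t with
  | T0 => a0 p
  | TPar t1 t2 => let r1 := trec p t1 in apar p r1 (trec (dpar p r1) t2)
  | TId t => aid p (trec p t)
  | TOm t => aom p (trec p t)
  | TOut M => aout p M
  | TCall q Ms => acl p q Ms
  | TNu x t => anu p x (trec (dnu p x) t)
  end.

(* The fold also rebuilds the trees, as messages are needed as such, and
   returns the labels of leaves, for the arguments of binders and calls. *)
Notation res := (tree * (nat * B))%type.

Definition trec_value (p : P) (f : nat) (acc : seq res) : B :=
  nth (a0 p)
   [:: a0 p;
       if acc is r2 :: l then if l is r1 :: _ then apar p r1.2.2 r2.2.2 else a0 p else a0 p;
       if acc is r :: _ then aid p r.2.2 else a0 p;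
       if acc is r :: _ then aom p r.2.2 else a0 p;
       if acc is r :: _ then aout p (to_msg r.1) else a0 p;
       if rev acc is r :: l then acl p r.2.1 [seq to_msg s.1 | s <- l] else a0 p;
       if acc is r2 :: l then if l is r1 :: _ then anu p r1.2.1 r2.2.2 else a0 p else a0 p] f.

(** The parameter changes only for second children: the right component at label 1, and at label 6
    the body, which follows the leaf with the bound name. *)
Definition trec_down (p : P) (f : nat) (acc : seq res) : P :=
  if acc is r :: _ then nth p [:: p; dpar p r.2.2; p; p; p; p; dnu p r.2.1] f else p.

Definition trec_leaf (p : P) (x : nat) : res := (GenTree.Leaf x, (x, a0 p)).
Definition trec_node (p : P) (f : nat) (acc : seq res) : res :=
  (GenTree.Node f (rev [seq r.1 | r <- acc]), (0, trec_value p f acc)).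

Notation tf := (tfold trec_leaf trec_down trec_node).

Lemma tf_fst p t : (tf p t).1 = t.
Proof.
elim: t p => //= f ts IHt p; congr GenTree.Node.
suff e acc : [seq r.1 | r <- foldl (fun acc h => h (trec_down p f acc) :: acc) acc
    [seq tf^~ t | t <- ts]] = rev ts ++ [seq r.1 | r <- acc] by rewrite e cats0 revK.
elim: ts IHt acc => //= t ts IHts [IHt /IHts{}IHts] acc.
by rewrite IHts /= IHt rev_cons cat_rcons.
Qed.

Lemma tf_enc p t : tf p (enc_tmpl t) = (enc_tmpl t, (0, trec p t)).
Proof.
elim: t p => //=.
- move=> t1 IH1 t2 IH2 p; rewrite /trec_node /trec_value /trec_down /=.
  by rewrite !IH1 /= !IH2.
- by move=> t IH p; rewrite /trec_node /trec_value /trec_down /= !IH.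
- by move=> t IH p; rewrite /trec_node /trec_value /trec_down /= !IH.
- move=> M p; rewrite /trec_node /trec_value /= !tf_fst to_msgK //.
- move=> q Ms p; have := tf_fst p (GenTree.Node 5 (GenTree.Leaf q :: map val Ms)).
  rewrite /= => -[e]; rewrite /trec_node e; congr (_, (_, _)).
  move: e; set acc := foldl _ _ _ => e; rewrite /trec_value /=.
  have [l el] : exists l, acc = l ++ [:: trec_leaf p q].
    rewrite /acc; elim: (map _ _) [:: _] => [|h hs IH] acc0 /=; first by exists [::].
    have [l ->] := IH (h (trec_down p 5 acc0) :: acc0).
    by exists (rcons l (h (trec_down p 5 acc0))); rewrite cat_rcons.
  rewrite el rev_cat /=; move: e; rewrite el map_cat rev_cat /= => -[e].
  by rewrite (map_comp to_msg) map_rev e -map_comp map_id_in // => M _ /=; rewrite to_msgK.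
- move=> x t IH p; rewrite /trec_node /trec_value /trec_down /=.
  by rewrite !IH.
Qed.

Lemma comp_trec G (cG : coded G) (p : G -> P) (t : G -> tmpl) :
  computable a0 -> computable (fun u : P * B * B => apar u.1.1 u.1.2 u.2) ->
  computable (fun u : P * B => aid u.1 u.2) -> computable (fun u : P * B => aom u.1 u.2) ->
  computable (fun u : P * msg => aout u.1 u.2) ->
  computable (fun u : P * nat * seq msg => acl u.1.1 u.1.2 u.2) ->
  computable (fun u : P * nat * B => anu u.1.1 u.1.2 u.2) ->
  computable (fun u : P * B => dpar u.1 u.2) -> computable (fun u : P * nat => dnu u.1 u.2) ->
  computable p -> computable t -> computable (fun g => trec (p g) (t g)).
Proof.
move=> h0 hpar hid hom hout hcl hnu hdpar hdnu hp ht.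
apply: (comp_ext (f := fun g => (tf (p g) (enc_tmpl (t g))).2.2)).
  by move=> g; rewrite tf_enc.
have hm := comp_to_msg (@comp_id tree _).
do 2!apply: comp_snd; apply: comp_tfold => //.
- by rewrite /trec_leaf; comp_tac; apply: comp_leaf; comp_tac.
- by rewrite /trec_down; comp_tac.
- rewrite /trec_node /trec_value; comp_tac.
  by apply: comp_node; comp_tac.
Qed.
End Recursion.
End Computability.

Section Functions.
Variables (nc : nat) (ar : nat -> nat).
Notation msg := (Defs.msg nc ar).
Notation atom := (nat * seq msg)%type.
Notation tmpl := (tmpl nc ar).
Notation T0 := (T0 nc ar).

Ltac comp_user ::= first [comp_lists | match goal with
  | |- computable (fun u => iota _ _) => apply: comp_iota
  | |- computable (fun u => ubound _) => apply: comp_ubound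
  | |- computable (fun u => names _) => apply: comp_names
  | |- computable (fun u => subn _ _) => apply: comp_subn
  | |- computable (fun u => mren (rfun _) _) => apply: comp_mren
  | |- computable (fun u => rfun _ _) => apply: comp_rfun
  | |- computable (fun u => tuples _ _) => apply: comp_tuples
  | |- computable (fun u => sublists _) => apply: comp_sublists
  | |- computable (fun u => TPar _ _) => apply: comp_TPar
  | |- computable (fun u => TId _) => apply: comp_TId
  | |- computable (fun u => TOm _) => apply: comp_TOm
  | |- computable (fun u => TOut _) => apply: comp_TOut
  | |- computable (fun u => TCall _ _) => apply: comp_TCall
  | |- computable (fun u => TNu _ _) => apply: comp_TNu
  end].

Lemma comp_tfn G (cG : coded G) (t : G -> tmpl) :
  computable t -> computable (fun g => tfn (t g)).
Proof.
move=> ht; apply: (comp_ext (f := fun g => trec (fun _ : nat => [::]) (fun _ a b => a ++ b)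
  (fun _ a => a) (fun _ a => a) (fun _ M => names [:: M]) (fun _ _ Ms => names Ms)
  (fun _ x s => [seq a <- s | a != x]) (fun p _ => p) (fun p _ => p) 0 (t g))).
  by move=> g; elim: (t g) => //= [t1 -> t2 -> | x u ->].
by apply: comp_trec; comp_tac.
Qed.

Lemma comp_kbound G (cG : coded G) (t : G -> tmpl) (c : G -> nat) :
  computable t -> computable c -> computable (fun g => kbound (t g) (c g)).
Proof.
move=> ht hc; apply: (comp_ext (f := fun g => trec (fun _ : nat => 0) (fun _ a b => a + b)
  (fun _ a => a) (fun c a => c * a) (fun _ _ => 0) (fun _ _ _ => 1)
  (fun _ _ n => n.+1) (fun p _ => p) (fun p _ => p) (c g) (t g))).
  by move=> g; elim: (t g) => //= [t1 -> t2 -> | u -> | x u ->].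
by apply: comp_trec; comp_tac.
Qed.

Lemma comp_nbind G (cG : coded G) (t : G -> tmpl) :
  computable t -> computable (fun g => nbind (t g)).
Proof.
move=> ht; apply: (comp_ext (f := fun g => trec (fun _ : nat => 0) (fun _ a b => a + b)
  (fun _ a => a) (fun c a => 0) (fun _ _ => 0) (fun _ _ _ => 0)
  (fun _ _ n => n.+1) (fun p _ => p) (fun p _ => p) 0 (t g))).
  by move=> g; elim: (t g) => //= [t1 -> t2 -> | x u ->].
by apply: comp_trec; comp_tac.
Qed.

Lemma comp_ocount G (cG : coded G) (t : G -> tmpl) :
  computable t -> computable (fun g => ocount (t g)).
Proof.
move=> ht; apply: (comp_ext (f := fun g => trec (fun _ : nat => 0) (fun _ a b => a + b)
  (fun _ a => a) (fun c a => a.+1) (fun _ _ => 0) (fun _ _ _ => 0)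
  (fun _ _ n => n) (fun p _ => p) (fun p _ => p) 0 (t g))).
  by move=> g; elim: (t g) => //= [t1 -> t2 -> | u ->].
by apply: comp_trec; comp_tac.
Qed.

Lemma comp_copies G (cG : coded G) (k : G -> nat) (t : G -> tmpl) :
  computable k -> computable t -> computable (fun g => copies (k g) (t g)).
Proof. by move=> hk ht; rewrite /copies; comp_tac. Qed.

Lemma comp_full G (cG : coded G) (m : G -> nat) (t : G -> tmpl) :
  computable m -> computable t -> computable (fun g => full (m g) (t g)).
Proof.
move=> hm ht; apply: (comp_ext (f := fun g => trec (fun _ : nat => T0)
  (fun _ a b => TPar a b) (fun _ a => TId a) (fun m a => copies m a) (fun _ M => TOut M)
  (fun _ q Ms => TCall q Ms) (fun _ x a => TNu x a) (fun p _ => p) (fun p _ => p) (m g) (t g))).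
  by move=> g; elim: (t g) => //= [t1 -> t2 -> | u -> | u -> | x u ->].
by apply: comp_trec; comp_tac; apply: comp_copies; comp_tac.
Qed.

(** [unf] copies the body of a replication unprocessed, while the recursion offers only values of
    the components; so the template is rebuilt alongside. *)
Lemma comp_unf G (cG : coded G) (m : G -> nat) (t : G -> tmpl) :
  computable m -> computable t -> computable (fun g => unf (m g) (t g)).
Proof.
move=> hm ht; apply: (comp_ext (f := fun g => (trec (fun _ : nat => (T0, T0))
  (fun _ a b => (TPar a.1 b.1, TPar a.2 b.2)) (fun _ a => (TId a.1, TId a.2))
  (fun m a => (TOm a.1, copies m a.1)) (fun _ M => (TOut M, TOut M))
  (fun _ q Ms => (TCall q Ms, TCall q Ms)) (fun _ x a => (TNu x a.1, TNu x a.2))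
  (fun p _ => p) (fun p _ => p) (m g) (t g)).2)).
  move=> g; set r := trec _ _ _ _ _ _ _ _ _ _; suff -> : r (t g) = (t g, unf (m g) (t g)) by [].
  by rewrite /r; elim: (t g) => //= [t1 -> t2 -> | u -> | u -> | x u ->].
by apply: comp_snd; apply: comp_trec; comp_tac; apply: comp_copies; comp_tac.
Qed.

(** Computed together, since whether [prune] keeps a replication depends on the [need] of its
    body. *)
Lemma comp_need_prune G (cG : coded G) (B : G -> seq nat) (t : G -> tmpl) :
  computable B -> computable t -> computable (fun g => (need (t g), prune (B g) (t g))).
Proof.
move=> hB ht; apply: (comp_ext (f := fun g => trec (fun _ : seq nat => ([::], T0))
  (fun _ a b => (a.1 ++ b.1, TPar a.2 b.2)) (fun _ a => (a.1, TId a.2))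
  (fun B a => ([::], if all (fun x => x \in B) a.1 then TOm a.2 else T0))
  (fun _ M => (names [:: M], TOut M))
  (fun _ q Ms => (names Ms, TCall q Ms))
  (fun _ x a => ([seq y <- a.1 | y != x], TNu x a.2))
  (fun p _ => p) (fun p x => x :: p) (B g) (t g))).
  move=> g; elim: (t g) (B g) => //= [t1 IH1 t2 IH2|u IH|u IH|x u IH] p.
  - by rewrite IH1 IH2.
  - by rewrite IH.
  - by rewrite IH.
  - by rewrite IH.
by apply: comp_trec; comp_tac.
Qed.

Lemma comp_prunable G (cG : coded G) (B : G -> seq nat) (t : G -> tmpl) :
  computable B -> computable t -> computable (fun g => prunable (B g) (t g)).
Proof.
move=> hB ht; apply: (comp_ext (f := fun g =>
  all (fun x => x \in B g) (need (t g), prune (B g) (t g)).1)) => //.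
have h := comp_need_prune hB ht.
by apply: comp_all; [exact: comp_fst h | comp_tac].
Qed.

Lemma comp_prune G (cG : coded G) (B : G -> seq nat) (t : G -> tmpl) :
  computable B -> computable t -> computable (fun g => prune (B g) (t g)).
Proof. by move=> hB ht; have := comp_snd (comp_need_prune hB ht). Qed.

Lemma rfun_cons x xs b bs : rfun (x :: xs, b :: bs) =1 upd (rfun (xs, bs)) x b.
Proof.
move=> a; rewrite /rfun /upd /= inE eq_sym.
by case: (x =P a).
Qed.

Lemma atoms_ext (u : tmpl) rho rho' X : rho =1 rho' -> atoms u rho X = atoms u rho' X.
Proof.
elim: u rho rho' X => //= [t1 IH1 t2 IH2|M|q Ms|x t IH] rho rho' X e.
- by rewrite (IH1 rho rho') // (IH2 rho rho').
- by rewrite (@mren_ext _ _ rho rho').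
- by rewrite (@mren_ext_in _ _ rho rho').
- by apply: IH => a; rewrite /upd e.
Qed.

(** The recursion threads the supply of binder names from left to right and returns what is left
    over, with the environment kept as a pair of lists. It consumes only the first [nbind] names,
    whence the [take]. *)
Lemma comp_atoms G (cG : coded G) (t : G -> tmpl) (X : G -> seq nat) :
  (forall g, nbind (t g) <= size (X g)) -> (forall g, omfree (t g)) ->
  computable t -> computable X ->
  computable (fun g => atoms (t g) id (take (nbind (t g)) (X g))).
Proof.
move=> hs of_t ht hX.
pose E := ((seq nat * seq nat) * seq nat)%type.
pose R := (seq nat * seq atom)%type.
pose hd (X : seq nat) := if X is x :: _ then x else 0.
pose tl (X : seq nat) := if X is _ :: X' then X' else [::].
apply: (comp_ext (f := fun g => (trec (fun p : E => (p.2, [::]) : R)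
  (fun _ a b => (b.1, a.2 ++ b.2)) (fun _ a => a)
  (fun p _ => (p.2, [::]))
  (fun p M => (p.2, [:: (0, [:: mren (rfun p.1) M])]))
  (fun p q Ms => (p.2, [:: (q.+1, map (mren (rfun p.1)) Ms)]))
  (fun _ _ a => a)
  (fun p a => (p.1, a.1)) (fun p x => ((x :: p.1.1, hd p.2 :: p.1.2), tl p.2))
  (([::], [::]), X g) (t g)).2)).
  move=> g; set r := trec _ _ _ _ _ _ _ _ _.
  suff -> : forall u e Y, omfree u -> nbind u <= size Y ->
     r (e, Y) u = (drop (nbind u) Y, atoms u (rfun e) (take (nbind u) Y)).
  - by apply: atoms_ext.
  - exact: of_t.
  - exact: hs.
  elim=> //=.
  - by move=> e Y _ _; rewrite drop0.
  - move=> t1 IH1 t2 IH2 e Y /andP[o1 o2] le; rewrite IH1 //=; last by lia.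
    rewrite IH2 //=; last by rewrite size_drop; lia.
    by rewrite drop_drop take_drop [nbind t2 + _]addnC take_takel ?leq_addr.
  - by move=> M e Y _ _; rewrite drop0.
  - by move=> q Ms e Y _ _; rewrite drop0.
  - move=> x u IH e [|b Y] //= o le; rewrite IH //; congr (_, _).
    by apply: atoms_ext => a; case: (e) => xs bs; rewrite rfun_cons.
by apply: comp_snd; apply: comp_trec; rewrite /hd /tl; comp_tac.
Qed.

Lemma comp_snames G (cG : coded G) (S : G -> seq atom) :
  computable S -> computable (fun g => snames (S g)).
Proof. by move=> hS; rewrite /snames; comp_tac. Qed.

Lemma comp_souts G (cG : coded G) (S : G -> seq atom) :
  computable S -> computable (fun g => souts (S g)).
Proof. by move=> hS; rewrite /souts; comp_tac. Qed.

Lemma comp_scalls G (cG : coded G) (S : G -> seq atom) :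
  computable S -> computable (fun g => scalls (S g)).
Proof. by move=> hS; rewrite /scalls; comp_tac. Qed.

Lemma comp_sren G (cG : coded G) (e : G -> seq nat * seq nat) (S : G -> seq atom) :
  computable e -> computable S -> computable (fun g => sren (rfun (e g)) (S g)).
Proof. by move=> he hS; rewrite /sren /aren; comp_tac. Qed.

Lemma comp_count_mem G (cG : coded G) (a : G -> atom) (S : G -> seq atom) :
  computable a -> computable S -> computable (fun g => count_mem (a g) (S g)).
Proof.
move=> ha hS; apply: (comp_ext (f := fun g => count (fun b => code b == code (a g)) (S g))).
  move=> g; apply: eq_count => b /=.
  (* The code of an atom is convertible to its [pickle], hence injective, and equality of atoms can
     be tested on codes. *)
  by rewrite (inj_eq (pcan_inj (@pickleK (nat * seq msg)%type))).
by comp_tac; apply: comp_code; comp_tac.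
Qed.

Ltac comp_user ::= first [match goal with
  | |- computable (fun u => count _ _) => apply: comp_count_mem
  | |- computable (fun u => iota _ _) => apply: comp_iota
  | |- computable (fun u => ubound _) => apply: comp_ubound
  | |- computable (fun u => rfun _ _) => apply: comp_rfun
  | |- computable (fun u => tuples _ _) => apply: comp_tuples
  | |- computable (fun u => sublists _) => apply: comp_sublists
  | |- computable (fun u => tfn _) => apply: comp_tfn
  | |- computable (fun u => kbound _ _) => apply: comp_kbound
  | |- computable (fun u => nbind _) => apply: comp_nbind
  | |- computable (fun u => ocount _) => apply: comp_ocount
  | |- computable (fun u => full _ _) => apply: comp_full
  | |- computable (fun u => unf _ _) => apply: comp_unf
  | |- computable (fun u => prune _ _) => apply: comp_prune
  | |- computable (fun u => prunable _ _) => apply: comp_prunable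
  | |- computable (fun u => snames _) => apply: comp_snames
  | |- computable (fun u => souts _) => apply: comp_souts
  | |- computable (fun u => scalls _) => apply: comp_scalls
  | |- computable (fun u => sren (rfun _) _) => apply: comp_sren
  end | comp_lists].

Lemma comp_atoms_iota G (cG : coded G) (t : G -> tmpl) (m : G -> nat) :
  (forall g, omfree (t g)) -> computable t -> computable m ->
  computable (fun g => atoms (t g) id (iota (m g) (nbind (t g)))).
Proof.
move=> of_t ht hm.
apply: (comp_ext (f := fun g => atoms (t g) id (take (nbind (t g)) (iota (m g) (nbind (t g)))))).
  by move=> g; rewrite take_oversize ?size_iota.
by apply: comp_atoms; comp_tac => g; rewrite size_iota.
Qed.

Variable derb : seq msg -> msg -> bool.
Hypothesis comp_derb : computable (fun u : seq msg * msg => derb u.1 u.2).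

Lemma comp_belowb G (cG : coded G) (S S' : G -> seq atom) :
  computable S -> computable S' -> computable (fun g => belowb derb (S g) (S' g)).
Proof. by move=> hS hS'; rewrite /belowb; comp_tac. Qed.

Lemma comp_check G (cG : coded G) (t : G -> tmpl) (S : G -> seq atom) :
  computable t -> computable S -> computable (fun g => check derb (t g) (S g)).
Proof.
move=> ht hS; rewrite /check /checkA; comp_tac.
apply: comp_belowb; first by comp_tac.
by apply: comp_atoms_iota => [g||]; [apply: omfree_full|comp_tac|comp_tac].
Qed.

Lemma comp_unfold_all G (cG : coded G) (t2 : G -> tmpl) (b : G -> nat) (t : G -> tmpl) :
  computable t2 -> computable b -> computable t ->
  computable (fun g => unfold_all (t2 g) (b g) (t g)).
Proof. by move=> h2 hb ht; rewrite /unfold_all /unfold_step /nunf; comp_tac. Qed.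

(* The padding makes the sequence of names long enough for the program that
   computes [atoms], whatever the length of X. *)
Lemma decideBE (t1 t2 : tmpl) B : decideB derb t1 t2 B =
  (let u := unfold_all t2 (size B) (prune B t1) in
  ~~ prunable B t1 ||
  all (fun X => [|| ~~ uniq X, has (fun x => x \in B) X
                 | check derb t2 (atoms u id (take (nbind u) (X ++ iota 0 (nbind u))))])
    (tuples (nbind u) (tfn t2 ++ iota (ubound (B ++ tfn t2)) (nbind u)))).
Proof.
rewrite /decideB; congr (_ || _); apply: eq_in_all => X /tuplesP[sz _].
by rewrite take_size_cat.
Qed.

Lemma comp_decide : computable (fun u : tmpl * tmpl => decide derb u.1 u.2).
Proof.
apply: (comp_ext (f := fun u => all (fun B => let u' := unfold_all u.2 (size B) (prune B u.1) in
  ~~ prunable B u.1 ||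
  all (fun X => [|| ~~ uniq X, has (fun x => x \in B) X
                 | check derb u.2 (atoms u' id (take (nbind u') (X ++ iota 0 (nbind u'))))])
    (tuples (nbind u') (tfn u.2 ++ iota (ubound (B ++ tfn u.2)) (nbind u'))))
  (sublists (tfn u.1)))).
  by move=> u; apply: eq_all => B; rewrite decideBE.
have hu (G : Type) (cG : coded G) (t1 t2 : G -> tmpl) (B : G -> seq nat) :
    computable t1 -> computable t2 -> computable B ->
    computable (fun g => unfold_all (t2 g) (size (B g)) (prune (B g) (t1 g))).
  by move=> h1 h2 hB; apply: comp_unfold_all; comp_tac.
cbv zeta; comp_tac; try by apply: hu; comp_tac.
apply: comp_check; first by comp_tac.
apply: comp_atoms.
- by move=> g; rewrite size_cat size_iota leq_addl.
- by move=> g; apply: omfree_unfold_all.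
- by apply: hu; comp_tac.
- by comp_tac; apply: hu; comp_tac.
Qed.
End Functions.

Lemma enc_tlim nc ar nq :
  (forall l : lim nc ar nq, enc_tmpl (tlim l) = enc_lim l) /\
  (forall r : rep nc ar nq, enc_tmpl (trep r) = enc_rep r) /\
  (forall b : blk nc ar nq, enc_tmpl (tblk b) = enc_blk b).
Proof.
by apply: lim_rep_blk_ind => //= [r -> l ->|b ->|b ->|x l ->].
Qed.

Theorem theorem3p8 (nc : nat) (ar : nat -> nat) (nq : nat)
  (der : seq (msg nc ar) -> msg nc ar -> Prop) :
  intruder_model der -> effective der -> absorbing der ->
  decidable2 (@code_lim nc ar nq) (@code_lim nc ar nq)
    (fun L1 L2 => forall P, den der L1 P -> den der L2 P).
Proof.
move=> model [pd hpd] abs.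
(* The Boolean test exists by classical logic; its computability is what effectiveness provides. *)
pose derb G M : bool := if excluded_middle_informative (der G M) then true else false.
have derP G M : reflect (der G M) (derb G M).
  by rewrite /derb; case: excluded_middle_informative => h; constructor.
have cder : computable (fun u : seq (msg nc ar) * msg nc ar => derb u.1 u.2).
  exists (PrComp pd [:: pr_hd; PrComp pr_hd [:: pr_tl]]) => -[G M] /=.
  apply: (@eval_comp2 _ _ _ _ (pickle G) (pickle M)).
  - exact: eval_hd.
  - by apply: eval_comp1 (eval_tl _ _) (eval_hd _ _).
  - by have [h1 h2] := hpd G M; case: (derP G M).
have [p hp] := comp_decide cder.
(* The two inputs are packed into the code of a pair. Limits and their templates have equal codes,
   so no translation is computed. *)
exists (PrComp p [:: PrComp pr_cons [:: PrProj 0; PrComp pr_cons [:: PrProj 1; PrZero]]]).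
move=> l1 l2.
have ev : eval (PrComp p [:: PrComp pr_cons [:: PrProj 0; PrComp pr_cons [:: PrProj 1; PrZero]]])
    [:: code_lim l1; code_lim l2] (decide derb (tlim l1) (tlim l2)).
  apply: eval_comp1 (hp (tlim l1, tlim l2)).
  have el (l : lim nc ar nq) : code (tlim l) = code_lim l.
    by rewrite /code /coded_tmpl (enc_tlim nc ar nq).1.
  apply: (eval_comp2 _ _ (eval_cons _ _)); first by apply: eval_proj; rewrite /= el.
  apply: (eval_comp2 _ _ (eval_cons _ _)); last by constructor.
  by apply: eval_proj; rewrite /= el.
have dP := decideP model derP abs (tlim l1) (tlim l2).
have incl := den_inclusion model l1 l2.
by split=> h; move: ev; case: dP => // /incl.
Qed.
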